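(* Let $(M,\tau)$ be a tracial von Neumann algebra and let $x=(x_1,\dots,x_r)\in M^r$ be a tuple generating $M$ as a von Neumann algebra which has a Galois bounded sequence of microstates. Then for all $m,n\in\mathbb N$ and every matrix polynomial $P\in M_{m,n}(\overline{\mathbb Q}\langle T_1,T_1^*,\dots,T_r,T_r^*\rangle)$ with algebraic coefficients, the Fuglede--Kadison pseudo-determinant of $P(x)\in M_{m,n}(M)$ is positive: $\det^+_M(P(x))>0$.
   Context: A tracial von Neumann algebra $(M,\tau)$ is a von Neumann algebra with a faithful normal tracial state. $\overline{\mathbb Q}$ is the field of algebraic numbers in $\mathbb C$, $\mathcal O$ the ring of algebraic integers in $\mathbb C$, and $\mathrm{Gal}(\overline{\mathbb Q}/\mathbb Q)$ the group of all field automorphisms of $\overline{\mathbb Q}$, acting entrywise on matrices over $\overline{\mathbb Q}$. $K\langle T_1,T_1^*,\dots,T_r,T_r^*\rangle$ denotes noncommutative $*$-polynomials with coefficients in $K$; a matrix of $*$-polynomials is evaluated entrywise: $(P(x))_{ij}=P_{ij}(x)$. A sequence $X^{(k)}\in M_{n(k)}(\mathbb C)$ ($n(k)\in\mathbb N$) is Galois bounded if all entries of all $X^{(k)}$ are algebraic integers, $\sup_k\max_{\sigma\in\mathrm{Gal}(\overline{\mathbb Q}/\mathbb Q)}\|\sigma(X^{(k)})\|<\infty$ (operator norm), and $\sup_k\#\{\sigma(X^{(k)}):\sigma\in\mathrm{Gal}(\overline{\mathbb Q}/\mathbb Q)\}<\infty$. A sequence of tuples $X^{(k)}\in M_{n(k)}(\mathbb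 C)^r$ is Galois bounded if each coordinate sequence $(X^{(k)}_j)_k$ is. It is a Galois bounded sequence of microstates for $x\in M^r$ if moreover $\mathrm{tr}_{n(k)}(Q(X^{(k)}))\to\tau(Q(x))$ for every $Q\in\mathbb C\langle T_1,T_1^*,\dots,T_r,T_r^*\rangle$, where $\mathrm{tr}_n$ is the normalized trace. For $y\in M_{m,n}(M)$, with $|y|=(y^*y)^{1/2}\in M_n(M)$ and $\mu_{|y|}$ the spectral measure of $|y|$ with respect to $\mathrm{tr}_n\otimes\tau$, set $\det^+_M(y)=\exp\big(n\int_{(0,\infty)}\log t\,d\mu_{|y|}(t)\big)$, with $\exp(-\infty)=0$. *)

(* Defs.v *)
From HB Require Import structures.
From mathcomp Require Import all_boot all_order all_algebra.
From mathcomp Require Import sesquilinear spectral mxpoly.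
From mathcomp Require Import finmap complex.
From mathcomp Require Import all_classical all_reals all_analysis.

Set Implicit Arguments.
Unset Strict Implicit.
Unset Printing Implicit Defensive.

Import Order.TTheory GRing.Theory Num.Theory Num.Def.
Import numFieldNormedType.Exports.

Local Open Scope classical_set_scope.
Local Open Scope complex_scope.
Local Open Scope ring_scope.
Local Open Scope sesquilinear_scope.

(* The complex numbers are [R[i]] for [R : realType]. *)

Section AlgebraicNumbers.
Variable R : realType.

Definition algnum_pred : {pred R[i]} :=
  [pred z | `[< algebraicOver (ratr : rat -> R[i]) z >]].

Lemma algnum_divring_closed : divring_closed algnum_pred.
Proof.
split; first by apply/asboolP; exact: algebraic1.
- by move=> x y /asboolP hx /asboolP hy; apply/asboolP; exact: algebraic_sub.
- by move=> x y /asboolP hx /asboolP hy; apply/asboolP; exact: algebraic_div.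
Qed.

HB.instance Definition _ :=
  GRing.isDivringClosed.Build R[i] algnum_pred algnum_divring_closed.

Record algnum := AlgNum { algnum_val :> R[i]; _ : algnum_val \in algnum_pred }.

HB.instance Definition _ := [isSub for algnum_val].
HB.instance Definition _ := [Choice of algnum by <:].
HB.instance Definition _ := [SubChoice_isSubComUnitRing of algnum by <:].
HB.instance Definition _ := [SubComUnitRing_isSubIntegralDomain of algnum by <:].
HB.instance Definition _ := [SubIntegralDomain_isSubField of algnum by <:].

(* The absolute Galois group of the rationals: a ring endomorphism of the
   field of algebraic numbers automatically fixes the rationals. *)
Definition galois_group : set {rmorphism algnum -> algnum} :=
  [set s : {rmorphism algnum -> algnum} | bijective s].

Definition algebraic_integer (z : R[i]) : Prop :=
  integralOver (intr : int -> R[i]) z.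

(* Only meaningful on matrices with algebraic entries: the other entries
   are sent to 0. *)
Definition galois_mx m n (s : {rmorphism algnum -> algnum})
    (A : 'M[R[i]]_(m, n)) : 'M[R[i]]_(m, n) :=
  map_mx (fun z => algnum_val (s (insubd 0 z))) A.

End AlgebraicNumbers.

(* Noncommutative *-polynomials in [r] variables with coefficients in [K]:
   the letter [(i, false)] stands for T_i, and [(i, true)] for T_i^*. *)
Definition star_word (r : nat) := seq ('I_r * bool).
Definition star_poly (K : nmodType) (r : nat) :=
  {fsfun star_word r -> K with (0 : K)}.

Definition eval_word (A : pzRingType) (star : A -> A) r (x : 'I_r -> A)
    (w : star_word r) : A :=
  \prod_(l <- w) (if l.2 then star (x l.1) else x l.1).

Definition star_eval (C : nzRingType) (K : nmodType) (iota : K -> C)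
    (A : algType C) (star : A -> A) r (x : 'I_r -> A) (Q : star_poly K r) : A :=
  \sum_(w <- finsupp Q) iota (Q w) *: eval_word star x w.

Definition star_eval_mx (C : nzRingType) (K : nmodType) (iota : K -> C)
    (A : algType C) (star : A -> A) r (x : 'I_r -> A) m n
    (P : 'M[star_poly K r]_(m, n)) : 'M[A]_(m, n) :=
  map_mx (star_eval iota star x) P.

Section GaloisBounded.
Variable R : realType.

Definition l2norm n (v : 'cV[R[i]]_n) : R :=
  Num.sqrt (\sum_i complex.Re `|v i 0| ^+ 2).

Definition opnorm n (A : 'M[R[i]]_n) : R :=
  sup [set l2norm (A *m v) | v in [set v | l2norm v <= 1]].

Definition galois_bounded (d : nat -> nat) (Y : forall k, 'M[R[i]]_(d k)) :=
  [/\ forall k i j, algebraic_integer (Y k i j),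
      exists c : R, forall k s, galois_group s ->
        opnorm (galois_mx s (Y k)) <= c
    & exists N : nat, forall k,
        ([set galois_mx s (Y k) | s in @galois_group R] #<= `I_N)%card].

Definition normalized_trace n (A : 'M[R[i]]_n) : R[i] := \tr A / n%:R.

End GaloisBounded.

Section VonNeumann.
Variable R : realType.

Section Commutant.
Variable H : completeNormedModType R[i].

Definition bounded_op (T : H -> H) : Prop := linear T /\ continuous T.

Definition commutant (A : set (H -> H)) : set (H -> H) :=
  [set S | bounded_op S /\ forall T, A T -> S \o T = T \o S].

Definition adjoint_of (dot : {dot H for conjC}) (T S : H -> H) : Prop :=
  forall u v, dot (T u) v = dot u (S v).

(* By the bicommutant condition, [A] is a unital algebra of bounded
   operators. *)
Definition von_neumann_set (dot : {dot H for conjC}) (A : set (H -> H)) : Prop :=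
  commutant (commutant A) = A /\
  (forall T, A T -> exists2 S, A S & adjoint_of dot T S).

End Commutant.

(* A von Neumann algebra is a complex *-algebra identified, by a faithful unital
   *-representation, with a von Neumann algebra of operators on a Hilbert
   space. *)
Record vonNeumannAlgebra := VonNeumannAlgebra {
  vN_alg :> algType R[i];
  vN_star : vN_alg -> vN_alg;
  vN_space : completeNormedModType R[i];
  vN_dot : {dot vN_space for conjC};
  vN_rep : vN_alg -> vN_space -> vN_space;
  _ : forall v, `|v| ^+ 2 = vN_dot v v;
  _ : forall (c : R[i]) a b v,
        vN_rep (c *: a + b) v = c *: vN_rep a v + vN_rep b v;
  _ : forall v, vN_rep 1 v = v;
  _ : forall a b v, vN_rep (a * b) v = vN_rep a (vN_rep b v);
  _ : forall a, adjoint_of vN_dot (vN_rep a) (vN_rep (vN_star a));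
  _ : injective vN_rep;
  _ : von_neumann_set vN_dot (range vN_rep) }.

Variable M : vonNeumannAlgebra.
Local Notation star := (@vN_star M).
Local Notation rep := (@vN_rep M).
Local Notation dot := (@vN_dot M).

Definition vN_generates r (x : 'I_r -> M) : Prop :=
  forall N : set (vN_space M -> vN_space M),
    von_neumann_set dot N -> (forall i, N (rep (x i))) -> range rep `<=` N.

Definition vN_le (a b : M) : Prop := exists c, b - a = star c * c.

Definition vN_lub (D : set M) (s : M) : Prop :=
  (forall a, D a -> vN_le a s) /\
  (forall t, (forall a, D a -> vN_le a t) -> vN_le s t).

Definition vN_directed (D : set M) : Prop :=
  D !=set0 /\
  forall a b, D a -> D b -> exists2 c, D c & vN_le a c /\ vN_le b c.

Definition vN_normal (tau : M -> R[i]) : Prop :=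
  forall (D : set M) (s : M), (forall a, D a -> star a = a) ->
    vN_directed D -> vN_lub D s ->
    forall c, (forall a, D a -> tau a <= c) -> tau s <= c.

Definition faithful_normal_tracial_state (tau : {scalar M}) : Prop :=
  [/\ (forall a, 0 <= tau (star a * a)) /\ tau 1 = 1,
      forall a, tau (star a * a) = 0 -> a = 0,
      vN_normal tau
    & forall a b, tau (a * b) = tau (b * a)].

Variable tau : {scalar M}.

Definition has_galois_bounded_microstates r (x : 'I_r -> M) : Prop :=
  exists (d : nat -> nat) (X : forall k, 'I_r -> 'M[R[i]]_((d k).+1)),
    (forall j, galois_bounded (fun k => X k j)) /\
    (forall Q : star_poly R[i] r,
       (fun k => normalized_trace
          (star_eval id (fun A => A ^t*) (X k) Q) : R[i]^o) @ \oo -->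
       (tau (star_eval id star x Q) : R[i]^o)).

Definition vN_adjmx m n (y : 'M[M]_(m, n)) : 'M[M]_(n, m) := map_mx star y^T.

Definition vN_abs m n (y : 'M[M]_(m, n)) (a : 'M[M]_n) : Prop :=
  (exists b : 'M[M]_n, a = vN_adjmx b *m b) /\ a *m a = vN_adjmx y *m y.

(* The functional tr_n \otimes tau on M_n(M). *)
Definition vN_mxtrace n (a : 'M[M]_n) : R[i] := (\sum_i tau (a i i)) / n%:R.

(* The quadratic form <a xi, xi> of [a], for the action of M_n(M) on the
   [n]-fold direct sum of the Hilbert space. *)
Definition vN_quad n (a : 'M[M]_n) (xi : 'I_n -> vN_space M) : R[i] :=
  \sum_i dot (\sum_j rep (a i j) (xi j)) (xi i).

(* [E] is the projection-valued spectral measure of the self-adjoint [a]. As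
   [a] and the [E B] are self-adjoint, the quadratic forms are real and
   determine the operators. *)
Definition spectral_resolution n (a : 'M[M]_n)
    (E : set (measurableTypeR R) -> 'M[M]_n) : Prop :=
  [/\ forall B, measurable B -> vN_adjmx (E B) = E B,
      E setT = 1%:M,
      forall A B, measurable A -> measurable B -> E (A `&` B) = E A *m E B
    & forall xi, exists nu : {measure set (measurableTypeR R) -> \bar R},
        [/\ forall B, measurable B -> nu B = (complex.Re (vN_quad (E B) xi))%:E,
            nu.-integrable setT (fun t : R => t%:E)
          & (\int[nu]_t (t%:E) = (complex.Re (vN_quad a xi))%:E)%E]].

Definition spectral_measure n (a : 'M[M]_n)
    (mu : {measure set (measurableTypeR R) -> \bar R}) : Prop :=
  exists2 E, spectral_resolution a E &
    forall B, measurable B -> mu B = (complex.Re (vN_mxtrace (E B)))%:E.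

(* A relation rather than a function: that |y| and its spectral measure exist
   and are unique is the spectral theorem, which is not available here. [ln t]
   is bounded above on the support of [mu], so the integral lies in
   [-oo, +oo[, and [expeR -oo = 0]. *)
Definition is_FK_pseudodet m n (y : 'M[M]_(m, n)) (d : \bar R) : Prop :=
  exists a mu, [/\ vN_abs y a, spectral_measure a mu
    & d = expeR (n%:R%:E * \int[mu]_(t in `]0%R, +oo[) (ln t)%:E)%E].

End VonNeumann.

(* Main.v *)
(** Let [h = P(x)^* P(x)] and [h_k = P(X_k)^* P(X_k)], with the denominators of
    [P] cleared. The product of the nonzero eigenvalues of [h_k] is a
    coefficient of its characteristic polynomial, hence a nonzero algebraic
    integer. Galois boundedness bounds the number of its conjugates by a
    constant and their size exponentially in the dimension; their product being
    a nonzero integer, the normalized logarithm of the product of the nonzero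
    eigenvalues is bounded below uniformly in [k]. So are the normalized traces
    of [- q_J(h_k / C)], where the polynomials [q_J] vanish at [0] and tend to
    [- ln] on [(0, 1]] up to constants. As [q_J] is a polynomial, the bound on
    its trace passes to the limit [h], and comparing [q_J(h / C)] with the
    spectral projections [E_i] of [|P(x)|] for the intervals
    [(2^-(i+1), 2^-i]] shows that the sum of the [i * tau(E_i)] is finite. *)

Require Import Defs.
From HB Require Import structures.
From mathcomp Require Import all_boot all_order all_algebra.
From mathcomp Require Import sesquilinear spectral mxpoly separable.
From mathcomp Require Import finmap complex ring lra.
From mathcomp Require Import all_classical all_reals all_analysis.
From mathcomp Require Import measurable_realfun.

Set Implicit Arguments.
Unset Strict Implicit.
Unset Printing Implicit Defensive.

Import Order.TTheory GRing.Theory Num.Theory Num.Def.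
Import numFieldNormedType.Exports.

Local Open Scope classical_set_scope.
Local Open Scope complex_scope.
Local Open Scope ring_scope.
Local Open Scope sesquilinear_scope.

(** * Extending embeddings of the algebraic numbers *)

Section Extension.
Variable L : fieldType.

(* The graph of a ring homomorphism to [L] from a subring of [L]. *)
Definition hom_graph (G : set (L * L)) : Prop :=
  [/\ G (1, 1),
      forall x y, G x -> G y -> G (x.1 - y.1, x.2 - y.2),
      forall x y, G x -> G y -> G (x.1 * y.1, x.2 * y.2)
    & forall b, G (0, b) -> b = 0].

Section Graph.
Variables (G : set (L * L)) (GP : hom_graph G).

Lemma graph0 : G (0, 0).
Proof. by case: GP => G1 GB _ _; have := GB _ _ G1 G1; rewrite /= !subrr. Qed.

Lemma graphN x y : G (x, y) -> G (- x, - y).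
Proof.
by case: GP => _ GB _ _ Gx; have := GB _ _ graph0 Gx; rewrite /= !sub0r.
Qed.

Lemma graphD x y z t : G (x, y) -> G (z, t) -> G (x + z, y + t).
Proof.
case: (GP) => _ GB _ _ Gx /graphN Gz; have := GB _ _ Gx Gz.
by rewrite /= !opprK.
Qed.

Lemma graphM x y z t : G (x, y) -> G (z, t) -> G (x * z, y * t).
Proof. by case: GP => _ _ GM _ Gx Gz; exact: (GM _ _ Gx Gz). Qed.

Lemma graph_inj x y z : G (x, y) -> G (x, z) -> y = z.
Proof.
case: GP => _ GB _ Gf Gx Gz; have := GB _ _ Gx Gz; rewrite /= subrr => /Gf.
by move/eqP; rewrite subr_eq0 => /eqP.
Qed.

Lemma graph_sum (I : Type) (s : seq I) (P : pred I) (F H : I -> L) :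
  (forall i, P i -> G (F i, H i)) ->
  G (\sum_(i <- s | P i) F i, \sum_(i <- s | P i) H i).
Proof.
move=> GFH; elim: s => [|i s IH]; first by rewrite !big_nil; exact: graph0.
by rewrite !big_cons; case: ifP => // Pi; apply: graphD => //; apply: GFH.
Qed.

Lemma graph_exp x y n : G (x, y) -> G (x ^+ n, y ^+ n).
Proof.
move=> Gx; elim: n => [|n IH]; first by rewrite !expr0; case: GP.
by rewrite !exprS; exact: graphM.
Qed.

Lemma graph_int (z : int) : G (z%:~R, z%:~R).
Proof.
have Gn n : G (n%:R, n%:R).
  elim: n => [|n IH]; first exact: graph0.
  by rewrite -addn1 !natrD; apply: graphD => //; case: GP.
by case: z => n; rewrite ?NegzE ?mulrNz; [|apply: graphN]; exact: Gn.
Qed.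

Definition graph_poly (p q : {poly L}) := forall i, G (p`_i, q`_i).

Lemma graph_polyM p q r s :
  graph_poly p q -> graph_poly r s -> graph_poly (p * r) (q * s).
Proof.
by move=> pq rs i; rewrite !coefM; apply: graph_sum => j _; exact: graphM.
Qed.

Lemma graph_polyB p q r s :
  graph_poly p q -> graph_poly r s -> graph_poly (p - r) (q - s).
Proof.
by move=> pq rs i; rewrite !coefB; apply: graphD; [|apply: graphN].
Qed.

Lemma graph_poly_eq0 p q : graph_poly p q -> p = 0 -> q = 0.
Proof.
move=> pq p0; apply/polyP => i; have := pq i; rewrite p0 !coef0.
by case: GP => _ _ _; apply.
Qed.

Lemma graph_polyXn n : graph_poly 'X^n 'X^n.
Proof. by move=> i; rewrite !coefXn; exact: (graph_int (i == n)). Qed.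

Lemma graph_polyC x y : G (x, y) -> graph_poly x%:P y%:P.
Proof. by move=> Gx i; rewrite !coefC; case: ifP => // _; exact: graph0. Qed.

Lemma graph_horner p q x y : graph_poly p q -> G (x, y) -> G (p.[x], q.[y]).
Proof.
move=> pq Gx; rewrite (horner_coef_wide _ (leq_maxl (size p) (size q))).
rewrite (horner_coef_wide _ (leq_maxr (size p) (size q))).
by apply: graph_sum => i _; apply: graphM => //; exact: graph_exp.
Qed.

(* The graph of the extension that sends [g] to [d]. *)
Definition graph_adjoin g d : set (L * L) :=
  [set z | exists p q, [/\ graph_poly p q, z.1 = p.[g] & z.2 = q.[d]]].

Lemma sub_graph_adjoin g d : G `<=` graph_adjoin g d.
Proof.
by move=> [x y] /graph_polyC Gx; exists x%:P, y%:P; rewrite /= !hornerC.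
Qed.

Lemma graph_adjoin_self g d : graph_adjoin g d (g, d).
Proof.
by exists 'X, 'X; rewrite /= !hornerX; split => //; exact: (graph_polyXn 1).
Qed.

Lemma hom_graph_adjoin g d :
  (forall p q, graph_poly p q -> p.[g] = 0 -> q.[d] = 0) ->
  hom_graph (graph_adjoin g d).
Proof.
move=> gd; split => [|[x y] [z t]|[x y] [z t]|b] /=.
- by apply: sub_graph_adjoin; case: GP.
- move=> [p [q [pq /= -> ->]]] [r [s [rs /= -> ->]]].
  exists (p - r), (q - s); rewrite !hornerD !hornerN; split => //.
  exact: graph_polyB.
- move=> [p [q [pq /= -> ->]]] [r [s [rs /= -> ->]]].
  by exists (p * r), (q * s); rewrite !hornerM; split => //; exact: graph_polyM.
- by move=> [p [q [pq /= /esym pg ->]]]; exact: gd pq pg.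
Qed.

End Graph.

Hypothesis algebraicL :
  forall x : L, exists2 p : {poly int}, p != 0 & (map_poly intr p).[x] = 0.
Hypothesis closedL : forall p : {poly L}, (1 < size p)%N -> exists x, root p x.
Hypothesis charL : injective (intr : int -> L).

Lemma map_intpoly_eq0 (p : {poly int}) :
  (map_poly (intr : int -> L) p == 0) = (p == 0).
Proof.
rewrite -!size_poly_eq0 size_map_inj_poly//.
Qed.

Lemma int_annihilator (x : L) : x != 0 ->
  exists2 p : {poly int}, (map_poly intr p).[x] = 0 & p`_0 != 0.
Proof.
move=> x0; have [p] := algebraicL x; have [n] := ubnP (size p).
elim: n p => // n IH p; rewrite ltnS => szp p0 px.
have [p00|p00] := eqVneq p`_0 0; last by exists p.
have pX : p = drop_poly 1 p * 'X.
  rewrite -{1}[p](poly_take_drop 1) -[X in X + _ = _]/(take_poly 1 p).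
  suff -> : take_poly 1 p = 0 by rewrite add0r expr1.
  by apply/polyP => -[|i]; rewrite coef_take_poly coef0.
have d0 : drop_poly 1 p != 0.
  by apply: contraNneq p0 => d0; rewrite pX d0 mul0r.
apply: (IH (drop_poly 1 p)) => //.
  rewrite size_drop_poly; apply: leq_trans szp.
  by rewrite subn1 prednK// lt0n size_poly_eq0.
move: px; rewrite {1}pX rmorphM /= map_polyX hornerM hornerX => /eqP.
by rewrite mulf_eq0 (negPf x0) orbF => /eqP.
Qed.

Lemma graph_int_poly G (GP : hom_graph G) (p : {poly int}) :
  graph_poly G (map_poly intr p) (map_poly intr p).
Proof. by move=> i; rewrite !coef_map /=; exact: graph_int. Qed.

Lemma graph_neq0 G (GP : hom_graph G) x y : G (x, y) -> x != 0 -> y != 0.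
Proof.
move=> Gxy /int_annihilator[p px p0]; apply: contra_neq p0 => y0.
have := graph_horner GP (graph_int_poly GP p) Gxy; rewrite px y0.
case: (GP) => _ _ _ /[apply]; rewrite horner_coef0 coef_map /= => h.
exact: charL.
Qed.

Definition graph_inverse (G : set (L * L)) a b : set (L * L) :=
  [set z | exists x y n, [/\ G (x, y), z.1 = x / a ^+ n & z.2 = y / b ^+ n]].

Lemma hom_graph_inverse G (GP : hom_graph G) a b : G (a, b) -> a != 0 ->
  hom_graph (graph_inverse G a b).
Proof.
move=> Gab a0; have b0 := graph_neq0 GP Gab a0.
have [a0n b0n] : (forall n, a ^+ n != 0) /\ (forall n, b ^+ n != 0).
  by split => n; rewrite expf_neq0.
split => [|[x y] [z t]|[x y] [z t]|c] /=.
- by exists 1, 1, 0; rewrite !expr0 !divr1; split => //; case: GP.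
- move=> [x1 [x2 [n [Gx /= -> ->]]]] [y1 [y2 [m [Gy /= -> ->]]]].
  exists (x1 * a ^+ m - y1 * a ^+ n), (x2 * b ^+ m - y2 * b ^+ n), (n + m)%N.
  rewrite /= !exprD; split.
  + by apply: (graphD GP); [|apply: (graphN GP)]; apply: (graphM GP) => //;
      apply: (graph_exp GP).
  + by rewrite -mulNr addf_div // mulNr.
  + by rewrite -mulNr addf_div // mulNr.
- move=> [x1 [x2 [n [Gx /= -> ->]]]] [y1 [y2 [m [Gy /= -> ->]]]].
  exists (x1 * y1), (x2 * y2), (n + m)%N; split; first exact: (graphM GP).
  + by rewrite /= exprD invfM mulrACA.
  + by rewrite /= exprD invfM mulrACA.
- move=> [x [y [n [Gxy /= /esym/eqP]]]].
  rewrite mulf_eq0 invr_eq0 (negPf (a0n _)) orbF => /eqP x0 ->.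
  by move: Gxy; rewrite x0; case: (GP) => _ _ _ /[apply] ->; rewrite mul0r.
Qed.

Lemma graph_inverse_closed G (GP : hom_graph G) :
  (forall H, hom_graph H -> G `<=` H -> H `<=` G) ->
  forall a b, G (a, b) -> G (a^-1, b^-1).
Proof.
move=> Gmax a b Gab; have [a0|a0] := eqVneq a 0.
  case: (GP) => _ _ _ /(_ b); rewrite -a0 => /(_ Gab) ->.
  by rewrite a0 !invr0; exact: graph0.
apply: (Gmax _ (hom_graph_inverse GP Gab a0)).
  by move=> [x y] Gxy; exists x, y, 0; rewrite !expr0 !divr1.
by exists 1, 1, 1; rewrite !expr1 !mul1r; split => //; case: GP.
Qed.

Lemma hom_graph_total G (GP : hom_graph G) :
  (forall H, hom_graph H -> G `<=` H -> H `<=` G) ->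
  forall g, exists d, G (g, d).
Proof.
move=> Gmax g; pose ann n := `[< exists p q, [/\ graph_poly G p q, p != 0,
  p.[g] = 0 & size p = n] >].
have [n0 ann0] : exists n, ann n.
  have [p p0 pg] := algebraicL g.
  exists (size (map_poly (intr : int -> L) p)); apply/asboolP.
  exists (map_poly intr p), (map_poly intr p); split => //.
    exact: graph_int_poly.
  by rewrite map_intpoly_eq0.
have [n /asboolP[p0 [q0 [pq0 p0n0 p0g szp0]]] nmin] :=
  ex_minnP (ex_intro _ n0 ann0).
have Glc : G (lead_coef p0, q0`_(size p0).-1) by rewrite lead_coefE.
pose p := (lead_coef p0)^-1 *: p0; pose q := (q0`_(size p0).-1)^-1 *: q0.
have lp0 : lead_coef p0 != 0 by rewrite lead_coef_eq0.
have pq : graph_poly G p q.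
  rewrite /p /q -!mul_polyC; apply: (graph_polyM GP) => //.
  by apply: graph_polyC => //; apply: (graph_inverse_closed GP).
have szp : size p = n by rewrite size_scale ?invr_eq0.
have pg : p.[g] = 0 by rewrite hornerZ p0g mulr0.
have n1 : (1 < n)%N.
  rewrite -szp0 ltnNge; apply: contraNN p0n0 => /size1_polyC p0C.
  by move: p0g; rewrite p0C hornerC => ->.
have [pm qm] : p`_n.-1 = 1 /\ q`_n.-1 = 1.
  have pm : p`_n.-1 = 1 by rewrite coefZ -szp0 -lead_coefE mulVf.
  split => //; apply: (graph_inj GP) (pq n.-1) _; rewrite pm.
  by case: GP.
have szq : (1 < size q)%N.
  apply: (leq_trans n1); rewrite leqNgt; apply/negP => szq.
  move: qm; rewrite nth_default => [/eqP|]; first by rewrite eq_sym oner_eq0.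
  by rewrite -ltnS prednK// (ltn_trans _ n1).
have [d /eqP dq] := closedL szq; exists d.
apply: (Gmax (graph_adjoin G g d)); last exact: (graph_adjoin_self GP).
  apply: (hom_graph_adjoin GP) => u v; have [m] := ubnP (size u).
  elim: m u v => // m IH u v; rewrite ltnS => szu uv ug.
  have [u0|u0] := eqVneq u 0.
    by rewrite (graph_poly_eq0 GP uv u0) horner0.
  have nu : (n <= size u)%N by apply: nmin; apply/asboolP; exists u, v.
  pose k := (size u - n)%N; pose x := lead_coef u; pose y := v`_(size u).-1.
  have Gxy : G (x, y) by rewrite /x lead_coefE.
  pose u' := u - x%:P * ('X^k * p); pose v' := v - y%:P * ('X^k * q).
  have uv' : graph_poly G u' v'.
    apply: (graph_polyB GP) => //; apply: (graph_polyM GP).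
      exact: graph_polyC.
    by apply: (graph_polyM GP) => //; exact: graph_polyXn.
  have u'g : u'.[g] = 0.
    by rewrite /u' hornerD hornerN ug !hornerM pg !mulr0 subr0.
  have szu' : (size u' < m)%N.
    have su0 : (0 < size u)%N by rewrite lt0n size_poly_eq0.
    apply: leq_ltn_trans (_ : ((size u).-1 < m)%N); last by rewrite prednK.
    apply/leq_sizeP => j lej; rewrite coefB coefCM coefXnM.
    have lek : (k <= j)%N.
      apply: leq_trans lej; rewrite /k -subn1 leq_sub2l //.
      exact: ltnW.
    rewrite ltnNge lek /=; have [ej|nej] := eqVneq j (size u).-1.
      have -> : (j - k)%N = n.-1.
        by rewrite ej /k -subn1 subnAC subKn// subn1.
      by rewrite pm mulr1 ej /x lead_coefE subrr.
    have {nej lej}lej : (size u <= j)%N.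
      by rewrite -(prednK su0) ltn_neqAle eq_sym nej.
    rewrite !nth_default ?mulr0 ?subr0// szp -(subKn nu).
    exact: leq_sub2r.
  have := IH _ _ szu' uv' u'g.
  by rewrite /v' hornerD hornerN !hornerM dq !mulr0 subr0.
exact: (sub_graph_adjoin GP).
Qed.

Lemma Zorn_above (G0 : set (L * L)) (F : set (set (L * L))) :
  F G0 -> (forall C, C !=set0 -> C `<=` F -> total_on C subset ->
    F (\bigcup_(X in C) X)) ->
  exists G, [/\ F G, G0 `<=` G & forall H, F H -> G `<=` H -> H `<=` G].
Proof.
move=> FG0 Fc; pose F' := [set G | G = set0 \/ (F G /\ G0 `<=` G)].
have [|G [F'G Gmax]] := @Zorn_bigcup _ F'.
  move=> C CF' Ctot; have [C0|] := pselect (C `<=` [set set0]).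
    by left; apply/seteqP; split => // z [X /C0 ->].
  move=> /existsNP[X /not_implyP[CX X0]].
  pose C' := [set X | C X /\ X <> set0].
  have -> : \bigcup_(X in C) X = \bigcup_(X in C') X.
    apply/seteqP; split => [z [Y CY Yz]|z [Y [CY _] Yz]]; exists Y => //.
    by split => // Y0; move: Yz; rewrite Y0.
  right; split.
    apply: Fc.
    - by exists X.
    - by move=> Y [CY Y0]; have [|[]] := CF' _ CY.
    - by move=> Y Z [CY _] [CZ _]; apply: Ctot.
  have [//|[_ G0X]] := CF' _ CX.
  by move=> z /G0X Xz; exists X.
have max H : F' H -> G `<=` H -> H `<=` G.
  move=> FH GH; have [//|nHG] := pselect (H `<=` G).
  by case: (Gmax H (conj GH nHG) FH).
case: F'G => [G0'|[FG G0G]].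
  exists G0; split => // H FH G0H; apply: (@subset_trans _ G); last by rewrite G0'.
  by apply: (max H); [right; split|rewrite G0'].
exists G; split => // H FH GH; apply: max => //; right; split => //.
exact: subset_trans GH.
Qed.

Lemma hom_graph_bigcup (C : set (set (L * L))) : C !=set0 ->
  C `<=` hom_graph -> total_on C subset -> hom_graph (\bigcup_(X in C) X).
Proof.
move=> [X0 CX0] Ch Ctot.
have C2 x y : (\bigcup_(X in C) X) x -> (\bigcup_(X in C) X) y ->
    exists X, [/\ C X, X x & X y].
  move=> [X CX Xx] [Y CY Yy]; have [XY|YX] := Ctot _ _ CX CY.
    by exists Y; split => //; exact: XY.
  by exists X; split => //; exact: YX.
split => [|x y /C2 /[apply]|x y /C2 /[apply]|b].
- by exists X0 => //; case: (Ch _ CX0).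
- by move=> [X [CX Xx Xy]]; exists X => //; case: (Ch _ CX) => _ + _ _; apply.
- by move=> [X [CX Xx Xy]]; exists X => //; case: (Ch _ CX) => _ _ + _; apply.
- by move=> [X CX]; case: (Ch _ CX) => _ _ _; exact.
Qed.

Lemma endomorphism_extension (a b : L) :
  (forall p : {poly int}, (map_poly intr p).[a] = 0 ->
     (map_poly intr p).[b] = 0) ->
  exists s : {rmorphism L -> L}, s a = b.
Proof.
move=> ab; pose G0 : set (L * L) := [set z | exists p : {poly int},
  z.1 = (map_poly intr p).[a] /\ z.2 = (map_poly intr p).[b]].
have hG0 : hom_graph G0.
  split => [|[x y] [z t]|[x y] [z t]|c] /=.
  - by exists 1; rewrite -polyC1 !map_polyC !hornerC.
  - move=> [p [/= -> ->]] [q [/= -> ->]]; exists (p - q).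
    by rewrite rmorphB /= !hornerD !hornerN.
  - move=> [p [/= -> ->]] [q [/= -> ->]]; exists (p * q).
    by rewrite rmorphM /= !hornerM.
  - by move=> [p [/= /esym/ab + ->]].
have [G [GP G0G Gmax]] := Zorn_above hG0 hom_graph_bigcup.
have [f fP] := choice (hom_graph_total GP Gmax).
have fE x y : G (x, y) -> f x = y by apply: graph_inj.
have fB : zmod_morphism f.
  move=> x y; apply: fE; apply: graphD => //; exact: graphN.
have fM : monoid_morphism f.
  split; first by apply: fE; case: GP.
  by move=> x y; apply: fE; exact: graphM.
pose fa := GRing.isZmodMorphism.Build _ _ f fB.
pose fm := GRing.isMonoidMorphism.Build _ _ f fM.
pose s : {rmorphism L -> L} := HB.pack f fa fm.
exists s; apply: fE; apply: G0G; exists 'X.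
by rewrite map_polyX !hornerX.
Qed.

Lemma endomorphism_bijective (s : {rmorphism L -> L}) : bijective s.
Proof.
have inj : injective s by exact: fmorph_inj.
suff surj y : exists x, s x = y.
  have [g gK] := choice surj; exists g => // x; apply: inj.
  exact: gK.
have [p p0 py] := algebraicL y.
pose P := map_poly (intr : int -> L) p.
have P0 : P != 0 by rewrite map_intpoly_eq0.
have sP x : P.[x] = 0 -> P.[s x] = 0.
  move=> Px; have := rmorph0 s; rewrite -Px -horner_map /= -map_poly_comp.
  by rewrite (eq_map_poly (_ : _ =1 intr)) // => z /=; rewrite rmorph_int.
pose n := (size P).-1; have Sn : n.+1 = size P by rewrite prednK// lt0n
  size_poly_eq0.
have itP i : P.[iter i s y] = 0 by elim: i => //= i; exact: sP.
have nuniq : ~~ uniq (traject s y n.+1).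
  have rt : all (root P) (traject s y n.+1).
    by apply/allP => _ /trajectP[i _ ->]; apply/eqP.
  by apply/negP => /(max_poly_roots P0 rt); rewrite size_traject Sn ltnn.
move: nuniq; rewrite looping_uniq negbK => /trajectP[i lti].
have itI : injective (iter i s) by elim: i {lti} => // i IH x z /inj/IH.
rewrite -(subnK (ltnW lti)) addnC iterD => /itI.
by rewrite -(prednK (_ : 0 < n - i)%N) ?subn_gt0//= => <-;
  exists (iter (n - i).-1 s y).
Qed.
End Extension.

(** * A lower bound for algebraic integers *)

Section AlgnumVal.
Variable R : realType.

Fact algnum_val_zmod_morphism : zmod_morphism (@algnum_val R).
Proof. exact: (raddfB (\val : algnum R -> R[i])). Qed.

Fact algnum_val_monoid_morphism : monoid_morphism (@algnum_val R).
Proof.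
split; first exact: (rmorph1 (\val : algnum R -> R[i])).
exact: (rmorphM (\val : algnum R -> R[i])).
Qed.

HB.instance Definition _ := GRing.isZmodMorphism.Build (algnum R) R[i]
  (@algnum_val R) algnum_val_zmod_morphism.
HB.instance Definition _ := GRing.isMonoidMorphism.Build (algnum R) R[i]
  (@algnum_val R) algnum_val_monoid_morphism.
End AlgnumVal.

Section Algnum.
Variable R : realType.
Local Notation L := (algnum R).
Local Notation val := (@algnum_val R).

Lemma val_horner_int (p : {poly int}) (x : L) :
  val (map_poly intr p).[x] = (map_poly intr p).[val x].
Proof.
rewrite -horner_map -map_poly_comp.
by congr (_.[_]); apply: eq_map_poly => z /=; rewrite rmorph_int.
Qed.

Lemma algnum_charL : injective (intr : int -> L).
Proof.
move=> x y xy; apply: (@intr_inj R[i]).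
by have := congr1 val xy; rewrite !rmorph_int.
Qed.

Lemma algebraic_int (z : R[i]) : z \in @algnum_pred R ->
  exists2 p : {poly int}, p != 0 & (map_poly intr p).[z] = 0.
Proof.
move=> /asboolP[p p0 /eqP pz]; have [q [a a0 pE]] := rat_poly_scale p; exists q.
  by apply: contra_neq p0 => q0; rewrite pE q0 rmorph0 scaler0.
apply/eqP; move: pz; rewrite pE linearZ /= hornerZ -map_poly_comp => /eqP.
rewrite mulf_eq0 fmorph_eq0 invr_eq0 intr_eq0 (negPf a0) /= => /eqP <-.
apply/eqP; congr (_.[_]); apply: eq_map_poly => t /=.
by rewrite ratr_int.
Qed.

Lemma algnum_algebraic (x : L) :
  exists2 p : {poly int}, p != 0 & (map_poly intr p).[x] = 0.
Proof.
have [p p0 px] := algebraic_int (valP x); exists p => //.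
by apply: (val_inj : injective (\val : L -> R[i]));
  rewrite rmorph0 -px /= val_horner_int.
Qed.

Lemma root_algnum (p : {poly L}) (z : R[i]) :
  p != 0 -> root (map_poly val p) z -> z \in @algnum_pred R.
Proof.
move=> p0 pz; apply/asboolP/integral_algebraic; apply: integral_root pz _.
  by rewrite map_poly_eq0.
move=> y /(nthP 0)[i _ <-]; apply/integral_algebraic; rewrite coef_map.
exact/asboolP/(valP p`_i).
Qed.

Lemma algnum_closed (p : {poly L}) : (1 < size p)%N -> exists x, root p x.
Proof.
move=> szp; have p0 : p != 0 by apply: contraTneq szp => ->; rewrite size_poly0.
have /closed_rootP[z pz] : size (map_poly val p) != 1%N.
  by rewrite size_map_poly; case: (size p) szp => [|[]].
exists (AlgNum (root_algnum p0 pz)); apply/eqP.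
apply: (val_inj : injective (\val : L -> R[i])); rewrite rmorph0 /= -horner_map.
by apply/eqP.
Qed.

Lemma galois_groupP (s : {rmorphism L -> L}) : galois_group s.
Proof. exact: (endomorphism_bijective algnum_algebraic algnum_charL). Qed.

(* Gauss: the minimal polynomial of an algebraic integer over the rationals
   has integer coefficients. *)
Lemma integral_minpoly (c : L) : algebraic_integer (val c) ->
  exists2 F : {poly int}, lead_coef F \is a GRing.unit &
    forall p : {poly int}, (map_poly intr p).[c] = 0 <-> exists r, p = F * r.
Proof.
move=> [g gm gc].
pose ann n := `[< exists p : {poly int}, [/\ p != 0, (map_poly intr p).[c] = 0
  & size p = n] >].
have [n0 ann0] : exists n, ann n.
  have [p p0 pc] := algnum_algebraic c.
  by exists (size p); apply/asboolP; exists p.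
have [n /asboolP[f [f0 fc szf]] nmin] := ex_minnP (ex_intro _ n0 ann0).
have fdiv (p : {poly int}) : (map_poly intr p).[c] = 0 ->
  exists r, p = zprimitive f * r.
  move=> pc; suff fp : f %| p by have [r] := dvdpP_int fp; exists r.
  apply/Pdiv.Idomain.modp_eq0P/eqP; apply: contraT => m0.
  have : (n <= size (p %% f)%R)%N.
    apply: nmin; apply/asboolP; exists (p %% f)%R; split => //.
    have /esym/(canRL (addKr _)) -> := Pdiv.Idomain.divp_eq p f.
    rewrite rmorphD rmorphN rmorphM /= linearZ /= hornerD hornerN hornerM hornerZ.
    by rewrite fc pc !mulr0 oppr0 addr0.
  by rewrite leqNgt -szf Pdiv.Idomain.ltn_modp f0.
have Fc : (map_poly intr (zprimitive f)).[c] = 0.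
  move: fc; rewrite {1}[f]zpolyEprim linearZ /= hornerZ => /eqP.
  rewrite mulf_eq0 -[0 in X in X || _](rmorph0 intr) (inj_eq algnum_charL).
  by rewrite zcontents_eq0 (negPf f0) => /eqP.
exists (zprimitive f).
  have [|r gE] := fdiv g.
    apply: (val_inj : injective (\val : L -> R[i]));
      rewrite rmorph0 /= val_horner_int.
    exact/eqP.
  apply/unitrPr; exists (lead_coef r); rewrite -lead_coefM -gE.
  exact/eqP.
move=> p; split => [/fdiv//|[r ->]].
by rewrite rmorphM /= hornerM Fc mul0r.
Qed.

(* [f] is injective on the conjugates of [c], which thus number at most [N];
   their product is a nonzero integer. *)
Lemma conjugate_norm_bound (c : L) (B : R) (N : nat) (f : {rmorphism L ->
  L} -> 'I_N) :
  c != 0 -> algebraic_integer (val c) -> 1 <= B ->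
  (forall s : {rmorphism L -> L}, `|val (s c)| <= B%:C) ->
  (forall s t : {rmorphism L -> L}, f s = f t -> s c = t c) ->
  1 <= `|val c| * B%:C ^+ N.
Proof.
move=> c0 ci B1 cB fc; have [F lF Fdiv] := integral_minpoly ci.
pose P := map_poly (intr : int -> R[i]) F.
have F0 : F != 0 by apply: contraTneq lF => ->; rewrite lead_coef0 unitr0.
have Fc : (map_poly intr F).[c] = 0 by apply/Fdiv; exists 1; rewrite mulr1.
have conjP z : root P z -> exists s : {rmorphism L -> L}, val (s c) = z.
  move=> Pz; have za : z \in @algnum_pred R.
    apply: (@root_algnum (map_poly intr F)).
      by rewrite map_intpoly_eq0//; exact: algnum_charL.
    rewrite -map_poly_comp; move: Pz; congr (root _ _).
    by apply: eq_map_poly => t /=; rewrite rmorph_int.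
  have [|s sc] := @endomorphism_extension _ algnum_algebraic algnum_closed
    algnum_charL c (AlgNum za); last by exists s; rewrite sc.
  move=> p /Fdiv[r ->]; apply: (val_inj : injective (\val : L -> R[i])).
  rewrite rmorph0 /= val_horner_int /= rmorphM hornerM.
  by move/eqP: Pz => ->; rewrite mul0r.
have lP : lead_coef P = (lead_coef F)%:~R by rewrite lead_coef_map_inj//;
  exact: intr_inj.
have P0 : P != 0 by rewrite -lead_coef_eq0 lP intr_eq0 lead_coef_eq0.
have [rs Prs] := closed_field_poly_normal P.
have rsP z : (z \in rs) = root P z.
  by rewrite Prs rootZ ?lead_coef_eq0// root_prod_XsubC.
have nlP : `|lead_coef P| = 1.
  rewrite lP -intr_norm; have /unitrP[b [_ /(congr1 absz)]] := lF.
  by rewrite abszM => /eqP; rewrite muln_eq1 -abszE => /andP[/eqP -> _].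
have rsu : uniq rs.
  rewrite -(separable_prod_XsubC rs) -(eqp_separable (eqp_scale _ (_ : lead_coef
    P != 0))) ?lead_coef_eq0//.
  rewrite -Prs separable_poly.unlock;
    apply/Pdiv.ClosedField.coprimepP => z /conjP[s <-].
  apply/negP => /eqP F'sc.
  have F'c : (map_poly intr F^`()).[c] = 0.
    apply: (fmorph_inj s); apply: (val_inj : injective (\val : L -> R[i])).
    rewrite !rmorph0 /= -F'sc /P deriv_map -val_horner_int -horner_map
      -map_poly_comp.
    congr (val _.[_]); apply: eq_map_poly => t /=.
    by rewrite rmorph_int.
  have [r F'E] := iffLR (Fdiv _) F'c.
  have szF : (1 < size F)%N.
    rewrite ltnNge; apply/negP => /size1_polyC FC.
    move: Fc F0; rewrite FC map_polyC hornerC /= -[RHS](rmorph0 intr) =>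
      /algnum_charL ->.
    by rewrite eqxx.
  have F'0 : F^`() != 0.
    apply: contra_neq F0 => F'0; apply/eqP; rewrite -lead_coef_eq0 lead_coefE.
    have := congr1 (fun p : {poly int} => p`_(size F).-2) F'0.
    rewrite coef_deriv coef0 /=; have -> : (size F).-2.+1 = (size F).-1.
      by rewrite prednK// -ltnS prednK// ltnW.
    have /negPf n0 : (size F).-1 != 0%N by rewrite -lt0n -ltnS prednK ?szF// ltnW.
    by move/eqP; rewrite -mulr_natr mulf_eq0 orbC pnatr_eq0 n0.
  have r0 : r != 0 by apply: contra_neq F'0 => r0; rewrite F'E r0 mulr0.
  have := lt_size_deriv F0; rewrite F'E size_mul//.
  by rewrite (polySpred r0) addnS /= ltnNge leq_addr.
have crs : val c \in rs by rewrite rsP /P /root -val_horner_int Fc rmorph0.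
have prs : 1 <= `|\prod_(z <- rs) z|.
  have P00 : `|P.[0]| = `|\prod_(z <- rs) z|.
    rewrite Prs hornerZ normrM nlP mul1r horner_prod !normr_prod.
    by apply: eq_bigr => z _; rewrite hornerXsubC sub0r normrN.
  rewrite -P00 horner_coef0 coef_map /= -intr_norm ler1z -gtz0_ge1 normr_gt0.
  have [p pc] := int_annihilator algnum_algebraic c0.
  move/Fdiv: pc => [r ->]; rewrite coef0M; apply: contra_neq => ->.
  by rewrite mul0r.
have [g gP] : exists g : R[i] -> {rmorphism L -> L},
    forall z, z \in rs -> val (g z c) = z.
  have /choice[g gP] : forall z, exists s : {rmorphism L -> L}, z \in rs ->
    val (s c) = z.
    move=> z; case: (boolP (z \in rs)) => [|_]; last by exists idfun.
    by rewrite rsP => /conjP[s sc]; exists s.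
  by exists g.
have szrs : (size rs <= N)%N.
  have fgu : uniq [seq f (g z) | z <- rs].
    rewrite map_inj_in_uniq// => z t zrs trs /fc.
    by rewrite -{2}(gP z zrs) -{2}(gP t trs) => ->.
  by rewrite -(size_map (fun z => f (g z))) -(card_uniqP fgu) (leq_trans
    (max_card _))// card_ord.
have B0 : 0 <= B%:C by rewrite ler0c (le_trans ler01).
have B1C : 1 <= B%:C by rewrite -(rmorph1 (real_complex R)) lecR.
apply: (le_trans prs); rewrite (perm_big _ (perm_to_rem crs)) big_cons normrM /=.
rewrite ler_wpM2l// normr_prod.
apply: (@le_trans _ _ (B%:C ^+ size (rem (val c) rs))); last first.
  by apply: ler_weXn2l => //; apply: leq_trans szrs; rewrite size_rem// leq_pred.
have : {subset rem (val c) rs <= rs} by apply: mem_rem.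
elim: (rem _ _) => [|z s IH] srs; first by rewrite big_nil expr0.
rewrite big_cons exprS ler_pM ?prodr_ge0//.
  by rewrite -(gP z) ?srs ?mem_head.
by apply: IH => x xs; rewrite srs// inE xs orbT.
Qed.

Lemma algnum_denominator (z : L) :
  exists2 D : nat, (0 < D)%N & algebraic_integer (val (z * D%:R)).
Proof.
have [p p0 pz] := algnum_algebraic z.
pose n := (size p).-1; pose l := lead_coef p.
have szp : size p = n.+1 by rewrite prednK// lt0n size_poly_eq0.
have l0 : l != 0 by rewrite lead_coef_eq0.
have lz : algebraic_integer (val (z * l%:~R)).
  case: (posnP n) => [n0|n0].
    move: szp pz p0; rewrite n0 => /eqP/size_poly1P[c c0 ->].
    by rewrite map_polyC hornerC /= -[RHS](rmorph0 intr) => /algnum_charL ->;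
      rewrite polyC0 eqxx.
  pose q := \poly_(i < n.+1) (if i == n :> nat then 1 else p`_i * l ^+ (n.-1 - i)).
  have qm : q \is monic.
    by rewrite monicE lead_coef_poly//= eqxx.
  exists q => //; apply/eqP; rewrite -val_horner_int.
  suff -> : (map_poly intr q).[z * l%:~R] = l%:~R ^+ n.-1 * (map_poly intr p).[z].
    by rewrite pz mulr0 rmorph0.
  rewrite (@horner_coef_wide _ n.+1); last first.
    by rewrite (leq_trans (size_poly _ _))// size_poly.
  rewrite (@horner_coef_wide _ n.+1 (map_poly _ p)); last first.
    by rewrite (leq_trans (size_poly _ _))// szp.
  rewrite big_distrr /=; apply: eq_bigr => i _.
  rewrite !coef_map /= coef_poly ltn_ord; case: eqVneq => [->|nin].
    have ln : l%:~R ^+ n = l%:~R ^+ n.-1 * l%:~R :> L by rewrite -exprSr prednK.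
    by rewrite mul1r exprMn ln {2}/l lead_coefE -/n mulrC -mulrA.
  have {nin}lin : (i <= n.-1)%N.
    by rewrite -ltnS prednK// ltn_neqAle nin -ltnS ltn_ord.
  rewrite exprMn -{2}(subnK lin) exprD rmorphM rmorphXn /= -!mulrA.
  by rewrite mulrCA; congr (_ * _); rewrite [z ^+ i * _]mulrC mulrCA.
exists `|l|%N; first by rewrite absz_gt0.
case: (ger0P l) => [l_ge0|l_lt0].
  by have -> : (`|l|%N)%:R = l%:~R :> L by rewrite -{2}(gez0_abs l_ge0).
have -> : (`|l|%N)%:R = - l%:~R :> L.
  by rewrite -mulrNz -(ltz0_abs l_lt0).
by rewrite mulrN rmorphN; exact: integral_opp.
Qed.
End Algnum.

(** * Semi-inner products *)

Section ComplexAbs.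
Variable R : realType.
Implicit Types z w : R[i].

Definition cabs z : R := complex.Re `|z|.

Lemma cabsE z : `|z| = (cabs z)%:C.
Proof. by rewrite /cabs RRe_real// normr_real. Qed.

Lemma cabs_ge0 z : 0 <= cabs z.
Proof. by rewrite -ler0c -cabsE. Qed.

Lemma cabsM z w : cabs (z * w) = cabs z * cabs w.
Proof. by apply: complexI; rewrite rmorphM/= -!cabsE normrM. Qed.

Lemma cabsD z w : cabs (z + w) <= cabs z + cabs w.
Proof. by rewrite -lecR rmorphD/= -!cabsE ler_normD. Qed.

Lemma cabsC (x : R) : cabs x%:C = `|x|.
Proof. by apply: complexI; rewrite -cabsE normc_def /= expr0n addr0 sqrtr_sqr. Qed.

Lemma cabs_conj z : cabs (conjC z) = cabs z.
Proof. by apply: complexI; rewrite -!cabsE norm_conjC. Qed.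

Lemma cabs_eq0 z : (cabs z == 0) = (z == 0).
Proof. by rewrite -[z == 0]normr_eq0 cabsE -(inj_eq (@complexI R)). Qed.

Lemma sqr_cabs z : (cabs z ^+ 2)%:C = z * conjC z.
Proof. by rewrite rmorphXn/= -cabsE normCK. Qed.

Lemma Re_le_cabs z : `|complex.Re z| <= cabs z.
Proof. by rewrite -lecR -cabsE normc_ge_Re. Qed.

Lemma cRe_conj z : complex.Re (conjC z) = complex.Re z.
Proof. by case: z. Qed.

Lemma ReD z w : complex.Re (z + w) = complex.Re z + complex.Re w.
Proof. by case: z w => a b []. Qed.

Lemma ReN z : complex.Re (- z) = - complex.Re z.
Proof. by case: z. Qed.

Lemma ReZ (x : R) z : complex.Re (x%:C * z) = x * complex.Re z.
Proof. by case: z => a b /=; rewrite mul0r subr0. Qed.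

Lemma Re_sum I (s : seq I) (P : pred I) (F : I -> R[i]) :
  complex.Re (\sum_(i <- s | P i) F i) = \sum_(i <- s | P i) complex.Re (F i).
Proof. by elim/big_rec2: _ => //= i y1 y2 _ <-; rewrite ReD. Qed.

Lemma ge0_ReE z : 0 <= z -> z = (complex.Re z)%:C.
Proof. by move=> z0; rewrite RRe_real// ger0_real. Qed.

Lemma Re_ge0 z : 0 <= z -> 0 <= complex.Re z.
Proof. by move=> z0; rewrite -ler0c -ge0_ReE. Qed.

End ComplexAbs.

Section SemiInnerProduct.
Variables (R : realType) (V : lmodType R[i]) (f : V -> V -> R[i]).
Hypothesis flin : forall c u v w, f (c *: u + v) w = c * f u w + f v w.
Hypothesis fsym : forall u v, f u v = conjC (f v u).
Hypothesis fpos : forall u, 0 <= f u u.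

Definition ipsq u : R := complex.Re (f u u).

Lemma ipsqE u : f u u = (ipsq u)%:C. Proof. exact: ge0_ReE. Qed.
Lemma ipsq_ge0 u : 0 <= ipsq u. Proof. exact: Re_ge0. Qed.

Lemma ipDl u v w : f (u + v) w = f u w + f v w.
Proof. by rewrite -[u]scale1r flin mul1r scale1r. Qed.
Lemma ip0l w : f 0 w = 0.
Proof. by apply: (addrI (f 0 w)); rewrite -ipDl !addr0. Qed.
Lemma ipZl c u w : f (c *: u) w = c * f u w.
Proof. by rewrite -[c *: u]addr0 flin ip0l addr0. Qed.
Lemma ipNl u w : f (- u) w = - f u w.
Proof. by rewrite -scaleN1r ipZl mulN1r. Qed.
Lemma ipBl u v w : f (u - v) w = f u w - f v w.
Proof. by rewrite ipDl ipNl. Qed.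
Lemma ipDr u v w : f w (u + v) = f w u + f w v.
Proof. by rewrite fsym ipDl rmorphD /= -!fsym. Qed.
Lemma ip0r w : f w 0 = 0.
Proof. by rewrite fsym ip0l rmorph0. Qed.
Lemma ipZr c u w : f w (c *: u) = conjC c * f w u.
Proof. by rewrite fsym ipZl rmorphM /= -fsym. Qed.
Lemma ipNr u w : f w (- u) = - f w u.
Proof. by rewrite fsym ipNl rmorphN /= -fsym. Qed.
Lemma ipBr u v w : f w (u - v) = f w u - f w v.
Proof. by rewrite ipDr ipNr. Qed.
Lemma ip_suml I (s : seq I) (P : pred I) (F : I -> V) w :
  f (\sum_(i <- s | P i) F i) w = \sum_(i <- s | P i) f (F i) w.
Proof. by elim/big_rec2: _ => [|i y1 y2 _ <-]; rewrite ?ip0l ?ipDl. Qed.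

Lemma ip_sumr I (s : seq I) (P : pred I) (F : I -> V) w :
  f w (\sum_(i <- s | P i) F i) = \sum_(i <- s | P i) f w (F i).
Proof. by elim/big_rec2: _ => [|i y1 y2 _ <-]; rewrite ?ip0r ?ipDr. Qed.

Lemma ipsqZ c u : ipsq (c *: u) = cabs c ^+ 2 * ipsq u.
Proof. by apply: complexI; rewrite rmorphM /= sqr_cabs -!ipsqE ipZl ipZr mulrA. Qed.

Lemma ipsqD u v : ipsq (u + v) = ipsq u + ipsq v + complex.Re (f u v) *+ 2.
Proof.
rewrite /ipsq ipDl !ipDr !ReD [f v u]fsym cRe_conj mulr2n; ring.
Qed.

Lemma Cauchy_Schwarz u v : cabs (f u v) ^+ 2 <= ipsq u * ipsq v.
Proof.
have key a b : ipsq b != 0 -> cabs (f a b) ^+ 2 <= ipsq a * ipsq b.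
  move=> b0; have b_gt0 : 0 < ipsq b by rewrite lt_def b0 ipsq_ge0.
  have := ipsq_ge0 ((ipsq b)%:C *: a - f a b *: b).
  suff -> : ipsq ((ipsq b)%:C *: a - f a b *: b) =
      ipsq b * (ipsq a * ipsq b - cabs (f a b) ^+ 2).
    by rewrite pmulr_rge0// subr_ge0.
  apply: complexI; rewrite -(ipsqE (_ - _)) ipBl !ipBr !ipZl !ipZr.
  rewrite [f b a]fsym !ipsqE rmorphM rmorphB rmorphM /= sqr_cabs.
  have -> : conjC ((ipsq b)%:C) = (ipsq b)%:C :> R[i] by exact: conjc_real.
  ring.
have [b0|] := eqVneq (ipsq v) 0; last exact: key.
have [a0|a0] := eqVneq (ipsq u) 0; last first.
  by rewrite fsym cabs_conj mulrC; exact: key.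
have := ipsq_ge0 (u - f u v *: v); rewrite ipsqD a0 -scaleNr ipsqZ b0 ipZr.
rewrite rmorphN /= mulNr [conjC _ * _]mulrC -sqr_cabs ReN /= mulr0 !add0r mulNrn
  oppr_ge0.
by rewrite pmulrn_lle0// => h; rewrite mulr0.
Qed.

Definition ipnorm u : R := Num.sqrt (ipsq u).

Lemma ipnorm_ge0 u : 0 <= ipnorm u. Proof. exact: sqrtr_ge0. Qed.
Lemma sqr_ipnorm u : ipnorm u ^+ 2 = ipsq u.
Proof. by rewrite sqr_sqrtr// ipsq_ge0. Qed.

Lemma cabs_ip u v : cabs (f u v) <= ipnorm u * ipnorm v.
Proof.
rewrite -ler_sqr ?nnegrE ?mulr_ge0 ?ipnorm_ge0 ?cabs_ge0//.
by rewrite exprMn !sqr_ipnorm Cauchy_Schwarz.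
Qed.

Lemma ipnormD u v : ipnorm (u + v) <= ipnorm u + ipnorm v.
Proof.
rewrite -ler_sqr ?nnegrE ?addr_ge0 ?ipnorm_ge0// sqrrD !sqr_ipnorm ipsqD.
have : complex.Re (f u v) <= ipnorm u * ipnorm v.
  by apply: le_trans (cabs_ip u v); apply: le_trans (Re_le_cabs _); exact: ler_norm.
lra.
Qed.

Lemma ipnormZ c u : ipnorm (c *: u) = cabs c * ipnorm u.
Proof. by rewrite /ipnorm ipsqZ sqrtrM ?sqr_ge0// sqrtr_sqr ger0_norm ?cabs_ge0.
  Qed.

Lemma ipnormN u : ipnorm (- u) = ipnorm u.
Proof. by rewrite /ipnorm /ipsq ipNl ipNr opprK. Qed.

End SemiInnerProduct.

Section PositiveOperator.
Variables (R : realType) (V : lmodType R[i]) (f : V -> V -> R[i]).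
Hypothesis flin : forall c u v w, f (c *: u + v) w = c * f u w + f v w.
Hypothesis fsym : forall u v, f u v = conjC (f v u).
Hypothesis fpos : forall u, 0 <= f u u.
Variable T : V -> V.
Hypothesis Tlin : forall c u v, T (c *: u + v) = c *: T u + T v.
Hypothesis Tsym : forall u v, f (T u) v = f u (T v).
Hypothesis Tpos : forall u, 0 <= f (T u) u.

Lemma positive_operator_bound (l : R) u : 0 <= l ->
  complex.Re (f (T u) u) <= l * ipsq f u ->
  complex.Re (f (T (T u)) (T u)) <= l * ipsq f (T u) ->
  ipsq f (T u) <= l ^+ 2 * ipsq f u.
Proof.
move=> l0 h1 h2.
have glin c a b w : f (T (c *: a + b)) w = c * f (T a) w + f (T b) w.
  by rewrite Tlin flin.
have gsym a b : f (T a) b = conjC (f (T b) a) by rewrite Tsym fsym.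
have h : cabs (f (T u) (T u)) ^+ 2 <=
    complex.Re (f (T u) u) * complex.Re (f (T (T u)) (T u)).
  exact: (Cauchy_Schwarz glin gsym Tpos).
have := ipsq_ge0 fpos (T u); rewrite le_eqVlt => /predU1P[<-|Tu_gt0].
  by rewrite mulr_ge0 ?sqr_ge0 ?ipsq_ge0.
have E : cabs (f (T u) (T u)) = ipsq f (T u).
  by rewrite (ipsqE fpos) cabsC ger0_norm// ltW.
rewrite E in h.
rewrite -(ler_pM2r Tu_gt0) -expr2; apply: (le_trans h).
have -> : l ^+ 2 * ipsq f u * ipsq f (T u) =
  (l * ipsq f u) * (l * ipsq f (T u)) by ring.
by apply: ler_pM => //; exact: Re_ge0.
Qed.

End PositiveOperator.

(** * Von Neumann algebras as operators *)

Section NormLimits.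
Variables (R : realType) (H : completeNormedModType R[i]).

Lemma complex_eps (e : R[i]) : 0 < e -> exists2 r : R, 0 < r & e = r%:C.
Proof.
move=> e0; exists (complex.Re e); last by apply: ge0_ReE; exact: ltW.
by rewrite -ltcR -ge0_ReE// ltW.
Qed.

Lemma Cauchy_limit (u : nat -> H) (e : nat -> R) :
  (forall eps, 0 < eps -> exists N, e N <= eps) ->
  (forall k l, (k <= l)%N -> `|u k - u l| <= (e k)%:C) ->
  exists v, u @ \oo --> v /\ forall k, `|u k - v| <= (e k)%:C.
Proof.
move=> e_to0 ue; have ucvg : cvg (u @ \oo).
  apply: cauchy_cvg; apply: cauchy_exP => _ /complex_eps[r r0 ->].
  have [N eN] := e_to0 (r / 2) (divr_gt0 r0 (ltr0n _ 2)).
  exists (u N); exists N => // k /= Nk; rewrite -ball_normE /=.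
  apply: (le_lt_trans (ue _ _ Nk)); rewrite ltcR (le_lt_trans eN)//.
  by rewrite ltr_pdivrMr// ltr_pMr// ltr1n.
exists (lim (u @ \oo)); split => // k.
have : (fun l => `|u k - u l|) @ \oo --> `|u k - lim (u @ \oo)|.
  by apply: cvg_norm; apply: cvgB => //; exact: cvg_cst.
move=> /cvgrPdist_le h.
have h0 (x y : R[i]) : 0 <= x -> 0 <= y -> (forall r : R, 0 < r ->
  x <= y + r%:C) -> x <= y.
  move=> /ge0_ReE -> /ge0_ReE -> hr; rewrite lecR; apply/ler_addgt0Pr => r /hr.
  by rewrite -rmorphD lecR.
apply: h0 => //; first by apply: le_trans (ue k k (leqnn _)).
move=> r r0; have [|N _ hN] := h r%:C; first by rewrite ltcR.
have := hN (maxn N k) (leq_maxl _ _); have := ue k (maxn N k) (leq_maxr _ _).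
move=> uk hl.
have -> : `|u k - lim (u @ \oo)| = `|u k - u (maxn N k)| + (`|u k - lim (u @
  \oo)| - `|u k - u (maxn N k)|).
  by rewrite [RHS]addrC subrK.
apply: lerD => //; apply: le_trans hl; apply: real_ler_norm.
by apply: realB; exact: normr_real.
Qed.

End NormLimits.

Section VonNeumannBasics.
Variables (R : realType) (M : vonNeumannAlgebra R).
Local Notation H := (vN_space M).
Local Notation star := (@vN_star R M).
Local Notation rep := (@vN_rep R M).
Local Notation dot := (@vN_dot R M).

Lemma vN_normE (v : H) : `|v| ^+ 2 = dot v v. Proof. by case: (M) v. Qed.
Lemma rep_linl c a b v : rep (c *: a + b) v = c *: rep a v + rep b v.
Proof. by case: (M) c a b v. Qed.
Lemma rep1 v : rep 1 v = v. Proof. by case: (M) v. Qed.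
Lemma repM a b v : rep (a * b) v = rep a (rep b v).
Proof. by case: (M) a b v. Qed.
Lemma rep_adj a u v : dot (rep a u) v = dot u (rep (star a) v).
Proof. by case: (M) a u v => ? ? ? ? ? ? ? ? ? h ? ? a u v; exact: h. Qed.
Lemma rep_inj : injective rep. Proof. by case: (M). Qed.
Lemma rep_vN_set : von_neumann_set dot (range rep). Proof. by case: (M). Qed.

Lemma dotl c u v w : dot (c *: u + v) w = c * dot u w + dot v w.
Proof. by rewrite linearDl/= linearZl_LR. Qed.
Lemma dotC u v : dot u v = conjC (dot v u).
Proof. by rewrite hermC /= expr0 mul1r. Qed.
Lemma dot_ge0 u : 0 <= dot u u. Proof. exact: dnorm_ge0. Qed.

Definition dotN : H -> R := ipnorm (fun u v : H => dot u v).

Lemma vN_norm (v : H) : `|v| = (dotN v)%:C.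
Proof.
apply/eqP; rewrite -(@eqrXn2 _ 2)// ?ler0c ?ipnorm_ge0// vN_normE -rmorphXn /=.
by rewrite sqr_ipnorm ?(ipsqE dot_ge0)//; exact: dot_ge0.
Qed.

Lemma dot_inj u v : (forall w, dot u w = dot v w) -> u = v.
Proof.
move=> uv; apply/eqP; rewrite -subr_eq0 -(dnorm_eq0 dot).
by rewrite linearBl /= uv subrr.
Qed.

Lemma dot_injr u v : (forall w, dot w u = dot w v) -> u = v.
Proof. by move=> uv; apply: dot_inj => w; rewrite dotC uv -dotC. Qed.

Lemma rep_ext a b : (forall v, rep a v = rep b v) -> a = b.
Proof. by move=> ab; apply: rep_inj; apply/funext. Qed.

Lemma repDl a b v : rep (a + b) v = rep a v + rep b v.
Proof. by rewrite -[a]scale1r rep_linl !scale1r. Qed.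
Lemma rep0l v : rep 0 v = 0.
Proof. by apply: (addrI (rep 0 v)); rewrite -repDl !addr0. Qed.
Lemma repZl c a v : rep (c *: a) v = c *: rep a v.
Proof. by rewrite -[c *: a]addr0 rep_linl rep0l addr0. Qed.
Lemma repNl a v : rep (- a) v = - rep a v.
Proof. by rewrite -scaleN1r repZl scaleN1r. Qed.
Lemma repBl a b v : rep (a - b) v = rep a v - rep b v.
Proof. by rewrite repDl repNl. Qed.
Lemma rep_suml I (s : seq I) (P : pred I) (F : I -> M) v :
  rep (\sum_(i <- s | P i) F i) v = \sum_(i <- s | P i) rep (F i) v.
Proof. by elim/big_rec2: _ => [|i y1 y2 _ <-]; rewrite ?rep0l ?repDl. Qed.

Lemma rep_linr a c u v : rep a (c *: u + v) = c *: rep a u + rep a v.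
Proof.
apply: dot_inj => w; rewrite rep_adj dotl dotl -!rep_adj //.
Qed.
Lemma repDr a u v : rep a (u + v) = rep a u + rep a v.
Proof. by rewrite -[u]scale1r rep_linr !scale1r. Qed.
Lemma rep0r a : rep a 0 = 0.
Proof. by apply: (addrI (rep a 0)); rewrite -repDr !addr0. Qed.
Lemma rep_sumr a I (s : seq I) (P : pred I) (F : I -> H) :
  rep a (\sum_(i <- s | P i) F i) = \sum_(i <- s | P i) rep a (F i).
Proof. by elim/big_rec2: _ => [|i y1 y2 _ <-]; rewrite ?rep0r ?repDr. Qed.

Lemma star_uniq a b : (forall u v, dot (rep a u) v = dot u (rep b v)) -> b = star a.
Proof.
by move=> ab; apply: rep_ext => v; apply: dot_injr => w; rewrite -ab rep_adj.
Qed.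

Lemma starK a : star (star a) = a.
Proof. by apply/esym/star_uniq => u v; rewrite dotC -rep_adj -dotC. Qed.
Lemma starM a b : star (a * b) = star b * star a.
Proof. by apply/esym/star_uniq => u v; rewrite !repM !rep_adj. Qed.
Lemma star1 : star 1 = 1.
Proof. by apply/esym/star_uniq => u v; rewrite !rep1. Qed.
Lemma starD a b : star (a + b) = star a + star b.
Proof.
apply/esym/star_uniq => u v; rewrite !repDl linearDl linearDr /=.
by rewrite !rep_adj.
Qed.
Lemma starZ c a : star (c *: a) = conjC c *: star a.
Proof.
apply/esym/star_uniq => u v; rewrite !repZl linearZl_LR linearZr_LR /=.
by rewrite rep_adj conjCK.
Qed.
Lemma star0 : star 0 = 0.
Proof. by apply: (addrI (star 0)); rewrite -starD !addr0. Qed.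
Lemma starN a : star (- a) = - star a.
Proof. by rewrite -scaleN1r starZ rmorphN rmorph1 /= scaleN1r. Qed.
Lemma star_sum I (s : seq I) (P : pred I) (F : I -> M) :
  star (\sum_(i <- s | P i) F i) = \sum_(i <- s | P i) star (F i).
Proof. by elim/big_rec2: _ => [|i y1 y2 _ <-]; rewrite ?star0 ?starD. Qed.

Lemma rep_bounded (a : M) : exists2 K : R, 0 <= K & forall v, dotN (rep a v) <=
  K * dotN v.
Proof.
have [bic _] := rep_vN_set.
have : range rep (rep a) by exists a.
rewrite -bic => -[[lin cont] _].
pose fl := GRing.isLinear.Build _ _ _ _ (rep a) lin.
pose f : {linear H -> H} := HB.pack (rep a) fl.
have /linear_bounded_continuous : continuous f by [].
move=> /linear_boundedP[K0 [K0r h]].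
exists (`|complex.Re K0| + 1); first by rewrite addr_ge0.
move=> v; rewrite -lecR rmorphM /= -!vN_norm; apply: h.
by rewrite -[ltLHS]RRe_real// ltcR ltr_pwDr// ler_norm.
Qed.

Lemma rep_complete (a : nat -> M) (e : nat -> R) :
  (forall eps, 0 < eps -> exists N, e N <= eps) ->
  (forall k l v, (k <= l)%N -> dotN (rep (a k - a l) v) <= e k * dotN v) ->
  exists b, forall k v, dotN (rep (a k - b) v) <= e k * dotN v.
Proof.
move=> e0 ae.
have [|T TP] := @choice _ _ (fun v w => (rep (a k) v @[k --> \oo] --> w) /\
    forall k, dotN (rep (a k) v - w) <= e k * dotN v).
  move=> v; have [||w [h1 h2]] :=
    @Cauchy_limit _ _ (fun k => rep (a k) v) (fun k => e k * dotN v).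
  - move=> eps eps0; have d0 : 0 < dotN v + 1.
      by rewrite ltr_pwDr// ipnorm_ge0.
    have [N eN] := e0 (eps / (dotN v + 1)) (divr_gt0 eps0 d0); exists N.
    rewrite ler_pdivlMr// mulrDr mulr1 in eN.
    have dv : 0 <= dotN v := ipnorm_ge0 _ v.
    have [eN0|eN0] := leP 0 (e N).
      by apply: le_trans eN; rewrite lerDl.
    by apply: (@le_trans _ _ 0); rewrite ?(ltW eps0)// nmulr_rle0.
  - by move=> k l kl; rewrite -repBl vN_norm lecR; exact: ae.
  - by exists w; split => // k; have := h2 k; rewrite vN_norm lecR.
have [bic _] := rep_vN_set.
have Tlim v : rep (a k) v @[k --> \oo] --> T v by case: (TP v).
have Tlin : linear T.
  move=> c u v; apply: (cvg_unique _ (Tlim _)) => //.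
  have -> : (fun k => rep (a k) (c *: u + v)) = (fun k => c *: rep (a k) u + rep
    (a k) v).
    by apply/funext => k; exact: rep_linr.
  by apply: cvgD => //; apply: cvgZr.
have : range rep T.
  rewrite -bic; split.
    split => //; pose fl := GRing.isLinear.Build _ _ _ _ T Tlin.
    pose f : {linear H -> H} := HB.pack T fl.
    suff : continuous f by [].
    apply/linear_bounded_continuous/linear_boundedP.
    have [K K0 aK] := rep_bounded (a 0).
    exists (K + e 0)%:C; split; first by rewrite complex_real.
    move=> r Kr v; rewrite /f /=.
    have dv : 0 <= dotN v := ipnorm_ge0 _ v.
    apply: (@le_trans _ _ ((K + e 0)%:C * `|v|)); last first.
      by rewrite ler_wpM2r// ltW.
    rewrite !vN_norm -rmorphM lecR mulrDl.
    have -> : T v = rep (a 0) v - (rep (a 0) v - T v) by rewrite opprB addrC subrK.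
    apply: le_trans (ipnormD dotl dotC dot_ge0 _ _) _.
    rewrite (ipnormN dotl dotC).
    by apply: lerD => //; case: (TP v) => _; apply.
  move=> S [[Slin Scont] Scom]; apply/funext => v /=.
  apply: (cvg_unique _ (Tlim _)) => //.
  have ES k : rep (a k) (S v) = S (rep (a k) v).
    by have := congr1 (fun g => g v) (Scom (rep (a k)) (ex_intro2 _ _ (a k) I
      erefl)).
  have -> : (fun k => rep (a k) (S v)) = (fun k => S (rep (a k) v)) by apply/funext.
  by apply: continuous_cvg => //; exact: Scont.
by move=> [b _ bT]; exists b => k v; rewrite repBl bT; have [_ /(_ k)] := TP v.
Qed.

End VonNeumannBasics.

(** * Matrices over a von Neumann algebra *)

Section MatrixAction.
Variables (R : realType) (M : vonNeumannAlgebra R).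
Local Notation H := (vN_space M).
Local Notation star := (@vN_star R M).
Local Notation rep := (@vN_rep R M).
Local Notation dot := (@vN_dot R M).
Local Notation adj := (@vN_adjmx R M _ _).

Definition mip n (u v : {ffun 'I_n -> H}) : R[i] := \sum_i dot (u i) (v i).

Definition act m n (A : 'M[M]_(m, n)) (u : {ffun 'I_n -> H}) : {ffun 'I_m -> H} :=
  [ffun i => \sum_j rep (A i j) (u j)].

Lemma mip_lin n c (u v w : {ffun 'I_n ->
  H}) : mip (c *: u + v) w = c * mip u w + mip v w.
Proof.
rewrite /mip big_distrr /= -big_split /=; apply: eq_bigr => i _.
by rewrite !ffunE (@dotl R M).
Qed.

Lemma mip_sym n (u v : {ffun 'I_n -> H}) : mip u v = conjC (mip v u).
Proof. by rewrite /mip rmorph_sum /=; apply: eq_bigr => i _;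
  exact: (@dotC R M). Qed.

Lemma mip_ge0 n (u : {ffun 'I_n -> H}) : 0 <= mip u u.
Proof. by apply: sumr_ge0 => i _; exact: (@dot_ge0 R M). Qed.

Definition mnorm n (u : {ffun 'I_n -> H}) : R := ipnorm (@mip n) u.

Lemma mip_inj n (u v : {ffun 'I_n -> H}) : (forall w, mip u w = mip v w) -> u = v.
Proof.
move=> uv; apply/ffunP => i; apply: dot_inj => x.
have := uv [ffun j => if j == i then x else 0]; rewrite /mip (bigD1 i)//= big1;
  last first.
  by move=> j ji; rewrite ffunE (negPf ji) linear0r.
rewrite (bigD1 i)//= big1 ?addr0 ?ffunE ?eqxx// => j ji.
by rewrite ffunE (negPf ji) linear0r.
Qed.

Lemma act_linr m n (A : 'M[M]_(m, n)) c u v : act A (c *: u + v) = c *: act A u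
  + act A v.
Proof.
apply/ffunP => i; rewrite !ffunE scaler_sumr -big_split /=; apply: eq_bigr => j _.
by rewrite !ffunE rep_linr.
Qed.

Lemma actDr m n (A : 'M[M]_(m, n)) u v : act A (u + v) = act A u + act A v.
Proof. by rewrite -[u]scale1r act_linr !scale1r. Qed.
Lemma act0r m n (A : 'M[M]_(m, n)) : act A 0 = 0.
Proof. by apply: (addrI (act A 0)); rewrite -actDr !addr0. Qed.
Lemma actZr m n (A : 'M[M]_(m, n)) c v : act A (c *: v) = c *: act A v.
Proof. by rewrite -[c *: v]addr0 act_linr act0r addr0. Qed.

Lemma actDl m n (A B : 'M[M]_(m, n)) u : act (A + B) u = act A u + act B u.
Proof.
apply/ffunP => i; rewrite !ffunE -big_split /=; apply: eq_bigr => j _.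
by rewrite !mxE repDl.
Qed.

Lemma actNl m n (A : 'M[M]_(m, n)) u : act (- A) u = - act A u.
Proof.
apply/ffunP => i; rewrite !ffunE -sumrN; apply: eq_bigr => j _.
by rewrite !mxE repNl.
Qed.

Lemma actBl m n (A B : 'M[M]_(m, n)) u : act (A - B) u = act A u - act B u.
Proof. by rewrite actDl actNl. Qed.

Lemma act0l m n u : act (0 : 'M[M]_(m, n)) u = 0.
Proof. by apply: (addrI (act 0 u)); rewrite -actDl !addr0. Qed.

Lemma act1 n u : act (1%:M : 'M[M]_n) u = u.
Proof.
apply/ffunP => i; rewrite !ffunE (bigD1 i)//= mxE eqxx mulr1n rep1 big1 ?addr0//.
by move=> j ji; rewrite mxE eq_sym (negPf ji) mulr0n rep0l.
Qed.

Lemma actM m n p (A : 'M[M]_(m, n)) (B : 'M[M]_(n, p)) u :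
  act (A *m B) u = act A (act B u).
Proof.
apply/ffunP => i; rewrite !ffunE.
under eq_bigr do rewrite mxE rep_suml.
rewrite exchange_big /=; apply: eq_bigr => k _; rewrite ffunE rep_sumr.
by apply: eq_bigr => j _; rewrite repM.
Qed.

Definition vscale m n (c : R[i]) (A : 'M[M]_(m, n)) : 'M[M]_(m, n) :=
  map_mx ( *:%R c) A.

Lemma actZl m n c (A : 'M[M]_(m, n)) u : act (vscale c A) u = c *: act A u.
Proof.
apply/ffunP => i; rewrite !ffunE scaler_sumr; apply: eq_bigr => j _.
by rewrite !mxE repZl.
Qed.

Lemma act_adj m n (A : 'M[M]_(m, n)) u v : mip (act A u) v = mip u (act (adj A) v).
Proof.
rewrite /mip.
under eq_bigr do rewrite ffunE (ip_suml (@dotl R M)).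
under [RHS]eq_bigr do rewrite ffunE (ip_sumr (@dotl R M) (@dotC R M)).
rewrite exchange_big /=; apply: eq_bigr => j _; apply: eq_bigr => i _.
by rewrite rep_adj !mxE.
Qed.

Lemma act_inj m n (A B : 'M[M]_(m, n)) : (forall u, act A u = act B u) -> A = B.
Proof.
move=> AB; apply/matrixP => i j; apply: rep_ext => x.
have := congr1 (fun f : {ffun _ ->
  _} => f i) (AB [ffun k => if k == j then x else 0]).
rewrite /= !ffunE (bigD1 j)//= big1; last first.
  by move=> k kj; rewrite ffunE (negPf kj) rep0r.
rewrite (bigD1 j)//= big1 ?addr0 ?ffunE ?eqxx// => k kj.
by rewrite ffunE (negPf kj) rep0r.
Qed.

Lemma adjmxK m n (A : 'M[M]_(m, n)) : adj (adj A) = A.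
Proof. by apply/matrixP => i j; rewrite !mxE starK. Qed.
Lemma adjmxD m n (A B : 'M[M]_(m, n)) : adj (A + B) = adj A + adj B.
Proof. by apply/matrixP => i j; rewrite !mxE starD. Qed.
Lemma adjmxN m n (A : 'M[M]_(m, n)) : adj (- A) = - adj A.
Proof. by apply/matrixP => i j; rewrite !mxE starN. Qed.
Lemma adjmxB m n (A B : 'M[M]_(m, n)) : adj (A - B) = adj A - adj B.
Proof. by rewrite adjmxD adjmxN. Qed.
Lemma adjmxM m n p (A : 'M[M]_(m, n)) (B : 'M[M]_(n, p)) : adj (A *m B) = adj B
  *m adj A.
Proof.
apply/matrixP => i j; rewrite !mxE star_sum; apply: eq_bigr => k _.
by rewrite !mxE starM.
Qed.
Lemma adjmx1 n : adj (1%:M : 'M[M]_n) = 1%:M.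
Proof.
apply/matrixP => i j; rewrite !mxE eq_sym; case: eqP => _.
  by rewrite !mulr1n star1.
by rewrite !mulr0n star0.
Qed.
Lemma adjmxZ m n c (A : 'M[M]_(m, n)) : adj (vscale c A) = vscale (conjC c) (adj A).
Proof. by apply/matrixP => i j; rewrite !mxE starZ. Qed.
Lemma adjmxX n (A : 'M[M]_n) k : adj A = A -> adj (A ^+ k) = A ^+ k.
Proof.
move=> hA; elim: k => [|k IH]; first exact: adjmx1.
by rewrite {1}exprS exprSr -!mulmxE adjmxM IH hA.
Qed.
Lemma adjmx_sum I (s : seq I) (P : pred I) m n (F : I -> 'M[M]_(m, n)) :
  adj (\sum_(i <- s | P i) F i) = \sum_(i <- s | P i) adj (F i).
Proof.
elim/big_rec2: _ => [|i y1 y2 _ <-]; last by rewrite adjmxD.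
by apply/matrixP => i j; rewrite !mxE star0.
Qed.

Definition bnd m n (A : 'M[M]_(m, n)) (K : R) :=
  forall u, mnorm (act A u) <= K * mnorm u.

Lemma mnorm_ge0 n (u : {ffun 'I_n ->
  H}) : 0 <= mnorm u. Proof. exact: ipnorm_ge0. Qed.
Lemma mnormD n (u v : {ffun 'I_n -> H}) : mnorm (u + v) <= mnorm u + mnorm v.
Proof. exact: (ipnormD (@mip_lin n) (@mip_sym n) (@mip_ge0 n)). Qed.
Lemma mnormZ n c (u : {ffun 'I_n -> H}) : mnorm (c *: u) = cabs c * mnorm u.
Proof. exact: (ipnormZ (@mip_lin n) (@mip_sym n) (@mip_ge0 n)). Qed.
Lemma mnormN n (u : {ffun 'I_n -> H}) : mnorm (- u) = mnorm u.
Proof. exact: (ipnormN (@mip_lin n) (@mip_sym n)). Qed.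
Lemma mnorm_eq0 n (u : {ffun 'I_n -> H}) : mnorm u = 0 -> u = 0.
Proof.
move=> u0; apply: mip_inj => w.
have := cabs_ip (@mip_lin n) (@mip_sym n) (@mip_ge0 n) u w.
rewrite -/(mnorm u) u0 mul0r => h; have /eqP : cabs (mip u w) = 0.
  by apply/eqP; rewrite eq_le h cabs_ge0.
by rewrite cabs_eq0 => /eqP ->; rewrite (ip0l (@mip_lin n)).
Qed.

Lemma bndD m n (A B : 'M[M]_(m, n)) K K' : bnd A K -> bnd B K' ->
  bnd (A + B) (K + K').
Proof.
move=> hA hB u; rewrite actDl mulrDl; apply: le_trans (mnormD _ _) _.
exact: lerD.
Qed.
Lemma bndN m n (A : 'M[M]_(m, n)) K : bnd A K -> bnd (- A) K.
Proof. by move=> hA u; rewrite actNl mnormN. Qed.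
Lemma bndM m n p (A : 'M[M]_(m, n)) (B : 'M[M]_(n, p)) K K' : 0 <= K ->
  bnd A K -> bnd B K' -> bnd (A *m B) (K * K').
Proof.
move=> K0 hA hB u; rewrite actM; apply: le_trans (hA _) _.
by rewrite -mulrA ler_wpM2l.
Qed.
Lemma bndZ m n c (A : 'M[M]_(m, n)) K : bnd A K -> bnd (vscale c A) (cabs c * K).
Proof. by move=> hA u; rewrite actZl mnormZ -mulrA ler_wpM2l ?cabs_ge0. Qed.
Lemma bnd_le m n (A : 'M[M]_(m, n)) K K' : K <= K' -> bnd A K -> bnd A K'.
Proof. by move=> KK' hA u; apply: le_trans (hA u) _;
  rewrite ler_wpM2r ?mnorm_ge0. Qed.

Lemma sqr_mnorm n (u : {ffun 'I_n -> H}) : mnorm u ^+ 2 = complex.Re (mip u u).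
Proof. by rewrite (sqr_ipnorm (@mip_ge0 n)). Qed.

Lemma bnd_adj m n (A : 'M[M]_(m, n)) K : 0 <= K -> bnd A K -> bnd (adj A) K.
Proof.
move=> K0 hA u; have [|] := eqVneq (mnorm (act (adj A) u)) 0.
  by move=> ->; rewrite mulr_ge0// mnorm_ge0.
move=> n0; have n_gt0 : 0 < mnorm (act (adj A) u) by rewrite lt_def n0 mnorm_ge0.
rewrite -(ler_pM2l n_gt0) -expr2 sqr_mnorm act_adj adjmxK.
apply: (@le_trans _ _ (mnorm u * mnorm (act A (act (adj A) u)))).
  apply: le_trans (cabs_ip (@mip_lin m) (@mip_sym m) (@mip_ge0 m) _ _).
  by apply: le_trans (Re_le_cabs _); exact: ler_norm.
rewrite mulrCA [_ * mnorm u]mulrC mulrCA [K * _]mulrC mulrA -mulrA ler_wpM2l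
  ?mnorm_ge0// .
by rewrite mulrC.
Qed.

Lemma dotN_coord n (u : {ffun 'I_n -> H}) i : dotN (u i) <= mnorm u.
Proof.
rewrite -ler_sqr ?nnegrE ?ipnorm_ge0// sqr_mnorm sqr_ipnorm;
  last exact: (@dot_ge0 R M).
rewrite /ipsq /mip (bigD1 i)//= ReD lerDl Re_sum sumr_ge0// => j _.
exact/Re_ge0/(@dot_ge0 R M).
Qed.

Lemma mnorm_single n (i : 'I_n) (x : H) :
  mnorm [ffun k => if k == i then x else 0] = dotN x.
Proof.
rewrite /mnorm /dotN /ipnorm /ipsq /mip (bigD1 i)//= big1 ?addr0 ?ffunE ?eqxx//.
by move=> k ki; rewrite ffunE (negPf ki) linear0r.
Qed.

Lemma mnorm_le_sum n (u : {ffun 'I_n -> H}) : mnorm u <= \sum_i dotN (u i).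
Proof.
have uE : u = \sum_i [ffun k => if k == i then u i else 0].
  apply/ffunP => k; rewrite sum_ffunE (bigD1 k)//= ffunE eqxx big1 ?addr0//.
  by move=> i ik; rewrite ffunE eq_sym (negPf ik).
rewrite {1}uE; apply: (@le_trans _ _ (\sum_i mnorm [ffun k => if k == i then u i
  else 0])).
  elim/big_rec2: _ => [|i y1 y2 _ h]; last by apply: le_trans (mnormD _ _) _;
    rewrite lerD2l.
  have -> : (0 : {ffun 'I_n -> H}) = 0 *: 0 by rewrite scaler0.
  by rewrite mnormZ -[0]/(0%:C) cabsC normr0 mul0r.
by apply: ler_sum => i _; rewrite mnorm_single.
Qed.

Lemma bnd_entry m n (A : 'M[M]_(m, n)) K i j : bnd A K ->
  forall v, dotN (rep (A i j) v) <= K * dotN v.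
Proof.
move=> hA v; rewrite -(mnorm_single j v); apply: le_trans (hA _).
apply: le_trans (dotN_coord _ i);
  rewrite ffunE (bigD1 j)//= ffunE eqxx big1 ?addr0//.
by move=> k kj; rewrite ffunE (negPf kj) rep0r.
Qed.

Lemma bnd_entries m n (A : 'M[M]_(m, n)) K : 0 <= K ->
  (forall i j v, dotN (rep (A i j) v) <= K * dotN v) -> bnd A ((m * n)%:R * K).
Proof.
move=> K0 hA u; apply: le_trans (mnorm_le_sum _) _.
apply: (@le_trans _ _ (\sum_(i < m) \sum_(j < n) K * mnorm u)).
  apply: ler_sum => i _; rewrite ffunE.
  apply: (@le_trans _ _ (\sum_j dotN (rep (A i j) (u j)))).
    elim/big_rec2: _ => [|j y1 y2 _ h].
      by rewrite /dotN /ipnorm /ipsq linear0l sqrtr0.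
    by apply: le_trans (ipnormD (@dotl R M) (@dotC R M) (@dot_ge0 R M) _ _) _;
      rewrite lerD2l.
  apply: ler_sum => j _; apply: le_trans (hA _ _ _) _.
  by rewrite ler_wpM2l// dotN_coord.
by rewrite !sumr_const !card_ord -mulrnA -mulrA mulr_natl mulnC.
Qed.

End MatrixAction.

(** * Positivity of the trace *)

Section MatrixPositivity.
Variables (R : realType) (M : vonNeumannAlgebra R).
Local Notation H := (vN_space M).
Local Notation star := (@vN_star R M).
Local Notation rep := (@vN_rep R M).
Local Notation dot := (@vN_dot R M).
Local Notation adj := (@vN_adjmx R M _ _).

Lemma bnd_exists m n (A : 'M[M]_(m, n)) : exists2 K, 0 <= K & bnd A K.
Proof.
have /choice[K KP] : forall ij : 'I_m * 'I_n, exists K : R, 0 <= K /\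
    forall v, dotN (rep (A ij.1 ij.2) v) <= K * dotN v.
  by move=> ij; have [K ? ?] := rep_bounded (A ij.1 ij.2); exists K.
have K0 : 0 <= \sum_ij K ij by apply: sumr_ge0 => ij _; case: (KP ij).
exists ((m * n)%:R * \sum_ij K ij); first exact: mulr_ge0.
apply: bnd_entries => // i j v; have [K1 h] := KP (i, j).
apply: le_trans (h v) _; rewrite ler_wpM2r ?ipnorm_ge0//.
by rewrite (bigD1 (i, j))//= lerDl sumr_ge0// => ij _; case: (KP ij).
Qed.

Lemma bnd_eq0 m n (A : 'M[M]_(m, n)) : (forall eps, 0 < eps -> bnd A eps) -> A = 0.
Proof.
move=> hA; apply: act_inj => u; rewrite act0l; apply: mnorm_eq0.
apply/eqP; rewrite eq_le mnorm_ge0 andbT; apply/ler_addgt0Pr => e e0.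
rewrite add0r; have u0 : 0 < mnorm u + 1 by rewrite ltr_wpDl// mnorm_ge0.
apply: le_trans (hA _ (divr_gt0 e0 u0) u) _.
by rewrite -mulrA ger_pMr// mulrC ler_pdivrMr// mul1r lerDl.
Qed.

Lemma bnd_limit m n (A : nat -> 'M[M]_(m, n)) (e : nat -> R) :
  (forall eps, 0 < eps -> exists N, e N <= eps) -> (forall k, 0 <= e k) ->
  (forall k l, (k <= l)%N -> bnd (A k - A l) (e k)) ->
  exists B, forall k, bnd (A k - B) ((m * n)%:R * e k).
Proof.
move=> e_to0 e0 hA.
have /choice[B BP] : forall ij : 'I_m * 'I_n, exists b, forall k v,
    dotN (rep (A k ij.1 ij.2 - b) v) <= e k * dotN v.
  move=> [i j]; apply: rep_complete => //= k l v kl.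
  by have := bnd_entry i j (hA _ _ kl) v; rewrite !mxE.
exists (\matrix_(i, j) B (i, j)) => k; apply: bnd_entries => // i j v.
by rewrite !mxE; exact: (BP (i, j)).
Qed.

Lemma vscaleB m n c (A B : 'M[M]_(m, n)) : vscale c (A - B) = vscale c A -
  vscale c B.
Proof. by apply/matrixP => i j; rewrite !mxE scalerBr. Qed.
Lemma conjC_real (x : R) : conjC (x%:C) = x%:C :> R[i].
Proof. exact: conjc_real. Qed.

Lemma vscale_half n (A : 'M[M]_n) : vscale (2^-1)%:C A + vscale (2^-1)%:C A = A.
Proof.
apply/matrixP => i j; rewrite !mxE -scalerDl -rmorphD /=.
have -> : 2^-1 + 2^-1 = 1 :> R by field.
by rewrite scale1r.
Qed.

Lemma geometric_to0 (t : R) : 0 <= t -> t < 1 ->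
  forall eps, 0 < eps -> exists N, t ^+ N / (1 - t) <= eps.
Proof.
move=> t0 t1 eps eps0; have d0 : 0 < 1 - t by rewrite subr_gt0.
have /cvg_expr/cvgrPdist_le h : `|t| < 1 by rewrite ger0_norm.
have [N _ /(_ N (leqnn N))] := h _ (mulr_gt0 eps0 d0).
by rewrite sub0r normrN ger0_norm ?exprn_ge0// => hN; exists N; rewrite ler_pdivrMr.
Qed.

Section SquareRoot.
Variables (n : nat) (z : 'M[M]_n) (t : R).
Hypotheses (z_adj : adj z = z) (t_ge0 : 0 <= t) (t_lt1 : t < 1).
Hypothesis bz : bnd (1%:M - z) t.

Let hf := vscale (m := n) (n := n) (2^-1)%:C : 'M[M]_n -> 'M[M]_n.
Let c := 1%:M - z.
(* A contraction on the ball of radius [t]; its fixed point [w] satisfies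
   [(1 - w)^2 = 1 - c = z]. *)
Let phi (w : 'M[M]_n) := hf (c + w *m w).
Let w k := iter k phi 0.
Let e k := t ^+ k / (1 - t).

Let bnd_hf (A : 'M[M]_n) K : bnd A K -> bnd (hf A) (K / 2).
Proof. by move=> /(bndZ (2^-1)%:C); rewrite cabsC ger0_norm// mulrC. Qed.

Let w_adj k : adj (w k) = w k.
Proof.
elim: k => [|k IH]; first by apply/matrixP => i j; rewrite !mxE star0.
rewrite [w k.+1]/= -/(w k) /phi /hf adjmxZ conjC_real adjmxD adjmxM IH.
by rewrite /c adjmxB adjmx1 z_adj.
Qed.

Let w_bnd k : bnd (w k) t.
Proof.
elim: k => [|k IH].
  move=> u; rewrite act0l /mnorm /ipnorm /ipsq /= (ip0l (@mip_lin R M n)) sqrtr0.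
  by rewrite mulr_ge0// mnorm_ge0.
rewrite [w k.+1]/= -/(w k); apply: bnd_le (bnd_hf (bndD bz (bndM t_ge0 IH IH))).
rewrite ler_pdivrMr// mulr_natr mulr2n lerD2l ler_piMl//; exact: ltW.
Qed.

Let w_step k : bnd (w k.+1 - w k) (t ^+ k).
Proof.
elim: k => [|k IH].
  rewrite subr0 [w 1]/= /phi mul0mx addr0; apply: bnd_le (bnd_hf bz).
  by rewrite expr0 ler_pdivrMr// mul1r (le_trans (ltW t_lt1))// ler1n.
have -> : w k.+2 - w k.+1 =
    hf ((w k.+1 - w k) *m w k.+1 + w k *m (w k.+1 - w k)).
  rewrite [w k.+2]/= [w k.+1]/= -/(w k) -/(w k.+1) /phi -vscaleB; congr hf.
  rewrite mulmxBl mulmxBr opprD addrACA subrr add0r.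
  by rewrite addrA subrK.
apply: bnd_le (bnd_hf (bndD (bndM _ IH (w_bnd _)) (bndM t_ge0 (w_bnd _) IH))) => //.
  rewrite exprSr; lra.
by rewrite exprn_ge0.
Qed.

Let eS k : e k - e k.+1 = t ^+ k.
Proof. by rewrite /e exprS -mulrBl -{1}[t ^+ k]mul1r -mulrBl mulrC mulrA mulVf
  ?mul1r// subr_eq0 eq_sym lt_eqF. Qed.

Let e_ge0 k : 0 <= e k.
Proof. by rewrite divr_ge0 ?exprn_ge0// subr_ge0 ltW. Qed.

Let w_cauchy k l : (k <= l)%N -> bnd (w k - w l) (e k).
Proof.
move=> kl; apply: (@bnd_le _ _ _ _ _ (e k - e l)); first by rewrite gerBl.
rewrite -(subnK kl); elim: (l - k)%N => [|i IH].
  by rewrite add0n !subrr => u;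
    rewrite mul0r act0l /mnorm /ipnorm /ipsq (ip0l (@mip_lin R M n)) sqrtr0.
rewrite addSn -[_ - w _](subrKA (w (i + k)%N)) -[_ - e _](subrKA (e (i + k)%N)) eS.
apply: bndD => //; rewrite -opprB; apply: bndN; exact: w_step.
Qed.

Lemma sqrt_near_identity : exists s : 'M[M]_n, z = adj s *m s.
Proof.
have e_to0 := geometric_to0 t_ge0 t_lt1.
have [L hL] := bnd_limit e_to0 e_ge0 w_cauchy.
pose N : R := (n * n)%:R.
have small (A : 'M[M]_n) K : 0 <= K -> (forall k, bnd A (K * e k)) -> A = 0.
  move=> K0 hA; apply: bnd_eq0 => eps eps0.
  have [k hk] := e_to0 (eps / (K + 1)) (divr_gt0 eps0 (ltr_wpDl K0 ltr01)).
  apply: bnd_le (hA k); rewrite ler_pdivlMr ?ltr_wpDl// in hk.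
  by apply: le_trans hk; rewrite mulrDr mulr1 mulrC lerDl; exact: e_ge0.
have N0 : 0 <= N by [].
have hL' k : bnd (w k - adj L) (N * e k).
  rewrite -[w k]w_adj -adjmxB; apply: bnd_adj => //; exact: mulr_ge0.
have L_adj : adj L = L.
  apply/eqP; rewrite -subr_eq0; apply/eqP.
  apply: (@small _ (N + N)) => [|k]; first exact: addr_ge0.
  rewrite mulrDl -[adj L - L](subrKA (w k)); apply: bndD => //.
  by rewrite -opprB; exact: bndN.
have [K K0 bL] := bnd_exists L.
have fixL : L - phi L = 0.
  apply: (@small _ (N + (t * N + N * K) / 2)) => [|k].
    by rewrite addr_ge0// divr_ge0// addr_ge0// mulr_ge0.
  rewrite mulrDl -[L - phi L](subrKA (w k.+1)); apply: bndD.
    rewrite -opprB; apply: bndN; apply: bnd_le (hL k.+1).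
    by rewrite ler_wpM2l// -subr_ge0 eS exprn_ge0.
  have -> : w k.+1 - phi L = hf (w k *m (w k - L) + (w k - L) *m L).
    rewrite [w k.+1]/= -/(w k) /phi -vscaleB; congr hf.
    rewrite mulmxBl mulmxBr opprD addrACA subrr add0r.
    by rewrite addrA subrK.
  have -> : (t * N + N * K) / 2 * e k = (t * (N * e k) + (N * e k) * K) / 2.
    by ring.
  apply: bnd_hf; apply: bndD; apply: bndM => //.
  by rewrite mulr_ge0.
exists (1%:M - L); rewrite adjmxB adjmx1 L_adj mulmxBl mul1mx mulmxBr mulmx1.
have LL : L + L = c + L *m L.
  move/eqP: fixL; rewrite subr_eq0 => /eqP {1 2}->.
  exact: vscale_half.
have {LL}<- : L + L - c = L *m L by rewrite LL addrC addrA addNr add0r.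
have -> : L - (L + L - c) = c - L.
  by rewrite opprB addrCA opprD addNKr.
by rewrite opprB subrKA subKr.
Qed.
End SquareRoot.

Section TraceNonneg.
Variable tau : {scalar M}.
Hypothesis tauP : faithful_normal_tracial_state tau.

Definition mtr n (A : 'M[M]_n) : R := complex.Re (\sum_i tau (A i i)).

Lemma mtrD n (A B : 'M[M]_n) : mtr (A + B) = mtr A + mtr B.
Proof.
rewrite /mtr -ReD -big_split /=; congr complex.Re; apply: eq_bigr => i _.
by rewrite mxE linearD.
Qed.
Lemma mtrZ n (x : R) (A : 'M[M]_n) : mtr (vscale x%:C A) = x * mtr A.
Proof.
rewrite /mtr -ReZ big_distrr; congr complex.Re; apply: eq_bigr => i _.
by rewrite mxE linearZ.
Qed.
Lemma mtrN n (A : 'M[M]_n) : mtr (- A) = - mtr A.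
Proof.
rewrite /mtr -ReN -sumrN; congr complex.Re; apply: eq_bigr => i _.
by rewrite mxE linearN.
Qed.
Lemma mtrB n (A B : 'M[M]_n) : mtr (A - B) = mtr A - mtr B.
Proof. by rewrite mtrD mtrN. Qed.
Lemma mtr0 n : mtr (0 : 'M[M]_n) = 0.
Proof. by rewrite -(subrr 0) mtrB subrr. Qed.
Lemma mtr1 n : mtr (1%:M : 'M[M]_n) = n%:R.
Proof.
rewrite /mtr (eq_bigr (fun=> 1)) => [|i _].
  by rewrite sumr_const card_ord -[1]/(1%:C) -rmorphMn.
by rewrite mxE eqxx; case: tauP => -[].
Qed.
Lemma mtr_mulC m n (A : 'M[M]_(m, n)) (B : 'M[M]_(n, m)) : mtr (A *m B) = mtr (B
  *m A).
Proof.
rewrite /mtr; congr complex.Re.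
under eq_bigr do rewrite mxE linear_sum.
under [RHS]eq_bigr do rewrite mxE linear_sum.
rewrite exchange_big /=; apply: eq_bigr => i _; apply: eq_bigr => j _.
by case: tauP => _ _ _; apply.
Qed.

Lemma mtr_adjM_ge0 m n (A : 'M[M]_(m, n)) : 0 <= mtr (adj A *m A).
Proof.
apply: Re_ge0; apply: sumr_ge0 => i _; rewrite mxE linear_sum.
by apply: sumr_ge0 => j _; rewrite !mxE; case: tauP => -[].
Qed.

Lemma mtr_ge0 n (z : 'M[M]_n) : adj z = z ->
  (forall u, 0 <= mip (act z u) u) -> 0 <= mtr z.
Proof.
move=> z_adj z_pos; have [K K0 bK] := bnd_exists z.
suff main (x : R) : 0 < x -> 0 <= mtr z + x * n%:R.
  apply/ler_addgt0Pr => x x0.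
  have n1 : 0 < n%:R + 1 :> R by rewrite ltr_wpDl.
  apply: le_trans (main (x / (n%:R + 1)) (divr_gt0 x0 n1)) _.
  by rewrite lerD2l -mulrA ger_pMr// mulrC ler_pdivrMr// mul1r lerDl.
move=> x0; have Kx0 : 0 < K + x by rewrite ltr_wpDl.
pose i : R := (K + x)^-1; have i0 : 0 < i by rewrite invr_gt0.
pose z' := vscale i%:C (z + vscale x%:C 1%:M).
have z'_adj : adj z' = z'.
  by rewrite /z' adjmxZ adjmxD adjmxZ adjmx1 !conjC_real z_adj.
pose t := 1 - x / (K + x).
have t0 : 0 <= t by rewrite subr_ge0 ler_pdivrMr// mul1r lerDr.
have t1 : t < 1 by rewrite gtrBl divr_gt0.
pose q u := complex.Re (mip (act z u) u).
have q_ge0 u : 0 <= q u by exact: Re_ge0.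
have q_le u : q u <= K * mnorm u ^+ 2.
  apply: le_trans (ler_norm _) _; apply: le_trans (Re_le_cabs _) _.
  apply: le_trans (cabs_ip (@mip_lin R M n) (@mip_sym R M n) (@mip_ge0 R M n) _
    _) _.
  by rewrite expr2 mulrA ler_wpM2r ?mnorm_ge0//; exact: bK.
have formE u : mip (act (1%:M - z') u) u = (t * mnorm u ^+ 2 - i * q u)%:C.
  rewrite actBl act1 actZl actDl actZl act1.
  rewrite (ipBl (@mip_lin R M n)) (ipZl (@mip_lin R M n)).
  rewrite (ipDl (@mip_lin R M n)) (ipZl (@mip_lin R M n)).
  rewrite (ge0_ReE (z_pos u)) -/(q u) (ge0_ReE (mip_ge0 u)) -sqr_mnorm.
  rewrite -!(rmorphM, rmorphD, rmorphB) /=; congr (_%:C); rewrite /t /i; ring.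
have form_ge0 u : 0 <= t * mnorm u ^+ 2 - i * q u.
  rewrite subr_ge0; apply: (@le_trans _ _ (i * (K * mnorm u ^+ 2))).
    by rewrite ler_wpM2l// ltW.
  rewrite mulrA ler_wpM2r ?sqr_ge0// /i /t.
  by rewrite -{1}(divff (lt0r_neq0 Kx0)) -mulrBl addrK mulrC.
have form_le u : t * mnorm u ^+ 2 - i * q u <= t * mnorm u ^+ 2.
  by rewrite gerBl mulr_ge0// ltW.
have [s z's] : exists s : 'M[M]_n, z' = adj s *m s.
  apply: (sqrt_near_identity z'_adj t0 t1) => u.
  rewrite -ler_sqr ?nnegrE ?mulr_ge0 ?mnorm_ge0// exprMn !(sqr_ipnorm (@mip_ge0
    R M n)).
  apply: (@positive_operator_bound _ _ _ (@mip_lin R M n) (@mip_sym R M n)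
    (@mip_ge0 R M n)) => //.
  - by move=> c v w; rewrite act_linr.
  - by move=> v w; rewrite act_adj adjmxB adjmx1 z'_adj.
  - by move=> v; rewrite formE ler0c.
  - by rewrite formE /= -(sqr_ipnorm (@mip_ge0 R M n)).
  - by rewrite formE /= -(sqr_ipnorm (@mip_ge0 R M n)).
have : 0 <= mtr z' by rewrite z's mtr_adjM_ge0.
by rewrite /z' mtrZ mtrD mtrZ mtr1 pmulr_rge0.
Qed.
End TraceNonneg.
End MatrixPositivity.

(** * Spectral resolutions *)

Section Spectral.
Variables (R : realType) (M : vonNeumannAlgebra R) (n : nat).
Local Notation H := (vN_space M).
Local Notation adj := (@vN_adjmx R M _ _).
Local Notation mip := (@mip R M n).
Variables (a : 'M[M]_n) (E : set (measurableTypeR R) -> 'M[M]_n).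
Hypotheses (a_adj : adj a = a) (aE : spectral_resolution a E).
Implicit Types (B : set (measurableTypeR R)) (u v : {ffun 'I_n -> H}).

Definition qf (A : 'M[M]_n) u : R := complex.Re (mip (act A u) u).

Lemma vN_quadE (A : 'M[M]_n) u : complex.Re (vN_quad A u) = qf A u.
Proof.
rewrite /vN_quad /qf; congr complex.Re; apply: eq_bigr => i _.
by rewrite ffunE.
Qed.

Lemma qfD A A' u : qf (A + A') u = qf A u + qf A' u.
Proof. by rewrite /qf actDl (ipDl (@mip_lin R M n)) ReD. Qed.

Lemma qf1 u : qf 1%:M u = mnorm u ^+ 2.
Proof. by rewrite /qf act1 sqr_mnorm. Qed.

Lemma qf_add A u v : adj A = A ->
  qf A (u + v) = qf A u + qf A v + complex.Re (mip (act A u) v) *+ 2.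
Proof.
move=> hA; rewrite /qf actDr (ipDl (@mip_lin R M n)) !(ipDr (@mip_lin R M n)
  (@mip_sym R M n)).
have -> : mip (act A v) u = conjC (mip (act A u) v) by rewrite act_adj hA -mip_sym.
by rewrite !ReD cRe_conj mulr2n; ring.
Qed.

Lemma Re_mip_eq0 u : (forall v, complex.Re (mip u v) = 0) -> u = 0.
Proof. by move=> /(_ u); rewrite -sqr_mnorm => /eqP;
  rewrite sqrf_eq0 => /eqP/mnorm_eq0. Qed.

Lemma qf_eq0 A : adj A = A -> (forall u, qf A u = 0) -> A = 0.
Proof.
move=> hA A0; apply: act_inj => u; rewrite act0l; apply: Re_mip_eq0 => v.
have := qf_add u v hA; rewrite !A0 !add0r => /esym/eqP.
by rewrite mulrn_eq0 => /eqP.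
Qed.

Lemma spectral_adj B : measurable B -> adj (E B) = E B.
Proof. by case: aE => h _ _ _; exact: h. Qed.

Lemma spectralI A B : measurable A -> measurable B -> E (A `&` B) = E A *m E B.
Proof. by case: aE => _ _ h _; exact: h. Qed.

Lemma spectral_idem B : measurable B -> E B *m E B = E B.
Proof. by move=> mB; rewrite -spectralI// setIid. Qed.

Lemma spectral_measure_at u :
  exists nu : {measure set (measurableTypeR R) -> \bar R},
  [/\ forall B, measurable B -> nu B = (qf (E B) u)%:E,
      nu.-integrable setT (fun t : R => t%:E)
    & (\int[nu]_t (t%:E) = (qf a u)%:E)%E].
Proof.
case: aE => _ _ _ /(_ u)[nu [h1 h2 h3]]; exists nu; split => //.
  by move=> B mB; rewrite h1// vN_quadE.
by rewrite h3 vN_quadE.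
Qed.

Lemma spectralU A B : measurable A -> measurable B -> A `&` B = set0 ->
  E (A `|` B) = E A + E B.
Proof.
move=> mA mB AB0; apply/eqP; rewrite -subr_eq0; apply/eqP; apply: qf_eq0.
  by rewrite adjmxB adjmxD !spectral_adj//; exact: measurableU.
move=> u; have [nu [h _ _]] := spectral_measure_at u.
have hU : qf (E (A `|` B)) u = qf (E A) u + qf (E B) u.
  apply: EFin_inj; rewrite EFinD -!h//; last exact: measurableU.
  exact: measureU.
rewrite qfD hU.
by rewrite /qf actNl (ipNl (@mip_lin R M n)) ReN actDl (ipDl (@mip_lin R M n))
  ReD subrr.
Qed.

Lemma spectral0 : E set0 = 0.
Proof.
apply: (addrI (E set0)); rewrite -spectralU ?setU0 ?addr0//; last exact: setI0.
Qed.

Lemma spectralC B : measurable B -> E B + E (~` B) = 1%:M.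
Proof.
move=> mB; rewrite -spectralU ?setUv ?setICr//; last exact: measurableC.
by case: aE.
Qed.

Lemma spectral_disj A B : measurable A -> measurable B -> A `&` B = set0 ->
  E A *m E B = 0.
Proof. by move=> mA mB AB; rewrite -spectralI// AB spectral0. Qed.

Lemma spectral_form_bounds B (s t : R) u : measurable B ->
  (forall x : R, B x -> s <= x <= t) -> act (E B) u = u ->
  s * mnorm u ^+ 2 <= qf a u <= t * mnorm u ^+ 2.
Proof.
move=> mB Bst uB; have [nu [h1 h2 h3]] := spectral_measure_at u.
have mC := measurableC mB.
have nuC : nu (~` B) = 0.
  rewrite h1// /qf -uB -actM spectral_disj ?setICl// act0l.
  by rewrite (ip0l (@mip_lin R M n)).
have nuB : nu B = (mnorm u ^+ 2)%:E by rewrite h1// /qf uB -sqr_mnorm.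
have intB : nu.-integrable B (fun t : R => t%:E).
  by apply: integrableS h2 => //; exact: measurableT.
have cstB (c : R) : nu.-integrable B (cst c%:E).
  apply/integrableP; split; first exact: measurable_cst.
  by rewrite integral_cst//= nuB -EFinM ltry.
have : (\int[nu]_(x in B) x%:E = (qf a u)%:E)%E.
  rewrite -h3 (@negligible_integral _ _ _ nu setT (~` B))//.
  by rewrite setTD setCK.
have low : (\int[nu]_(x in B) (cst s%:E) x <= \int[nu]_(x in B) x%:E)%E.
  by apply: le_integral => // x /set_mem/Bst/andP[? ?]; rewrite lee_fin.
have upp : (\int[nu]_(x in B) x%:E <= \int[nu]_(x in B) (cst t%:E) x)%E.
  by apply: le_integral => // x /set_mem/Bst/andP[? ?]; rewrite lee_fin.
move=> hB; move: low upp; rewrite hB !integral_cst// nuB -!EFinM !lee_fin.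
by move=> -> ->.
Qed.

(* The spectral measure at the left-hand vector is the sum of those at its two
   components. *)
Lemma spectral_form_split B u v : measurable B ->
  qf a (act (E B) u + act (E (~` B)) v) =
  qf a (act (E B) u) + qf a (act (E (~` B)) v).
Proof.
move=> mB; have mC := measurableC mB.
set x := act (E B) u; set y := act (E (~` B)) v.
have [nu [h1 _ h3]] := spectral_measure_at (x + y).
have [nx [x1 x2 x3]] := spectral_measure_at x.
have [ny [y1 y2 y3]] := spectral_measure_at y.
apply: EFin_inj; rewrite EFinD -h3 -x3 -y3 -integral_measure_add//.
apply: eq_measure_integral => A mA _.
rewrite [RHS]measure_addE h1// x1// y1// -EFinD qf_add ?spectral_adj//.
have -> : mip (act (E A) x) y = 0.
  rewrite /y -[E (~` B)]spectral_adj// -act_adj /x -!actM.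
  rewrite -spectralI// -spectralI ?setIA//; last exact: measurableI.
  have -> : ~` B `&` A `&` B = set0.
    by apply/seteqP; split => // z [[]].
  by rewrite spectral0 act0l (ip0l (@mip_lin R M n)).
by rewrite mul0rn addr0.
Qed.

Lemma spectral_comm B : measurable B -> a *m E B = E B *m a.
Proof.
move=> mB; have mC := measurableC mB.
have CaB : E (~` B) *m a *m E B = 0.
  apply: act_inj => u; rewrite act0l; apply: Re_mip_eq0 => v.
  rewrite -mulmxA actM act_adj spectral_adj//.
  have := spectral_form_split u v mB; rewrite qf_add// -{2}[_ + qf a _]addr0.
  by move/addrI/eqP; rewrite mulrn_eq0 -actM => /eqP.
have BaC : E B *m a *m E (~` B) = 0.
  have /(congr1 adj) : E (~` B) *m a *m E B = 0 by [].
  rewrite !adjmxM a_adj !spectral_adj// mulmxA => ->.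
  by apply/matrixP => i j; rewrite !mxE star0.
have e1 : a *m E B = E B *m a *m E B.
  by rewrite -[LHS]mul1mx -(spectralC mB) mulmxDl !mulmxA CaB addr0.
by rewrite e1 -[RHS]mulmx1 -(spectralC mB) mulmxDr BaC addr0.
Qed.

End Spectral.

(** * The polynomials approximating the logarithm *)

(* For [t] in [0, 1], [qlog J (1 - t)] vanishes at [t = 0], is at most
   [2 ln 2 - 2 ln t], and is of the order of [- ln t] for [t] > 0 and [J]
   large. *)
Definition qlog (A : pzRingType) (J : nat) (g : A) : A :=
  \sum_(k < J) (g ^+ (2 * 2 ^ k) - g ^+ (2 * 4 ^ J)).

Section ScalarBounds.
Variable R : realType.

Lemma Bernoulli_ge (x : R) n : 0 <= x -> 1 + x *+ n <= (1 + x) ^+ n.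
Proof.
move=> x0; elim: n => [|n IH]; first by rewrite mulr0n addr0 expr0.
rewrite exprS; apply: (@le_trans _ _ ((1 + x) * (1 + x *+ n))); last first.
  by rewrite ler_wpM2l// addr_ge0.
rewrite mulrDl mul1r mulrDr mulr1 mulrS; set y := x *+ n.
have : 0 <= x * y by rewrite mulr_ge0// mulrn_wge0.
lra.
Qed.

Lemma Bernoulli_le (x : R) n : 0 <= x <= 1 -> 1 - x *+ n <= (1 - x) ^+ n.
Proof.
move=> /andP[x0 x1]; elim: n => [|n IH]; first by rewrite mulr0n subr0 expr0.
rewrite exprS; apply: (@le_trans _ _ ((1 - x) * (1 - x *+ n))); last first.
  by rewrite ler_wpM2l// subr_ge0.
rewrite mulrBl mul1r mulrBr mulr1 mulrS; set y := x *+ n.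
have : 0 <= x * y by rewrite mulr_ge0// mulrn_wge0.
lra.
Qed.

Lemma exp1B_le (x : R) n : 0 <= x <= 1 -> (1 - x) ^+ n * (1 + x *+ n) <= 1.
Proof.
move=> /andP[x0 x1]; apply: (@le_trans _ _ ((1 - x) ^+ n * (1 + x) ^+ n)).
  by rewrite ler_wpM2l ?exprn_ge0 ?subr_ge0// Bernoulli_ge.
rewrite -exprMn exprn_ile1 ?mulr_ge0 ?subr_ge0 ?addr_ge0//.
by rewrite -subr_sqr expr1n gerBl sqr_ge0.
Qed.

Lemma qlog_lower (x y : R) p : 0 <= x <= 1 -> 0 < y <= 1 -> x * 2 ^+ p <= 2^-1 ->
  exists J0, forall J, (J0 <= J)%N ->
    p%:R / 2 - 1 <= \sum_(k < J) ((1 - x) ^+ (2 * 2 ^ k) - (1 - y) ^+ (2 * 4 ^ J)).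
Proof.
move=> x01 /andP[y0 y1] xp.
exists (maxn p (Num.Def.truncn y^-1).+1) => J; rewrite geq_max => /andP[pJ yJ].
rewrite sumrB; apply: lerD.
  rewrite -(big_mkord xpredT (fun k => (1 - x) ^+ (2 * 2 ^ k))) (@big_cat_nat _
    _ _ p)//=.
  apply: (@le_trans _ _ (\sum_(0 <= k < p) (1 - x) ^+ (2 * 2 ^ k))); last first.
    rewrite lerDl sumr_ge0// => k _; case/andP: x01 => _ ?.
    by rewrite exprn_ge0// subr_ge0.
  have -> : p%:R / 2 = \sum_(0 <= k < p) (2^-1 : R).
    by rewrite big_const_nat subn0 iter_addr_0 mulr_natl.
  rewrite big_nat_cond [leRHS]big_nat_cond; apply: ler_sum => k;
    rewrite andbT => /andP[_ kp].
  apply: le_trans (Bernoulli_le _ x01).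
  have : x *+ (2 * 2 ^ k) <= 2^-1.
    apply: le_trans xp; rewrite -[x *+ _]mulr_natr ler_wpM2l//;
      first by case/andP: x01.
    by rewrite -natrX ler_nat -expnS leq_exp2l.
  lra.
rewrite sumr_const card_ord lerN2.
have yJ1 : 1 <= y * J%:R.
  rewrite mulrC -ler_pdivrMr// mul1r; apply: ltW.
  by apply: lt_le_trans (truncnS_gt _) _; rewrite ler_nat.
have JJ : (J * J <= 4 ^ J)%N.
  by rewrite -[4%N]/(2 * 2)%N expnMn leq_mul// ltnW// ltn_expl.
set w := (1 - y) ^+ _; have w0 : 0 <= w by rewrite exprn_ge0// subr_ge0.
have : w * (1 + y *+ (2 * 4 ^ J)) <= 1 by rewrite exp1B_le// ltW.
apply: le_trans; rewrite -mulr_natr ler_wpM2l//.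
apply: (@le_trans _ _ (y *+ (J * J))); last first.
  rewrite ler_wpDl// ler_wpMn2l ?ltW//.
  by rewrite (leq_trans JJ)// leq_pmull.
by rewrite -[y *+ _]mulr_natr natrM mulrA ler_peMl.
Qed.

End ScalarBounds.

Section SpectralInequality.
Variables (R : realType) (M : vonNeumannAlgebra R) (n : nat).
Local Notation H := (vN_space M).
Local Notation adj := (@vN_adjmx R M _ _).
Local Notation mip := (@mip R M n).
Variable tau : {scalar M}.
Hypothesis tauP : faithful_normal_tracial_state tau.
Variables (a : 'M[M]_n) (E : set (measurableTypeR R) -> 'M[M]_n).
Hypotheses (a_adj : adj a = a) (a_ge0 : forall u, 0 <= mip (act a u) u).
Hypothesis aE : spectral_resolution a E.
Implicit Types (B : set (measurableTypeR R)) (u v : {ffun 'I_n -> H}).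

Lemma sym_mip (A : 'M[M]_n) u : adj A = A -> mip (act A u) u = (qf A u)%:C.
Proof.
move=> hA; rewrite /qf RRe_real//; apply/CrealP.
by rewrite -mip_sym act_adj hA.
Qed.

Lemma mtr_ge0_qf (A : 'M[M]_n) : adj A = A -> (forall u, 0 <= qf A u) ->
  0 <= mtr tau A.
Proof. by move=> hA A0; apply: mtr_ge0 => // u; rewrite sym_mip// ler0c. Qed.

Variable C : R.
Hypotheses (C_ge2 : 2 <= C) (aC : forall u, mnorm (act a u) ^+ 2 <= C * mnorm u
  ^+ 2).

Let g := 1%:M - vscale C^-1%:C (a *m a).

Let C_ge1 : 1 <= C. Proof. by apply: le_trans C_ge2; rewrite ler1n. Qed.
Let C0 : 0 < C. Proof. exact: lt_le_trans C_ge1. Qed.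

Let g_adj : adj g = g.
Proof. by rewrite /g adjmxB adjmx1 adjmxZ conjC_real adjmxM a_adj. Qed.

Let qf_g u : qf g u = mnorm u ^+ 2 - C^-1 * mnorm (act a u) ^+ 2.
Proof.
rewrite /g qfD qf1 /qf actNl (ipNl (@mip_lin R M n)) ReN actZl.
by rewrite (ipZl (@mip_lin R M n)) ReZ actM act_adj a_adj !sqr_mnorm.
Qed.

Let g_ge0 u : 0 <= qf g u.
Proof. by rewrite qf_g subr_ge0 mulrC ler_pdivrMr// mulrC. Qed.

Lemma operator_bound (A : 'M[M]_n) (l : R) u : adj A = A ->
  (forall v, 0 <= qf A v) ->
  0 <= l -> qf A u <= l * mnorm u ^+ 2 ->
  qf A (act A u) <= l * mnorm (act A u) ^+ 2 ->
  mnorm (act A u) <= l * mnorm u.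
Proof.
move=> hA A0 l0 h1 h2.
rewrite -ler_sqr ?nnegrE ?mulr_ge0 ?mnorm_ge0// exprMn !(sqr_ipnorm (@mip_ge0 R
  M n)).
rewrite !(sqr_ipnorm (@mip_ge0 R M n)) in h1 h2.
apply: (@positive_operator_bound _ _ _ (@mip_lin R M n) (@mip_sym R M n)
  (@mip_ge0 R M n)) => //.
- by move=> c v w; rewrite act_linr.
- by move=> v w; rewrite act_adj hA.
- by move=> v; rewrite sym_mip// ler0c.
Qed.

Let g_contr u : mnorm (act g u) <= mnorm u.
Proof.
rewrite -[leRHS]mul1r; apply: operator_bound => //.
  by rewrite qf_g mul1r gerBl mulr_ge0 ?sqr_ge0// invr_ge0 ltW.
by rewrite qf_g mul1r gerBl mulr_ge0 ?sqr_ge0// invr_ge0 ltW.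
Qed.

Let g_contrX j k u : mnorm (act (g ^+ (j + k)) u) <= mnorm (act (g ^+ j) u).
Proof.
elim: k => [|k IH]; first by rewrite addn0.
rewrite addnS exprS -mulmxE actM; exact: le_trans (g_contr _) IH.
Qed.

Let qf_gX j u : qf (g ^+ (2 * j)) u = mnorm (act (g ^+ j) u) ^+ 2.
Proof.
by rewrite mul2n -addnn exprD -mulmxE /qf actM act_adj adjmxX// sqr_mnorm.
Qed.

Lemma qfN A u : qf (- A) u = - qf A u.
Proof. by rewrite /qf actNl (ipNl (@mip_lin R M n)) ReN. Qed.

Lemma qf_sum I (s : seq I) (P : pred I) (F : I -> 'M[M]_n) u :
  qf (\sum_(i <- s | P i) F i) u = \sum_(i <- s | P i) qf (F i) u.
Proof.
elim/big_rec2: _ => [|i y1 y2 _ <-]; last by rewrite qfD.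
by rewrite /qf act0l (ip0l (@mip_lin R M n)).
Qed.

Lemma qf_qlog J u : qf (qlog J g) u =
  \sum_(k < J) (mnorm (act (g ^+ (2 ^ k)) u) ^+ 2 - mnorm (act (g ^+ (4 ^ J)) u)
    ^+ 2).
Proof. by rewrite /qlog qf_sum; apply: eq_bigr => k _; rewrite qfD qfN !qf_gX. Qed.

Lemma qlog_adj J : adj (qlog J g) = qlog J g.
Proof.
by rewrite /qlog adjmx_sum; apply: eq_bigr => k _; rewrite adjmxB !adjmxX.
Qed.

Lemma qlog_ge0 J u : 0 <= qf (qlog J g) u.
Proof.
rewrite qf_qlog sumr_ge0// => k _; rewrite subr_ge0 ler_sqr ?nnegrE ?mnorm_ge0//.
rewrite -[(4 ^ J)%N](@subnKC (2 ^ k)%N) ?g_contrX//.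
rewrite -[4%N]/(2 ^ 2)%N -expnM leq_exp2l//.
by rewrite (leq_trans (ltnW (ltn_ord k)))// leq_pmull.
Qed.

Section Annulus.
Variables (B : set (measurableTypeR R)) (s t : R).
Hypotheses (mB : measurable B) (s0 : 0 < s) (t1 : t <= 1).
Hypothesis Bst : forall x : R, B x -> s <= x <= t.
Let alpha := C^-1 * s ^+ 2.
Let beta := C^-1 * t ^+ 2.

Let st : s <= t \/ E B = 0.
Proof.
have [[x /Bst/andP[h1 h2]]|B0] := pselect (B !=set0).
  by left; exact: le_trans h2.
right; have -> : B = set0 by apply/seteqP; split => // x Bx; case: B0; exists x.
exact: (spectral0 aE).
Qed.

Let gE : g *m E B = E B *m g.
Proof.
have aB := spectral_comm a_adj aE mB.
have aaB : a *m a *m E B = E B *m (a *m a).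
  by rewrite -mulmxA aB mulmxA aB mulmxA.
rewrite /g mulmxBl mulmxBr mul1mx mulmx1; congr (_ - _).
apply: act_inj => u; rewrite [LHS]actM actZl [RHS]actM actZl actZr -!actM.
by rewrite aaB.
Qed.

Let gR u : act (E B) u = u -> act (E B) (act g u) = act g u.
Proof. by move=> uB; rewrite -actM -gE actM uB. Qed.

Let a_upper u : act (E B) u = u -> s <= t -> mnorm (act a u) <= t * mnorm u.
Proof.
move=> uB st'; apply: operator_bound => //.
- by move=> v; exact: Re_ge0.
- by rewrite (le_trans (ltW s0)).
- by case/andP: (spectral_form_bounds aE mB Bst uB).
- have aR : act (E B) (act a u) = act a u.
    by rewrite -actM -(spectral_comm a_adj aE mB) actM uB.
  by case/andP: (spectral_form_bounds aE mB Bst aR).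
Qed.

Let a_lower u : act (E B) u = u -> s * mnorm u <= mnorm (act a u).
Proof.
move=> uB; have [u0|u0] := eqVneq (mnorm u) 0; first by rewrite u0 mulr0 mnorm_ge0.
have u1 : 0 < mnorm u by rewrite lt_def u0 mnorm_ge0.
rewrite -(ler_pM2r u1) -mulrA -expr2.
have /andP[h _] := spectral_form_bounds aE mB Bst uB; apply: (le_trans h).
apply: le_trans (ler_norm _) _; apply: le_trans (Re_le_cabs _) _.
exact: (cabs_ip (@mip_lin R M n) (@mip_sym R M n) (@mip_ge0 R M n)).
Qed.

Let g_upper u : act (E B) u = u -> s <= t ->
  mnorm (act g u) <= (1 - alpha) * mnorm u.
Proof.
move=> uB st'; have qf_le v : act (E B) v = v ->
  qf g v <= (1 - alpha) * mnorm v ^+ 2.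
  move=> vB; rewrite qf_g mulrBl mul1r lerD2l lerN2 /alpha -mulrA ler_wpM2l
    ?invr_ge0 ?(ltW C0)//.
  by rewrite -exprMn ler_sqr ?nnegrE ?mulr_ge0 ?mnorm_ge0 ?(ltW s0)// a_lower.
apply: operator_bound => //; try exact: qf_le.
  rewrite subr_ge0 /alpha mulrC ler_pdivrMr// mul1r (le_trans _ C_ge1)//.
  by rewrite exprn_ile1// ?(ltW s0)// (le_trans st').
by apply: qf_le; exact: gR.
Qed.

Let g_lower u : act (E B) u = u -> s <= t ->
  (1 - beta) * mnorm u <= mnorm (act g u).
Proof.
move=> uB st'; have [u0|u0] := eqVneq (mnorm u) 0;
  first by rewrite u0 mulr0 mnorm_ge0.
have u1 : 0 < mnorm u by rewrite lt_def u0 mnorm_ge0.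
rewrite -(ler_pM2r u1) -mulrA -expr2; apply: (@le_trans _ _ (qf g u)).
  rewrite qf_g mulrBl mul1r lerD2l lerN2 /beta -mulrA ler_wpM2l ?invr_ge0 ?(ltW
    C0)//.
  rewrite -exprMn ler_sqr ?nnegrE ?mulr_ge0 ?mnorm_ge0 ?(le_trans (ltW s0))//.
  exact: a_upper.
apply: le_trans (ler_norm _) _; apply: le_trans (Re_le_cabs _) _.
exact: (cabs_ip (@mip_lin R M n) (@mip_sym R M n) (@mip_ge0 R M n)).
Qed.

Lemma qlog_annulus p : beta * 2 ^+ p <= 2^-1 ->
  exists J0, forall J, (J0 <= J)%N ->
    (p%:R / 2 - 1) * mtr tau (E B) <= mtr tau (E B *m qlog J g).
Proof.
move=> bp; have [st'|EB0] := st; last first.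
  by exists 0 => J _; rewrite EB0 mul0mx mtr0 mulr0.
have alpha01 : 0 < alpha <= 1.
  rewrite mulr_gt0 ?invr_gt0 ?exprn_gt0//= /alpha mulrC ler_pdivrMr// mul1r.
  by rewrite (le_trans _ C_ge1)// exprn_ile1// ?(ltW s0)// (le_trans st').
have t0 : 0 <= t by rewrite (le_trans (ltW s0)).
have beta01 : 0 <= beta <= 1.
  rewrite mulr_ge0 ?invr_ge0 ?(ltW C0) ?exprn_ge0//= /beta mulrC ler_pdivrMr//
    mul1r.
  by rewrite (le_trans _ C_ge1)// exprn_ile1.
have [J0 hJ0] := qlog_lower beta01 alpha01 bp; exists J0 => J /hJ0{J0}hJ0.
have gXR j u : act (E B) u = u -> act (E B) (act (g ^+ j) u) = act (g ^+ j) u.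
  move=> uB; elim: j => [|j IH]; first by rewrite expr0 -[1]/(1%:M) act1.
  by rewrite exprS -mulmxE actM; exact: gR.
have upX j u : act (E B) u = u ->
  mnorm (act (g ^+ j) u) <= (1 - alpha) ^+ j * mnorm u.
  move=> uB; elim: j => [|j IH]; first by rewrite !expr0 mul1r -[1]/(1%:M) act1.
  rewrite !exprS -mulmxE actM; apply: le_trans (g_upper (gXR _ _ uB) st') _.
  by rewrite -mulrA ler_wpM2l// subr_ge0; case/andP: alpha01.
have lowX j u : act (E B) u = u ->
  (1 - beta) ^+ j * mnorm u <= mnorm (act (g ^+ j) u).
  move=> uB; elim: j => [|j IH]; first by rewrite !expr0 mul1r -[1]/(1%:M) act1.
  rewrite !exprS -mulmxE actM; apply: le_trans (g_lower (gXR _ _ uB) st').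
  by rewrite -mulrA ler_wpM2l// subr_ge0; case/andP: beta01.
have qf_ge u : act (E B) u = u -> (p%:R / 2 - 1) * mnorm u ^+ 2 <= qf (qlog J g) u.
  move=> uB; rewrite qf_qlog; apply: le_trans (ler_wpM2r (sqr_ge0 _) hJ0) _.
  rewrite mulr_suml; apply: ler_sum => k _; rewrite mulrBl; apply: lerB.
    rewrite mulnC exprM -exprMn ler_sqr ?nnegrE ?mulr_ge0 ?mnorm_ge0 ?exprn_ge0//.
      exact: lowX.
    by rewrite subr_ge0; case/andP: beta01.
  rewrite mulnC exprM -exprMn ler_sqr ?nnegrE ?mulr_ge0 ?mnorm_ge0 ?exprn_ge0//.
    exact: upX.
  by rewrite subr_ge0; case/andP: alpha01.
have idB := spectral_idem aE mB; have adjB := spectral_adj aE mB.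
have -> : mtr tau (E B *m qlog J g) = mtr tau (E B *m qlog J g *m E B).
  by rewrite [RHS]mtr_mulC// mulmxA idB.
rewrite -subr_ge0 -mtrZ -mtrB; apply: mtr_ge0_qf.
  by rewrite adjmxB adjmxZ conjC_real !adjmxM qlog_adj adjB mulmxA.
move=> u; rewrite qfD qfN {2}/qf actZl (ipZl (@mip_lin R M n)) ReZ -/(qf _ _).
have -> : qf (E B) u = mnorm (act (E B) u) ^+ 2.
  by rewrite -{1}idB /qf actM act_adj adjB sqr_mnorm.
have -> : qf (E B *m qlog J g *m E B) u = qf (qlog J g) (act (E B) u).
  by rewrite /qf !actM act_adj adjB.
by rewrite subr_ge0 qf_ge// -actM idB.
Qed.
End Annulus.

Lemma mtr_qlog_ge0 B J : measurable B -> 0 <= mtr tau (E B *m qlog J g).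
Proof.
move=> mB; have idB := spectral_idem aE mB; have adjB := spectral_adj aE mB.
have -> : mtr tau (E B *m qlog J g) = mtr tau (E B *m qlog J g *m E B).
  by rewrite [RHS]mtr_mulC// mulmxA idB.
apply: mtr_ge0_qf; first by rewrite !adjmxM qlog_adj adjB mulmxA.
move=> u; have -> : qf (E B *m qlog J g *m E B) u = qf (qlog J g) (act (E B) u).
  by rewrite /qf !actM act_adj adjB.
exact: qlog_ge0.
Qed.

Definition dyadic i : set (measurableTypeR R) := [set` `](2 ^- i.+1 : R), 2 ^- i]].

Lemma qlog_dyadic (I : nat) : exists J,
  \sum_(i < I) (i%:R - 1) * mtr tau (E (dyadic i)) <= mtr tau (qlog J g).
Proof.
have mD i : measurable (dyadic i) by exact: measurable_itv.
have /choice[J0 hJ0] : forall i, exists J0, forall J, (J0 <= J)%N ->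
    (i%:R - 1) * mtr tau (E (dyadic i)) <= mtr tau (E (dyadic i) *m qlog J g).
  move=> i.
  have s_gt0 : 0 < 2 ^- i.+1 :> R by rewrite invr_gt0 exprn_gt0.
  have t_le1 : 2 ^- i <= 1 :> R by rewrite invf_le1 ?exprn_gt0// exprn_ege1// ler1n.
  have iD (x : R) : dyadic i x -> 2 ^- i.+1 <= x <= 2 ^- i.
    by rewrite /dyadic /= in_itv /= => /andP[/ltW -> ->].
  have hp : C^-1 * (2 ^- i) ^+ 2 * 2 ^+ i.*2 <= 2^-1 :> R.
    rewrite -mulrA exprVn -exprM muln2 mulVf ?expf_neq0// mulr1.
    by rewrite lef_pV2 ?posrE.
  have [J0 hJ0] := qlog_annulus (mD i) s_gt0 t_le1 iD hp.
  exists J0 => J /hJ0; rewrite -muln2 natrM mulfK//.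
pose J := \max_(i < I) J0 i; exists J.
pose U i : set (measurableTypeR R) := [set` `](2 ^- i : R), 1]].
have mU i : measurable (U i) by exact: measurable_itv.
have hU k : (k <= I)%N -> \sum_(i < k) (i%:R - 1) * mtr tau (E (dyadic i)) <=
    mtr tau (E (U k) *m qlog J g).
  elim: k => [|k IH] kI; first by rewrite big_ord0 mtr_qlog_ge0.
  rewrite big_ord_recr /= (_ : U k.+1 = U k `|` dyadic k); last first.
    apply/seteqP; split => x /=; rewrite /U /dyadic /= !in_itv /=.
      move=> /andP[x1 x2]; have [xk|xk] := ltP (2 ^- k) x; [left|right].
        by apply/andP; split.
      by apply/andP; split.
    have k1 : 2 ^- k.+1 <= 2 ^- k :> R.
      by rewrite lef_pV2 ?posrE ?exprn_gt0// ler_weXn2l// ler1n.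
    have k2 : 2 ^- k <= 1 :> R by rewrite invf_le1 ?exprn_gt0// exprn_ege1// ler1n.
    move=> [|] /andP[x1 x2]; apply/andP; split => //.
      exact: le_lt_trans x1.
    exact: le_trans k2.
  rewrite (spectralU aE)//; last first.
    apply/seteqP; split => x //=; rewrite /U /dyadic /= !in_itv /=.
    by move=> [/andP[x1 _] /andP[_ x2]]; move: (lt_le_trans x1 x2); rewrite ltxx.
  rewrite mulmxDl mtrD; apply: lerD; first exact/IH/ltnW.
  by apply: hJ0; exact: (leq_bigmax (Ordinal kI)).
apply: le_trans (hU I (leqnn _)) _.
rewrite -[qlog J g in leRHS]mul1mx -(spectralC aE (mU I)) mulmxDl mtrD lerDl.
by apply: mtr_qlog_ge0; exact: measurableC.
Qed.

End SpectralInequality.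

(** * Integrability of the logarithm *)

Section LogIntegral.
Variables (R : realType) (mu : {measure set (measurableTypeR R) -> \bar R}).
Local Notation D i := (@dyadic R i).

Lemma dyadic_cover : \bigcup_i D i = [set` `](0 : R), 1]].
Proof.
apply/seteqP; split => x /=.
  move=> [i _]; rewrite /dyadic /= !in_itv /= => /andP[x1 x2]; apply/andP; split.
    by apply: lt_trans x1; rewrite invr_gt0 exprn_gt0.
  by apply: le_trans x2 _; rewrite invf_le1 ?exprn_gt0// exprn_ege1// ler1n.
rewrite in_itv /= => /andP[x0 x1].
have [i hi] : exists i, 2 ^- i.+1 < x.
  exists (Num.Def.truncn x^-1); rewrite invf_plt ?posrE ?exprn_gt0//.
  apply: lt_trans (truncnS_gt _) _; rewrite -natrX ltr_nat; exact: ltn_expl.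
have [m hm mmin] := ex_minnP (ex_intro (fun i => 2 ^- i.+1 < x) i hi).
exists m => //; rewrite /dyadic /= in_itv /=; apply/andP; split => //.
case: m hm mmin => [|m] _ mmin; first by rewrite expr0 invr1.
by rewrite leNgt; apply/negP => /mmin; rewrite ltnn.
Qed.

Lemma dyadic_trivIset : trivIset setT (fun i => D i).
Proof.
apply/trivIsetP => i j _ _; wlog ij : i j / (i < j)%N => [hw|_].
  move=> ij; case: (ltngtP i j) ij => // [ij _|ji _].
    by apply: hw => //; rewrite ltn_eqF.
  by rewrite setIC; apply: hw => //; rewrite ltn_eqF.
apply/seteqP; split => x //=; rewrite /dyadic /= !in_itv /=.
move=> [/andP[x1 _] /andP[_ x2]]; have := lt_le_trans x1 x2; apply/negP.
by rewrite -leNgt lef_pV2 ?posrE ?exprn_gt0// ler_weXn2l// ler1n.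
Qed.

Lemma integral_ln_gtNy (K : R) : (forall B, measurable B -> mu B \is a fin_num) ->
  (forall I, \sum_(i < I) (i.+1)%:R * fine (mu (D i)) <= K) ->
  (-oo < \int[mu]_(t in `]0%R, +oo[) (ln t)%:E)%E.
Proof.
move=> mu_fin hK.
have mI : measurable (`]0%R, +oo[ : set (measurableTypeR R)) by exact:
  measurable_itv.
pose fl : measurableTypeR R -> \bar R := fun t => (ln t)%:E.
have mln (A : set (measurableTypeR R)) : measurable A ->
    measurable_fun A fl.
  by move=> mA; apply/measurable_EFinP; exact: measurable_funTS.
have mneg (A : set (measurableTypeR R)) : measurable A ->
    measurable_fun A (fl^\-)%E.
  by move=> mA; apply: measurable_funeneg; exact: mln.
have neg_fin : (\int[mu]_(t in `]0%R, +oo[) fl^\- t < +oo)%E.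
  have -> : [set` `]0%R, +oo[] = [set` `](0 : R), 1]] `|` [set` `](1 : R), +oo[]
    :> set R.
    apply/seteqP; split => x /=; rewrite !in_itv /= ?andbT.
      by move=> x0; case: (leP x 1) => x1; [left; rewrite x0|right].
    by case=> [/andP[]//|]; exact: lt_trans.
  rewrite ge0_integral_setU//=; last 2 first.
  - apply: mneg; apply: measurableU; exact: measurable_itv.
  - apply/disj_setPS => x /=; rewrite !in_itv /= andbT => -[/andP[_ x1] x2].
    by move: (lt_le_trans x2 x1); rewrite ltxx.
  rewrite [X in (_ + X)%E](_ : _ = 0%E) ?adde0; last first.
    apply: integral0_eq => x /=; rewrite in_itv /= andbT => x1.
    by rewrite funenegE -EFinN; apply/max_idPr;
      rewrite lee_fin oppr_le0 ln_ge0// ltW.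
  rewrite -dyadic_cover ge0_integral_bigcup//; last 3 first.
  - by move=> k; exact: measurable_itv.
  - by apply: mneg; rewrite dyadic_cover; exact: measurable_itv.
  - exact: dyadic_trivIset.
  apply: (@le_lt_trans _ _ (ln 2 * K)%:E); last exact: ltry.
  apply: lime_le.
    by apply: is_cvg_nneseries => i _ _; apply: integral_ge0.
  near=> I; apply: (@le_trans _ _ (\sum_(0 <= i < I) (ln 2 * ((i.+1)%:R * fine
    (mu (D i))))%:E)%E).
    apply: lee_sum => i _.
    apply: (@le_trans _ _ (\int[mu]_(x in D i) (cst (ln 2 * (i.+1)%:R)%:E) x)%E).
      apply: ge0_le_integral => //.
      + exact: measurable_itv.
      + by apply: mneg; exact: measurable_itv.
      + move=> x; rewrite /dyadic /= in_itv /= => /andP[x1 x2].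
        have x0 : 0 < x by apply: lt_trans x1; rewrite invr_gt0 exprn_gt0.
        rewrite funenegE ge_max /=; apply/andP; split; last first.
          by rewrite lee_fin mulr_ge0// ln_ge0// ler1n.
        rewrite lee_fin lerNl mulr_natr -lnXn// -lnV ?posrE ?exprn_gt0//.
        by rewrite ler_ln ?posrE ?invr_gt0 ?exprn_gt0// ltW.
    rewrite integral_cst; last exact: measurable_itv.
    have -> : mu (D i) = (fine (mu (D i)))%:E.
      by rewrite fineK// mu_fin//; exact: measurable_itv.
    by rewrite /= -EFinM lee_fin mulrA.
  rewrite sumEFin lee_fin -mulr_sumr ler_wpM2l ?ln_ge0 ?ler1n// big_mkord.
  exact: hK.
rewrite integralE; apply: (@lt_le_trans _ _ (0 - \int[mu]_(t in `]0%R, +oo[)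
  fl^\- t)%E).
  by rewrite sub0e -lteN2 oppeK.
by rewrite leeB// integral_ge0.
Unshelve. all: by end_near. Qed.

End LogIntegral.

Section LogUpper.
Variable R : realType.

(* Telescopes along [s = 2 ^ k t]. *)
Lemma inv1D_le_ln (s : R) : 0 < s ->
  (1 + s)^-1 <= 2 * (ln (2 * s / (1 + 2 * s)) - ln (s / (1 + s))).
Proof.
move=> s0; have s1 : 0 < 1 + s by rewrite addr_gt0.
have s2 : 0 < 1 + 2 * s by rewrite addr_gt0// mulr_gt0.
rewrite -ln_div ?posrE ?divr_gt0 ?mulr_gt0//.
have -> : 2 * s / (1 + 2 * s) / (s / (1 + s)) = (1 - (2 * (1 + s))^-1)^-1.
  field; rewrite ?gt_eqF//=; try lra.
have x1 : 0 < 1 - (2 * (1 + s))^-1.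
  by rewrite subr_gt0 invf_lt1 ?mulr_gt0//; lra.
rewrite lnV ?posrE//.
have := @le_ln1Dx R (- (2 * (1 + s))^-1).
rewrite ltrN2 invf_lt1 ?mulr_gt0// => /(_ _)/= h.
have {}h : ln (1 - (2 * (1 + s))^-1) <= - (2 * (1 + s))^-1 by apply: h; lra.
have -> : (1 + s)^-1 = 2 * (2 * (1 + s))^-1 by field; rewrite gt_eqF.
by rewrite ler_pM2l// lerNr.
Qed.

Lemma qlog_upper (t : R) J : 0 < t <= 1 -> qlog J (1 - t) <= 2 * ln 2 - 2 * ln t.
Proof.
move=> /andP[t0 t1].
pose phi (s : R) := 2 * ln (s / (1 + s)).
have tk k : 0 < 2 ^+ k * t by rewrite mulr_gt0 ?exprn_gt0.
apply: (@le_trans _ _ (\sum_(k < J) (phi (2 ^+ k.+2 * t) - phi (2 ^+ k.+1 * t)))).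
  apply: ler_sum => k _.
  apply: (@le_trans _ _ ((1 - t) ^+ (2 * 2 ^ k))).
    by rewrite gerBl exprn_ge0// subr_ge0.
  apply: (@le_trans _ _ (1 + 2 ^+ k.+1 * t)^-1); last first.
    have -> : 2 ^+ k.+2 * t = 2 * (2 ^+ k.+1 * t) by rewrite mulrA -exprS.
    by rewrite /phi -mulrBr; exact: inv1D_le_ln.
  rewrite -[leRHS]mul1r ler_pdivlMr ?addr_gt0//.
  have := @exp1B_le R t (2 * 2 ^ k); rewrite (ltW t0) t1 => /(_ isT).
  by rewrite -[t *+ _]mulr_natl natrM natrX -exprS.
rewrite -(big_mkord xpredT (fun k => phi (2 ^+ k.+2 * t) - phi (2 ^+ k.+1 * t)))
  telescope_sumr//.
have phi_le0 s : 0 < s -> phi s <= 0.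
  move=> s0; rewrite /phi pmulr_rle0// ln_le0// ler_pdivrMr ?addr_gt0// mul1r
    lerDr//.
have phit : 2 * ln t - 2 * ln 2 <= phi (2 ^+ 1 * t).
  rewrite expr1 /phi -mulrBr ler_pM2l// -ln_div ?posrE// ler_ln ?posrE ?divr_gt0
    ?mulr_gt0 ?addr_gt0 ?mulr_gt0//.
  rewrite ler_pdivrMr// mulrAC ler_pdivlMr ?addr_gt0 ?mulr_gt0//; nra.
have := phi_le0 _ (tk J.+1); lra.
Qed.

End LogUpper.

(** * Galois bounded sequences of matrices *)

Section ConjAlgnum.
Variable R : realType.
Local Notation L := (algnum R).

Lemma conjC_algnum (z : R[i]) : z \in @algnum_pred R -> conjC z \in @algnum_pred R.
Proof.
move=> /asboolP[p p0 pz]; apply/asboolP; exists p => //.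
apply/eqP; have /eqP := pz; rewrite /root => /(congr1 conjC); rewrite rmorph0.
rewrite -horner_map -map_poly_comp => h.
rewrite -[RHS]h; congr (_.[_]); apply: eq_map_poly => q /=.
by rewrite fmorph_rat.
Qed.

Definition conjL (z : L) : L := AlgNum (conjC_algnum (valP z)).

Fact conjL_zmod_morphism : zmod_morphism conjL.
Proof.
move=> x y; apply: (val_inj : injective (\val : L -> R[i])).
by rewrite /= !rmorphB.
Qed.

Fact conjL_monoid_morphism : monoid_morphism conjL.
Proof.
split; first by apply: (val_inj : injective (\val : L -> R[i]));
  rewrite /= !rmorph1.
by move=> x y; apply: (val_inj : injective (\val : L -> R[i])); rewrite /= !rmorphM.
Qed.

HB.instance Definition _ := GRing.isZmodMorphism.Build L L conjL
  conjL_zmod_morphism.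
HB.instance Definition _ := GRing.isMonoidMorphism.Build L L conjL
  conjL_monoid_morphism.

Lemma conjLK : involutive conjL.
Proof. by move=> z; apply: (val_inj : injective (\val : L -> R[i]));
  rewrite /= conjCK. Qed.

Lemma algebraic_integer_conj (z : R[i]) : algebraic_integer z ->
  algebraic_integer (conjC z).
Proof.
move=> [p pm /eqP pz]; exists p => //; apply/eqP.
move: pz => /(congr1 conjC); rewrite rmorph0.
rewrite -horner_map -map_poly_comp => h.
rewrite -[RHS]h; congr (_.[_]); apply: eq_map_poly => q /=.
by rewrite rmorph_int.
Qed.

Lemma algebraic_integer0 : algebraic_integer (0 : R[i]).
Proof. by exists 'X; rewrite ?monicX// map_polyX rootX. Qed.

End ConjAlgnum.

Section MatrixBound.
Variable R : realType.
Local Notation L := (algnum R).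

Definition cdot n (u v : 'cV[R[i]]_n) : R[i] := \sum_i u i 0 * conjC (v i 0).

Lemma cdot_lin n c (u v w : 'cV[R[i]]_n) : cdot (c *: u + v) w = c * cdot u w +
  cdot v w.
Proof.
rewrite /cdot big_distrr /= -big_split /=; apply: eq_bigr => i _.
by rewrite !mxE mulrDl mulrA.
Qed.

Lemma cdot_sym n (u v : 'cV[R[i]]_n) : cdot u v = conjC (cdot v u).
Proof.
rewrite /cdot rmorph_sum /=; apply: eq_bigr => i _.
by rewrite rmorphM /= conjCK mulrC.
Qed.

Lemma cdot_ge0 n (u : 'cV[R[i]]_n) : 0 <= cdot u u.
Proof. by apply: sumr_ge0 => i _; rewrite mul_conjC_ge0. Qed.

Definition csq n (u : 'cV[R[i]]_n) : R := ipsq (@cdot n) u.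

Lemma csq_ge0 n (u : 'cV[R[i]]_n) : 0 <= csq u.
Proof. exact: (ipsq_ge0 (@cdot_ge0 n)). Qed.

Lemma csqE n (u : 'cV[R[i]]_n) : csq u = \sum_i cabs (u i 0) ^+ 2.
Proof. by apply: complexI; rewrite -(ipsqE (@cdot_ge0 n)) rmorph_sum /=;
  apply: eq_bigr => i _; rewrite sqr_cabs. Qed.

Lemma csq_eq0 n (u : 'cV[R[i]]_n) : csq u = 0 -> u = 0.
Proof.
rewrite csqE => /eqP; rewrite psumr_eq0 => [/allP h|i _]; last exact: sqr_ge0.
apply/colP => i; rewrite mxE; apply/eqP; rewrite -cabs_eq0.
by have := h i (mem_index_enum _); rewrite sqrf_eq0.
Qed.

Lemma cdot_adj m n (A : 'M[R[i]]_(m, n)) u v :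
  cdot (A *m u) v = cdot u (A^t* *m v).
Proof.
rewrite /cdot.
under eq_bigr do rewrite mxE mulr_suml.
under [RHS]eq_bigr do rewrite mxE rmorph_sum mulr_sumr.
rewrite exchange_big /=; apply: eq_bigr => j _; apply: eq_bigr => i _.
by rewrite !mxE rmorphM /= conjCK mulrCA mulrA.
Qed.

(* [c] bounds the square of the operator norm. *)
Definition bdd m n (A : 'M[R[i]]_(m, n)) (c : R) :=
  0 <= c /\ forall u, csq (A *m u) <= c * csq u.

Lemma csqD n (u v : 'cV[R[i]]_n) : csq (u + v) <= 2 * csq u + 2 * csq v.
Proof.
have := csq_ge0 (u - v); rewrite /csq !(ipsqD (@cdot_lin n) (@cdot_sym n)).
rewrite (ipNr (@cdot_lin n) (@cdot_sym n)) ReN.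
have -> : ipsq (@cdot n) (- v) = ipsq (@cdot n) v.
  by rewrite /ipsq (ipNl (@cdot_lin n)) (ipNr (@cdot_lin n) (@cdot_sym n)) opprK.
lra.
Qed.

Lemma bddD m n (A B : 'M[R[i]]_(m, n)) a b : bdd A a -> bdd B b ->
  bdd (A + B) (2 * a + 2 * b).
Proof.
move=> [a0 hA] [b0 hB]; split; first lra.
move=> u; rewrite mulmxDl; apply: le_trans (csqD _ _) _.
by have := hA u; have := hB u; lra.
Qed.

Lemma bddM m n p (A : 'M[R[i]]_(m, n)) (B : 'M[R[i]]_(n, p)) a b :
  bdd A a -> bdd B b -> bdd (A *m B) (a * b).
Proof.
move=> [a0 hA] [b0 hB]; split; first exact: mulr_ge0.
move=> u; rewrite -mulmxA; apply: le_trans (hA _) _.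
by rewrite -mulrA ler_wpM2l.
Qed.

Lemma bdd_adj m n (A : 'M[R[i]]_(m, n)) a : bdd A a -> bdd (A^t*) a.
Proof.
move=> [a0 hA]; split => // u; set v := A^t* *m u.
have := Cauchy_Schwarz (@cdot_lin m) (@cdot_sym m) (@cdot_ge0 m) (A *m v) u.
rewrite cdot_adj -/v (ipsqE (@cdot_ge0 n)) cabsC ger0_norm ?csq_ge0// -!/(csq _)
  => h.
have [v0|v0] := eqVneq (csq v) 0; first by rewrite v0 mulr_ge0// csq_ge0.
have v1 : 0 < csq v by rewrite lt_def v0 csq_ge0.
rewrite -(ler_pM2l v1) -expr2; apply: (le_trans h).
rewrite mulrA ler_wpM2r ?csq_ge0// mulrC; exact: hA.
Qed.

Lemma csqZ n c (u : 'cV[R[i]]_n) : csq (c *: u) = cabs c ^+ 2 * csq u.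
Proof. exact: (ipsqZ (@cdot_lin n) (@cdot_sym n) (@cdot_ge0 n)). Qed.

Lemma bdd_scalar n c : bdd (c%:M : 'M[R[i]]_n) (cabs c ^+ 2).
Proof. by split; [exact: sqr_ge0|move=> u; rewrite mul_scalar_mx csqZ]. Qed.

Lemma bdd_exists m n (A : 'M[R[i]]_(m, n)) : exists c, bdd A c.
Proof.
pose r i : 'cV[R[i]]_n := \col_j conjC (A i j).
exists (\sum_i csq (r i)); split; first by apply: sumr_ge0 => i _; exact: csq_ge0.
move=> u; rewrite [leLHS]csqE mulr_suml; apply: ler_sum => i _.
have -> : (A *m u) i 0 = cdot u (r i).
  by rewrite mxE; apply: eq_bigr => j _; rewrite mxE conjCK mulrC.
rewrite mulrC.
exact: (Cauchy_Schwarz (@cdot_lin n) (@cdot_sym n) (@cdot_ge0 n)).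
Qed.

Lemma bdd_opnorm n (A : 'M[R[i]]_n) c : 0 <= c -> opnorm A <= c -> bdd A (c ^+ 2).
Proof.
move=> c0 Ac; split; first exact: sqr_ge0.
have l2E (v : 'cV[R[i]]_n) : l2norm v = Num.sqrt (csq v) by rewrite csqE.
have [K [K0 hK]] := bdd_exists A.
have ub : has_ubound [set l2norm (A *m v) | v in [set v | l2norm v <= 1]].
  exists (Num.sqrt K) => _ [v /= v1 <-]; rewrite l2E ler_sqrt//.
  apply: le_trans (hK v) _; rewrite -[leRHS]mulr1 ler_wpM2l//.
  by move: v1; rewrite l2E -[leRHS]sqrtr1 ler_sqrt.
move=> u; have [u0|u0] := eqVneq (csq u) 0.
  by rewrite (csq_eq0 u0) mulmx0 -(csq_eq0 u0) u0 mulr0.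
have u1 : 0 < csq u by rewrite lt_def u0 csq_ge0.
pose a := (Num.sqrt (csq u))^-1; have a0 : 0 < a by rewrite invr_gt0 sqrtr_gt0.
have a2 : a ^+ 2 = (csq u)^-1 by rewrite exprVn sqr_sqrtr// ltW.
have : l2norm (A *m (a%:C *: u)) <= c.
  apply: le_trans Ac; apply: ub_le_sup => //; exists (a%:C *: u) => //=.
  by rewrite l2E csqZ cabsC (ger0_norm (ltW a0)) a2 mulVf// sqrtr1.
rewrite l2E -scalemxAr csqZ cabsC (ger0_norm (ltW a0)) a2.
rewrite -ler_sqr ?nnegrE ?sqrtr_ge0// sqr_sqrtr; last first.
  by rewrite mulr_ge0 ?csq_ge0// invr_ge0 csq_ge0.
by rewrite mulrC ler_pdivrMr.
Qed.

End MatrixBound.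

Section GaloisBoundedSequences.
Variable R : realType.
Local Notation L := (algnum R).
Local Notation val := (@algnum_val R).
Local Notation vmx := (map_mx val).

Definition adjL m n (A : 'M[L]_(m, n)) : 'M[L]_(n, m) := map_mx (@conjL R) A^T.

Definition gal_bounded (p q : nat -> nat) (Y : forall k, 'M[L]_(p k, q k)) : Prop :=
  [/\ forall k i j, algebraic_integer (val (Y k i j)),
      exists c, forall k (s : {rmorphism L -> L}), bdd (vmx (map_mx s (Y k))) c
    & exists N, forall k, exists f : {rmorphism L -> L} -> 'I_N,
        forall s t, f s = f t -> map_mx s (Y k) = map_mx t (Y k)].

Lemma pair_code N N' (f : {rmorphism L -> L} -> 'I_N) (f' : {rmorphism L ->
  L} -> 'I_N') :
  exists g : {rmorphism L -> L} -> 'I_(#|{: 'I_N * 'I_N'}|),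
    forall s t, g s = g t -> f s = f t /\ f' s = f' t.
Proof.
exists (fun s => enum_rank (f s, f' s)) => s t /enum_rank_inj[-> ->].
by [].
Qed.

Lemma gal_boundedD p q (Y Z : forall k, 'M[L]_(p k, q k)) :
  gal_bounded Y -> gal_bounded Z -> gal_bounded (fun k => Y k + Z k).
Proof.
move=> [iY [c cY] [N NY]] [iZ [c' cZ] [N' NZ]]; split.
- by move=> k i j; rewrite mxE rmorphD /=; apply: integral_add;
  [exact: iY|exact: iZ].
- by exists (2 * c + 2 * c') => k s; rewrite !map_mxD; apply: bddD;
  [exact: cY|exact: cZ].
- exists #|{: 'I_N * 'I_N'}| => k; have [f fP] := NY k; have [f' fP'] := NZ k.
  have [g gP] := pair_code f f'; exists g => s t /gP[/fP h /fP' h'].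
  by rewrite !map_mxD h h'.
Qed.

Lemma gal_boundedM p q r (Y : forall k, 'M[L]_(p k, q k)) (Z : forall k,
  'M[L]_(q k, r k)) :
  gal_bounded Y -> gal_bounded Z -> gal_bounded (fun k => Y k *m Z k).
Proof.
move=> [iY [c cY] [N NY]] [iZ [c' cZ] [N' NZ]]; split.
- move=> k i j; rewrite mxE rmorph_sum /=; elim/big_ind: _ => [|x y|l _].
  + exact: algebraic_integer0.
  + by apply: integral_add.
  + by rewrite ?rmorphM /=; apply: integral_mul; [exact: iY|exact: iZ].
- by exists (c * c') => k s; rewrite !map_mxM; apply: bddM; [exact: cY|exact: cZ].
- exists #|{: 'I_N * 'I_N'}| => k; have [f fP] := NY k; have [f' fP'] := NZ k.
  have [g gP] := pair_code f f'; exists g => s t /gP[/fP h /fP' h'].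
  by rewrite !map_mxM h h'.
Qed.

Lemma gal_boundedJ p q (Y : forall k, 'M[L]_(p k, q k)) :
  gal_bounded Y -> gal_bounded (fun k => adjL (Y k)).
Proof.
move=> [iY [c cY] [N NY]].
pose cs (s : {rmorphism L -> L}) : {rmorphism L -> L} :=
  @conjL R \o (s \o @conjL R).
have csE m n (s : {rmorphism L -> L}) (A : 'M[L]_(m, n)) :
    map_mx s (adjL A) = adjL (map_mx (cs s) A).
  by apply/matrixP => i j; rewrite !mxE /= conjLK.
split.
- by move=> k i j; rewrite !mxE; apply: algebraic_integer_conj; exact: iY.
- exists c => k s; rewrite csE.
  have -> : vmx (adjL (map_mx (cs s) (Y k))) = (vmx (map_mx (cs s) (Y k)))^t*.
    by apply/matrixP => i j; rewrite !mxE.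
  by apply: bdd_adj; exact: cY.
- exists N => k; have [f fP] := NY k; exists (fun s => f (cs s)) => s t /fP h.
  by rewrite !csE h.
Qed.

Lemma gal_bounded_scalar p (b : L) : algebraic_integer (val b) ->
  gal_bounded (fun k => b%:M : 'M[L]_(p k)).
Proof.
move=> bi; have [P P0 Pb] := algnum_algebraic b.
pose PL := map_poly (intr : int -> L) P.
have PL0 : PL != 0 by rewrite map_intpoly_eq0//; exact: algnum_charL.
have Ps (s : {rmorphism L -> L}) : root PL (s b).
  apply/eqP; rewrite -(rmorph0 s) -Pb -horner_map -map_poly_comp.
  by congr (_.[_]); apply: eq_map_poly => z /=; rewrite rmorph_int.
have [rs rsP] : exists rs : seq L, forall x, root PL x -> x \in rs.
  have [zs Pzs] := closed_field_poly_normal (map_poly val PL).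
  exists [seq insubd 0 z | z <- zs] => x Px; apply/mapP; exists (val x); last first.
    by rewrite -[val x]/(\val x) valKd.
  have : root (map_poly val PL) (val x) by rewrite fmorph_root.
  rewrite Pzs rootZ ?root_prod_XsubC// lead_coef_map fmorph_eq0 lead_coef_eq0//.
split.
- move=> k i j; rewrite mxE; case: eqP => _; first by rewrite mulr1n.
  by rewrite mulr0n rmorph0; exact: algebraic_integer0.
- exists (\sum_(x <- rs) cabs (val x) ^+ 2) => k s; rewrite !map_scalar_mx.
  have [_ h] := bdd_scalar (p k) (val (s b)); split.
    by apply: sumr_ge0 => x _; exact: sqr_ge0.
  move=> u; apply: le_trans (h u) _; rewrite ler_wpM2r ?csq_ge0//.
  rewrite (perm_big _ (perm_to_rem (rsP _ (Ps s)))) big_cons lerDl.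
  by apply: sumr_ge0 => x _; exact: sqr_ge0.
- exists (size rs).+1 => k; exists (fun s => inord (index (s b) rs)) => s t.
  move=> /(congr1 (@nat_of_ord _)); rewrite !inordK ?ltnS ?index_size// => h.
  rewrite !map_scalar_mx; congr (_%:M).
  by rewrite -(nth_index 0 (rsP _ (Ps s))) h nth_index ?rsP.
Qed.

Lemma gal_bounded0 p q : gal_bounded (fun k => 0 : 'M[L]_(p k, q k)).
Proof.
split.
- by move=> k i j; rewrite mxE rmorph0; exact: algebraic_integer0.
- exists 0 => k s; rewrite !map_mx0; split => // u.
  by rewrite mul0mx mul0r csqE big1// => i _;
    rewrite mxE -[0]/(0%:C) cabsC normr0 expr0n.
- by exists 1%N => k; exists (fun=> ord0) => s t _; rewrite !map_mx0.
Qed.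

Lemma gal_bounded_ext p q (Y Z : forall k, 'M[L]_(p k, q k)) :
  (forall k, Y k = Z k) -> gal_bounded Y -> gal_bounded Z.
Proof.
move=> YZ; suff -> : Z = Y by [].
by apply: functional_extensionality_dep => k; rewrite YZ.
Qed.

Lemma gal_bounded_sum p q (I : eqType) (r : seq I) (Y : I ->
  forall k, 'M[L]_(p k, q k)) :
  (forall i, i \in r -> gal_bounded (Y i)) ->
    gal_bounded (fun k => \sum_(i <- r) Y i k).
Proof.
elim: r => [|i r IH] hY.
  by apply: gal_bounded_ext (@gal_bounded0 p q) => k; rewrite big_nil.
apply: (@gal_bounded_ext _ _ (fun k => Y i k + \sum_(j <- r) Y j k)) => [k|].
  by rewrite big_cons.
apply: gal_boundedD; first by apply: hY; rewrite mem_head.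
by apply: IH => j jr; apply: hY; rewrite inE jr orbT.
Qed.

Lemma galois_bounded_lift (d : nat -> nat) (X : forall k, 'M[R[i]]_(d k)) :
  galois_bounded X -> exists2 Y : forall k, 'M[L]_(d k), gal_bounded Y &
    forall k, vmx (Y k) = X k.
Proof.
move=> [iX [c cX] [N NX]].
have aX k i j : X k i j \in @algnum_pred R.
  have [p pm pz] := iX k i j; apply/asboolP; exists (map_poly intr p).
    by rewrite map_poly_eq0_id0 ?lead_coef_eq0 ?monic_neq0// (eqP pm) rmorph1
      oner_eq0.
  rewrite -map_poly_comp; move: pz; congr (root _ _).
  by apply: eq_map_poly => z /=; rewrite ratr_int.
pose Y k : 'M[L]_(d k) := map_mx (insubd 0) (X k).
have XY k : vmx (Y k) = X k.
  by apply/matrixP => i j; rewrite !mxE; apply: (insubdK 0 (aX k i j)).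
have gX k s : galois_mx s (X k) = vmx (map_mx s (Y k)).
  by apply/matrixP => i j; rewrite !mxE.
exists Y => //; split.
- by move=> k i j; have := iX k i j; rewrite -[X k]XY mxE.
- exists (`|c| ^+ 2) => k s; rewrite -gX; apply: bdd_opnorm => //.
  by apply: le_trans (ler_norm _); apply: cX; exact: galois_groupP.
- exists N => k; have /pcard_leP[f] := NX k.
  have fN (s : {rmorphism L -> L}) : (f (galois_mx s (X k)) < N)%N.
    by apply: (@funS _ _ _ _ f); exists s => //; exact: galois_groupP.
  exists (fun s => Ordinal (fN s)) => s t /(congr1 (@nat_of_ord _)) /= fst.
  have /(_ _ _ _ _ fst) := @inj _ _ _ f; rewrite !gX => h.
  have {}h : vmx (map_mx s (Y k)) = vmx (map_mx t (Y k)).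
    apply: h; apply/mem_set.
      by exists s; [exact: galois_groupP|rewrite gX].
    by exists t; [exact: galois_groupP|rewrite gX].
  apply/matrixP => i j; apply: (val_inj : injective (\val : L -> R[i])).
  by have /matrixP/(_ i j) := h; rewrite !mxE.
Qed.

End GaloisBoundedSequences.

(** * Characteristic polynomials *)

Section CharPoly.

Lemma char_poly_root_eigenvector (F : fieldType) n (A : 'M[F]_n) a :
  root (char_poly A) a -> exists2 v : 'cV[F]_n, v != 0 & A *m v = a *: v.
Proof.
move=> ra; have : \det (a%:M - A) == 0.
  move: ra; rewrite -eigenvalue_root_char => /eigenvalueP[v Av v0].
  apply/det0P; exists v => //.
  by rewrite mulmxBr Av mul_mx_scalar subrr.
rewrite -det_tr => /det0P[v v0 vA]; exists v^T.
  by rewrite trmx_eq0.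
move/(congr1 trmx): vA; rewrite trmx_mul trmxK trmx0 mulmxBl mul_scalar_mx.
by move/eqP; rewrite subr_eq0 => /eqP.
Qed.

Lemma char_poly_conj (F : fieldType) n (P D : 'M[F]_n) : P \in unitmx ->
  char_poly (invmx P *m D *m P) = char_poly D.
Proof.
move=> Pu; rewrite /char_poly.
have -> : char_poly_mx (invmx P *m D *m P) =
    map_mx polyC (invmx P) *m char_poly_mx D *m map_mx polyC P.
  rewrite /char_poly_mx !map_mxM /= mulmxBr mulmxBl; congr (_ - _).
  by rewrite mul_mx_scalar -scalemxAl -map_mxM mulVmx// map_mx1 scalemx1.
rewrite !det_mulmx mulrAC -det_mulmx -map_mxM mulVmx// map_mx1 det1 mul1r.
by [].
Qed.

Definition algint_pred (R : realType) : {pred algnum R} :=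
  [pred x | `[< algebraic_integer (algnum_val x) >] ].

Lemma algint_subring_closed (R : realType) : subring_closed (@algint_pred R).
Proof.
split.
- by apply/asboolP; rewrite rmorph1; exact: (integral1 intr).
- move=> x y /asboolP hx /asboolP hy; apply/asboolP; rewrite rmorphB.
  exact: integral_sub.
- move=> x y /asboolP hx /asboolP hy; apply/asboolP; rewrite rmorphM.
  exact: integral_mul.
Qed.

HB.instance Definition _ (R : realType) :=
  GRing.isSubringClosed.Build (algnum R) (@algint_pred R)
    (@algint_subring_closed R).

Lemma integral_char_poly (R : realType) n (A : 'M[algnum R]_n) i :
  (forall i j, algebraic_integer (algnum_val (A i j))) ->
  algebraic_integer (algnum_val (char_poly A)`_i).
Proof.
move=> iA.
suff /polyOverP/(_ i)/asboolP : char_poly A \is a polyOver (@algint_pred R) by [].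
rewrite /char_poly /determinant; apply: rpred_sum => s _; apply: rpredM.
  by rewrite rpredX// rpredN rpred1.
apply: rpred_prod => j _; rewrite !mxE rpredB// ?rpredMn ?polyOverX//.
by rewrite polyOverC; apply/asboolP.
Qed.

Variable R : realType.

Lemma coef_prod_XsubC_le (rs : seq R[i]) (b : R) i : 0 <= b ->
  (forall r, r \in rs -> cabs r <= b) ->
  cabs (\prod_(r <- rs) ('X - r%:P))`_i <= (1 + b) ^+ size rs.
Proof.
move=> b0; elim: rs i => [|r rs IH] i hrs.
  rewrite big_nil expr0 coefC; case: eqP => _.
    by rewrite -[1]/(1%:C) cabsC normr1.
  by rewrite -[0]/(0%:C) cabsC normr0.
have {}IH j : cabs (\prod_(r <- rs) ('X - r%:P))`_j <= (1 + b) ^+ size rs.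
  by apply: IH => x xrs; apply: hrs; rewrite inE xrs orbT.
rewrite big_cons mulrBl coefB coefXM coefCM exprS mulrDl mul1r.
apply: le_trans (cabsD _ _) _; apply: lerD.
  case: eqP => _; last exact: IH.
  by rewrite -[0]/(0%:C) cabsC normr0 exprn_ge0// addr_ge0.
have -> : forall z : R[i], cabs (- z) = cabs z.
  by move=> z; apply: complexI; rewrite -!cabsE normrN.
rewrite cabsM; apply: ler_pM; rewrite ?cabs_ge0//.
by apply: hrs; rewrite mem_head.
Qed.

Lemma root_char_poly_le n (A : 'M[R[i]]_n) c r : bdd A c -> root (char_poly A) r ->
  cabs r <= 1 + c.
Proof.
move=> [c0 hA] /char_poly_root_eigenvector[v v0 Av].
have v1 : 0 < csq v.
  by rewrite lt_def csq_ge0 andbT; apply: contra_neq v0 => /csq_eq0.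
have := hA v; rewrite Av csqZ ler_pM2r// => h.
have := cabs_ge0 r; nra.
Qed.

Lemma coef_char_poly_le n (A : 'M[R[i]]_n) c i : bdd A c ->
  cabs (char_poly A)`_i <= (2 + c) ^+ n.
Proof.
move=> Ac; have [rs Ars] := closed_field_poly_normal (char_poly A).
rewrite (eqP (char_poly_monic A)) scale1r in Ars.
have srs : size rs = n.
  by have := size_char_poly A; rewrite Ars size_prod_XsubC => -[].
rewrite Ars -srs (_ : 2 + c = 1 + (1 + c)); last by rewrite addrA.
apply: coef_prod_XsubC_le; first by case: Ac => c0 _; rewrite addr_ge0.
by move=> r; rewrite -root_prod_XsubC -Ars; exact: root_char_poly_le.
Qed.

End CharPoly.

Section HermitianTrace.
Variable R : realType.

Lemma hermitian_diagonalization n (A : 'M[R[i]]_n) : A^t* = A ->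
  exists (P : 'M[R[i]]_n) (d : 'rV[R[i]]_n), P \in unitmx /\
    A = invmx P *m diag_mx d *m P.
Proof.
move=> hA; exists (spectralmx A), (spectral_diag A); split;
  first exact: spectral_unit.
by apply/orthomx_spectralP/normalmxP; rewrite hA.
Qed.

Lemma mxtrace_conj_exp n (P : 'M[R[i]]_n) (d : 'rV[R[i]]_n) j : P \in unitmx ->
  \tr ((invmx P *m diag_mx d *m P) ^+ j) = \sum_i d 0 i ^+ j.
Proof.
move=> Pu; have -> : (invmx P *m diag_mx d *m P) ^+ j =
    invmx P *m diag_mx (\row_i d 0 i ^+ j) *m P.
  elim: j => [|j IH].
    rewrite expr0 (_ : \row_i _ = const_mx 1).
      by rewrite diag_const_mx mulmx1 mulVmx.
    by apply/rowP => i; rewrite !mxE expr0.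
  rewrite exprS IH -mulmxE -!mulmxA mulKVmx//; congr (_ *m _).
  rewrite mulmxA mulmx_diag; congr (diag_mx _ *m _).
  by apply/rowP => i; rewrite !mxE exprS.
rewrite mxtrace_mulC mulmxA mulmxV// mul1mx mxtrace_diag.
by apply: eq_bigr => i _; rewrite mxE.
Qed.

Lemma qlog_trace n (A : 'M[R[i]]_n) (P : 'M[R[i]]_n) (d : 'rV[R[i]]_n) (a :
  R[i]) J :
  P \in unitmx -> A = invmx P *m diag_mx d *m P ->
  \tr (qlog J (1%:M - a *: A)) = \sum_i qlog J (1 - a * d 0 i).
Proof.
move=> Pu AE; have -> : 1%:M - a *: A =
    invmx P *m diag_mx (\row_i (1 - a * d 0 i)) *m P.
  have -> : diag_mx (\row_i (1 - a * d 0 i)) = 1%:M - a *: diag_mx d.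
    by apply/matrixP => i j; rewrite !mxE; case: eqP => [->|_];
      rewrite ?mulr1n ?mulr0n ?mulr0 ?subr0.
  by rewrite mulmxBr mulmxBl mulmx1 mulVmx// -scalemxAr -scalemxAl -AE.
rewrite /qlog raddf_sum [RHS]exchange_big; apply: eq_bigr => k _.
rewrite raddfB /= !mxtrace_conj_exp// sumrB; congr (_ - _);
  by apply: eq_bigr => i _; rewrite mxE.
Qed.

Lemma qlog_real J (x : R) : qlog J (x%:C : R[i]) = (qlog J x)%:C.
Proof. by rewrite /qlog rmorph_sum; apply: eq_bigr => k _;
  rewrite rmorphB !rmorphXn. Qed.

Lemma qlog1 J : qlog J (1 : R) = 0.
Proof. by rewrite /qlog big1// => k _; rewrite !expr1n subrr. Qed.

End HermitianTrace.

(** * Traces of Galois bounded sequences *)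

Section GaloisBoundedTrace.
Variable R : realType.
Local Notation L := (algnum R).
Local Notation val := (@algnum_val R).
Local Notation vmx := (map_mx val).

Lemma char_poly_coef_prod n (d : 'I_n -> R[i]) :
  (\prod_i ('X - (d i)%:P))`_#|[pred i | d i == 0]| = \prod_(i | d i != 0) - d i.
Proof.
rewrite (bigID (fun i => d i == 0)) /= (eq_bigr (fun=> 'X)) => [|i /eqP ->];
  last first.
  by rewrite subr0.
rewrite prodr_const coefXnM ltnn subnn -horner_coef0 horner_prod.
by apply: eq_bigr => i _; rewrite hornerXsubC sub0r.
Qed.

Lemma gal_bounded_log_det (p q : nat -> nat) (B : forall k, 'M[L]_(p k, q k)) :
  gal_bounded B -> exists2 K, 0 <= K & forall k (d : 'I_(q k) -> R),
    char_poly ((vmx (B k))^t* *m vmx (B k)) = \prod_i ('X - ((d i)%:C)%:P) ->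
    (forall i, 0 <= d i) ->
    - K * (q k)%:R <= \sum_(i | d i != 0) ln (d i).
Proof.
move=> hB; have [iA [c cA] [N NA]] := gal_boundedM (gal_boundedJ hB) hB.
have c0 : 0 <= c by case: (cA 0%N idfun).
have K0 : 0 <= ln (2 + c) * N%:R by rewrite mulr_ge0// ln_ge0//; lra.
exists (ln (2 + c) * N%:R) => // k d.
set A := adjL (B k) *m B k.
have -> : (vmx (B k))^t* *m vmx (B k) = vmx A.
  rewrite /A map_mxM; congr (_ *m _).
  by apply/matrixP => i j; rewrite !mxE.
move=> Ad d0.
pose z := #|[pred i | (d i)%:C == 0 :> R[i]]|.
pose a := (char_poly A)`_z.
have aE : val a = \prod_(i | (d i)%:C != 0 :> R[i]) - (d i)%:C.
  by rewrite -char_poly_coef_prod -Ad -map_char_poly coef_map.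
have na : `|val a| = (\prod_(i | d i != 0) d i)%:C.
  rewrite aE normr_prod rmorph_prod; apply: eq_big => i.
    by rewrite -(inj_eq (@complexI R)).
  by move=> _; rewrite normrN cabsE cabsC ger0_norm.
have prod_gt0 : 0 < \prod_(i | d i != 0) d i.
  by apply: prodr_gt0 => i di; rewrite lt_def di d0.
have [f fP] := NA k.
have h : 1 <= `|val a| * ((2 + c) ^+ q k)%:C ^+ N.
  apply: (@conjugate_norm_bound _ _ _ _ f).
  - by apply/eqP => a0; move: prod_gt0; rewrite -ltcR -na a0 rmorph0 normr0 ltxx.
  - exact: integral_char_poly.
  - by rewrite exprn_ege1//; lra.
  - move=> s; rewrite cabsE lecR.
    have -> : val (s a) = (char_poly (vmx (map_mx s A)))`_z.
      by rewrite -!map_char_poly !coef_map.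
    exact: coef_char_poly_le.
  - move=> s t /fP st; have := congr1 (fun X => (char_poly X)`_z) st.
    by rewrite -!map_char_poly !coef_map.
rewrite na -rmorphXn -rmorphM -[1]/(1%:C) lecR -exprM in h.
have l2 : 0 < 2 + c by lra.
have : 0 <= ln (\prod_(i | d i != 0) d i * (2 + c) ^+ (q k * N)).
  exact: ln_ge0.
rewrite lnM ?posrE ?exprn_gt0// lnXn// => h1.
have lnE : ln (\prod_(i | d i != 0) d i) = \sum_(i | d i != 0) ln (d i).
  have : (\prod_(i | d i != 0) d i > 0) /\
      ln (\prod_(i | d i != 0) d i) = \sum_(i | d i != 0) ln (d i).
    elim/big_rec2: _ => [|i x y di [y0 IH]]; first by rewrite ln1.
    have di0 : 0 < d i by rewrite lt_def di d0.
    by rewrite mulr_gt0// lnM ?posrE// IH.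
  by case.
by move: h1; rewrite lnE mulnC mulrnA -mulr_natr -[_ *+ N]mulr_natr; lra.
Qed.

Lemma cdot_adjl m n (A : 'M[R[i]]_(m, n)) u v : cdot (A^t* *m u) v = cdot u (A
  *m v).
Proof. by rewrite cdot_sym -cdot_adj -cdot_sym. Qed.

Theorem gal_bounded_trace (p q : nat -> nat) (B : forall k, 'M[L]_(p k, q k)) :
  gal_bounded B -> exists C0, forall C, C0 <= C -> exists K, forall k J,
    complex.Re (\tr (qlog J (1%:M - C^-1%:C *: ((vmx (B k))^t* *m vmx (B k)))))
      <= K * (q k)%:R.
Proof.
move=> hB; have [K K0 hK] := gal_bounded_log_det hB.
have [_ [c cB] _] := hB.
have c0 : 0 <= c by case: (cB 0%N idfun).
exists (1 + c) => C cC.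
have C1 : 1 <= C by lra.
have C0 : 0 < C by lra.
exists (2 * ln 2 + 2 * ln C + 2 * K) => k J.
set h := _ *m _.
have h_herm : h^t* = h.
  by rewrite /h trmx_mul map_mxM; congr (_ *m _); apply/matrixP => i j;
    rewrite !mxE /= ?conjCK.
have [P [d [Pu hE]]] := hermitian_diagonalization h_herm.
have hd : char_poly h = \prod_i ('X - (d 0 i)%:P).
  rewrite hE char_poly_conj// char_poly_trig ?diag_mx_is_trig//.
  by apply: eq_bigr => i _; rewrite mxE eqxx mulr1n.
have dP i : exists2 x : R, 0 <= x <= c & d 0 i = x%:C.
  have : root (char_poly h) (d 0 i).
    by rewrite hd /root horner_prod (bigD1 i)//= hornerXsubC subrr mul0r.
  move=> /char_poly_root_eigenvector[v v0 hv].
  have v1 : 0 < csq v.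
    by rewrite lt_def csq_ge0 andbT; apply: contra_neq v0 => /csq_eq0.
  have [_ hBv] := cB k idfun.
  have Bv : (csq (vmx (B k) *m v))%:C = d 0 i * (csq v)%:C.
    by rewrite /csq -!(ipsqE (@cdot_ge0 R _)) -(ipZl (@cdot_lin R _)) -hv /h
      -mulmxA cdot_adjl.
  exists (csq (vmx (B k) *m v) / csq v).
    rewrite divr_ge0 ?csq_ge0//= ler_pdivrMr//.
    by have := hBv v; rewrite map_mx_id.
  by rewrite rmorphM fmorphV /= Bv mulfK// -(rmorph0 (real_complex R)) (inj_eq
    (@complexI R)) gt_eqF.
have /choice[x xP] : forall i, exists x, 0 <= x <= c /\ d 0 i = x%:C.
  by move=> i; have [x ? ?] := dP i; exists x.
rewrite (qlog_trace _ _ Pu hE) Re_sum.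
have x_ge0 i : 0 <= x i by case: (xP i) => /andP[].
have := hK k x; rewrite -/h hd => /(_ _ x_ge0)/= hsum.
have {}hsum : - K * (q k)%:R <= \sum_(i | x i != 0) ln (x i).
  by apply: hsum; apply: eq_bigr => i _; case: (xP i) => _ ->.
have ln2 : 0 <= ln 2 :> R by rewrite ln_ge0// ler1n.
have lnC : 0 <= ln C by rewrite ln_ge0.
apply: (@le_trans _ _ (\sum_i ((2 * ln 2 + 2 * ln C) - 2 * (if x i != 0 then ln
  (x i) else 0)))).
  apply: ler_sum => i _; have [/andP[xi0 xic] ->] := xP i.
  rewrite -[1]/(1%:C) -rmorphM -rmorphB qlog_real /=.
  case: eqP => [->|/eqP xi] /=.
    by rewrite mulr0 subr0 qlog1 mulr0 subr0 addr_ge0// mulr_ge0.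
  have xi1 : 0 < x i by rewrite lt_def xi.
  apply: le_trans (qlog_upper _ _) _.
    rewrite mulr_gt0 ?invr_gt0//= mulrC ler_pdivrMr// mul1r; lra.
  rewrite lnM ?posrE ?invr_gt0// lnV ?posrE//; lra.
rewrite sumrB sumr_const card_ord -mulr_sumr -big_mkcond /= -mulr_natr; lra.
Qed.

End GaloisBoundedTrace.

(** * Transfer from microstates *)

Section WordCombinations.
Variables (R : realType) (r : nat).
Local Notation lincomb := (seq (R[i] * star_word r)).

Definition lin_eval (A : algType R[i]) (star : A -> A) (x : 'I_r ->
  A) (s : lincomb) : A :=
  \sum_(p <- s) p.1 *: eval_word star x p.2.

Definition lin_mul (s t : lincomb) : lincomb :=
  [seq (p.1 * q.1, p.2 ++ q.2) | p <- s, q <- t].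

Definition lin_star (s : lincomb) : lincomb :=
  [seq (conjC p.1, rev [seq (l.1, ~~ l.2) | l <- p.2]) | p <- s].

Record star_axioms (A : algType R[i]) (star : A -> A) : Prop := StarAxioms {
  sa_linear : forall c a b, star (c *: a + b) = conjC c *: star a + star b;
  sa_mul : forall a b, star (a * b) = star b * star a;
  sa_1 : star 1 = 1;
  sa_invol : involutive star }.

Variables (A : algType R[i]) (star : A -> A) (x : 'I_r -> A).
Hypothesis starP : star_axioms star.

Lemma lin_eval_cat s t : lin_eval star x (s ++ t) = lin_eval star x s + lin_eval
  star x t.
Proof. by rewrite /lin_eval big_cat. Qed.

Lemma lin_eval_scale c s : lin_eval star x [seq (c * p.1, p.2) | p <- s] = c *:
  lin_eval star x s.
Proof.
rewrite /lin_eval big_map scaler_sumr; apply: eq_bigr => p _.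
by rewrite scalerA.
Qed.

Lemma eval_word_cat v w : eval_word star x (v ++ w) = eval_word star x v *
  eval_word star x w.
Proof. by rewrite /eval_word big_cat. Qed.

Lemma lin_eval_mul s t : lin_eval star x (lin_mul s t) = lin_eval star x s *
  lin_eval star x t.
Proof.
rewrite /lin_eval /lin_mul big_allpairs_dep mulr_suml; apply: eq_bigr => p _.
rewrite mulr_sumr; apply: eq_bigr => q _.
by rewrite eval_word_cat -scalerAr -scalerAl scalerA mulrC.
Qed.

Lemma star_eval_word w :
  star (eval_word star x w) = eval_word star x (rev [seq (l.1, ~~ l.2) | l <- w]).
Proof.
elim: w => [|[i b] w IH]; first by rewrite /eval_word !big_nil sa_1.
have evalE l : eval_word star x [:: l] = if l.2 then star (x l.1) else x l.1.
  by rewrite /eval_word big_seq1.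
rewrite map_cons rev_cons -cats1 eval_word_cat -IH -cat1s eval_word_cat sa_mul//.
by congr (_ * _); rewrite !evalE /=; case: b; rewrite /= ?sa_invol.
Qed.

Lemma sa_0 : star 0 = 0.
Proof.
have := sa_linear starP (-1) 0 0.
by rewrite scaler0 addr0 rmorphN rmorph1 /= scaleN1r addNr.
Qed.

Lemma lin_eval_star s : lin_eval star x (lin_star s) = star (lin_eval star x s).
Proof.
rewrite /lin_eval /lin_star big_map; elim/big_rec2: _ => [|p a b _ ->].
  by rewrite sa_0.
by rewrite sa_linear// star_eval_word.
Qed.

Definition word_poly (w : star_word r) : star_poly R[i] r :=
  [fsfun v in [fset w]%fset => 1 | 0].

Lemma star_eval_word_poly w : star_eval id star x (word_poly w) = eval_word star
  x w.
Proof.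
have wE v : word_poly w v = if v == w then 1 else 0.
  by rewrite /word_poly fsfun_fun in_fset1.
have -> : star_eval id star x (word_poly w) =
    \sum_(v <- [fset w]%fset) word_poly w v *: eval_word star x v.
  rewrite /star_eval; congr (\sum_(v <- _) _).
  congr (enum_fset _); apply/fsetP => v; rewrite mem_finsupp wE in_fset1.
  by case: (v == w); rewrite /= ?oner_neq0 ?eqxx.
by rewrite big_seq_fset1 wE eqxx scale1r.
Qed.

End WordCombinations.

Section Transfer.
Variables (R : realType) (M : vonNeumannAlgebra R) (tau : {scalar M}).
Variables (r : nat) (x : 'I_r -> M) (d : nat -> nat).
Variable X : forall k, 'I_r -> 'M[R[i]]_((d k).+1).
Local Notation C := R[i].
Local Notation mstar := (fun A => A^t*).

Lemma vN_star_axioms : star_axioms (@vN_star R M).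
Proof.
split; [|exact: starM|exact: star1|exact: starK].
by move=> c a b; rewrite starD starZ.
Qed.

Lemma mx_star_axioms n : @star_axioms R 'M[R[i]]_n.+1 mstar.
Proof.
split => [c a b|a b||a].
- by apply/matrixP => i j; rewrite !mxE rmorphD rmorphM.
- by rewrite trmx_mul map_mxM.
- by rewrite trmx1 map_mx1.
- by apply/matrixP => i j; rewrite !mxE conjCK.
Qed.

(* [z] and the [Z k] are values of one *-polynomial with complex coefficients. *)
Definition same_poly (z : M) (Z : forall k, 'M[C]_((d k).+1)) : Prop :=
  exists s, z = lin_eval (@vN_star R M) x s /\ forall k, Z k = lin_eval mstar (X
    k) s.

Lemma same_poly0 : same_poly 0 (fun k => 0).
Proof. by exists [::]; split => [|k]; rewrite /lin_eval big_nil. Qed.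

Lemma same_poly1 : same_poly 1 (fun k => 1).
Proof. by exists [:: (1, [::])]; split => [|k];
  rewrite /lin_eval big_seq1 /eval_word big_nil scale1r. Qed.

Lemma same_polyD y Y z Z : same_poly y Y -> same_poly z Z ->
  same_poly (y + z) (fun k => Y k + Z k).
Proof.
move=> [s [-> hs]] [t [-> ht]]; exists (s ++ t); split => [|k].
  by rewrite lin_eval_cat.
by rewrite lin_eval_cat hs ht.
Qed.

Lemma same_polyM y Y z Z : same_poly y Y -> same_poly z Z ->
  same_poly (y * z) (fun k => Y k * Z k).
Proof.
move=> [s [-> hs]] [t [-> ht]]; exists (lin_mul s t); split => [|k].
  by rewrite lin_eval_mul.
by rewrite lin_eval_mul hs ht.
Qed.

Lemma same_polyZ c y Y : same_poly y Y -> same_poly (c *: y) (fun k => c *: Y k).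
Proof.
move=> [s [-> hs]]; exists [seq (c * p.1, p.2) | p <- s]; split => [|k].
  by rewrite lin_eval_scale.
by rewrite lin_eval_scale hs.
Qed.

Lemma same_polyN y Y : same_poly y Y -> same_poly (- y) (fun k => - Y k).
Proof.
move=> /(same_polyZ (-1))[s [hs ht]]; exists s; split => [|k].
  by rewrite -hs scaleN1r.
by rewrite -ht scaleN1r.
Qed.

Lemma same_poly_star y Y : same_poly y Y ->
  same_poly (vN_star y) (fun k => (Y k)^t*).
Proof.
move=> [s [-> hs]]; exists (lin_star s); split => [|k].
  by rewrite lin_eval_star//; exact: vN_star_axioms.
by rewrite lin_eval_star ?hs//; exact: mx_star_axioms.
Qed.

Lemma same_poly_sum (I : Type) (s : seq I) (y : I -> M) (Y : I ->
  forall k, 'M[C]_((d k).+1)) :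
  (forall i, same_poly (y i) (Y i)) ->
  same_poly (\sum_(i <- s) y i) (fun k => \sum_(i <- s) Y i k).
Proof.
move=> yY; elim: s => [|i s [t [h1 h2]]].
  by have [s [h1 h2]] := same_poly0; exists s; split => [|k]; rewrite big_nil.
have [u [h3 h4]] := same_polyD (yY i) (ex_intro _ t (conj h1 h2)).
by exists u; split => [|k]; rewrite big_cons// h3.
Qed.

Lemma same_poly_star_eval (K : nmodType) (iota : K -> C) (Q : star_poly K r) :
  same_poly (star_eval iota (@vN_star R M) x Q) (fun k => star_eval iota mstar
    (X k) Q).
Proof.
exists [seq (iota (Q w), w) | w <- finsupp Q]; split => [|k].
  by rewrite /lin_eval big_map.
by rewrite /lin_eval big_map.
Qed.

Hypothesis X_lim : forall Q : star_poly C r,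
  (fun k => normalized_trace (star_eval id mstar (X k) Q) : C^o) @ \oo -->
  (tau (star_eval id (@vN_star R M) x Q) : C^o).

Lemma same_poly_trace z Z : same_poly z Z ->
  (fun k => normalized_trace (Z k) : C^o) @ \oo --> (tau z : C^o).
Proof.
move=> [s [-> hs]].
have -> : (fun k => normalized_trace (Z k) : C^o) =
    (fun k => \sum_(p <- s) p.1 * normalized_trace (eval_word mstar (X k) p.2)).
  apply/funext => k; rewrite hs /normalized_trace /lin_eval raddf_sum mulr_suml.
  by apply: eq_bigr => p _; rewrite /= mxtraceZ mulrA.
rewrite /lin_eval linear_sum /=; elim: s {hs} => [|p s IH].
  under eq_fun do rewrite big_nil.
  by rewrite big_nil; exact: cvg_cst.
under eq_fun do rewrite big_cons.
have tauZ (c : C) y : tau (c *: y) = c * tau y by exact: linearZ.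
rewrite big_cons tauZ; apply: cvgD; last exact: IH.
apply: cvgM; first exact: cvg_cst.
have := @X_lim (word_poly R p.2); rewrite star_eval_word_poly.
by under eq_fun do rewrite star_eval_word_poly.
Qed.

End Transfer.

Section Flatten.
Variables (T : comNzRingType) (D : nat).

Definition flat m n (A : 'M['M[T]_D.+1]_(m, n)) :
  'M[T]_(\sum_(i < m) D.+1, \sum_(j < n) D.+1) := mxblock (fun i j => A i j).

Lemma flatM m n p (A : 'M['M[T]_D.+1]_(m, n)) (B : 'M['M[T]_D.+1]_(n, p)) :
  flat (A *m B) = flat A *m flat B.
Proof.
rewrite /flat (mul_mxblock (fun i j => A i j) (fun j k => B j k)).
by apply/eq_mxblock => i k; rewrite mxE.
Qed.

Lemma flatB m n (A B : 'M['M[T]_D.+1]_(m, n)) : flat (A - B) = flat A - flat B.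
Proof. by rewrite /flat -mxblockB; apply/eq_mxblock => i j; rewrite !mxE. Qed.

Lemma flatD m n (A B : 'M['M[T]_D.+1]_(m, n)) : flat (A + B) = flat A + flat B.
Proof. by rewrite /flat -mxblockD; apply/eq_mxblock => i j; rewrite !mxE. Qed.

Lemma flatZ m n c (A : 'M['M[T]_D.+1]_(m, n)) : flat (map_mx ( *:%R c) A) = c *:
  flat A.
Proof. by apply/matrixP => i j; rewrite !mxE. Qed.

Lemma flat0 m n : flat (0 : 'M['M[T]_D.+1]_(m, n)) = 0.
Proof. by rewrite -(subrr 0) flatB subrr. Qed.

Lemma flat_sum m n I (s : seq I) (F : I -> 'M['M[T]_D.+1]_(m, n)) :
  flat (\sum_(i <- s) F i) = \sum_(i <- s) flat (F i).
Proof.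
elim: s => [|i s IH]; first by rewrite !big_nil flat0.
by rewrite !big_cons flatD IH.
Qed.

Lemma flat1 n : flat (1%:M : 'M['M[T]_D.+1]_n) = 1%:M.
Proof.
rewrite -(mxdiagZ (p_ := fun _ : 'I_n => D.+1)) /mxdiag; apply/eq_mxblock => i j.
by rewrite mxE; case: eqP => _; rewrite ?conform_mx_id.
Qed.

Lemma flatX n (A : 'M['M[T]_D.+1]_n) k : flat (A ^+ k) = flat A ^+ k.
Proof.
elim: k => [|k IH]; first exact: flat1.
by rewrite !exprS -!mulmxE flatM IH.
Qed.

Lemma flat_qlog n (A : 'M['M[T]_D.+1]_n) J : flat (qlog J A) = qlog J (flat A).
Proof. by rewrite /qlog flat_sum; apply: eq_bigr => k _; rewrite flatB !flatX. Qed.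

Lemma flat_trace n (A : 'M['M[T]_D.+1]_n) : \tr (flat A) = \sum_i \tr (A i i).
Proof. exact: mxtrace_mxblock. Qed.

End Flatten.

Section GaloisBoundedBlocks.
Variable R : realType.
Local Notation L := (algnum R).
Local Notation val := (@algnum_val R).
Local Notation vmx := (map_mx val).

Definition block_col m D (i : 'I_m) : 'M[L]_(\sum_(i < m) D, D) :=
  mxcol (fun j : 'I_m => if j == i then 1%:M else 0 : 'M[L]_D).

Lemma gal_bounded_fixed (p q : nat -> nat) (Y : forall k, 'M[L]_(p k, q k)) c :
  (forall k i j, Y k i j = 0 \/ Y k i j = 1) -> (forall k, bdd (vmx (Y k)) c) ->
  gal_bounded Y.
Proof.
move=> Y01 Yc.
have sY k (s : {rmorphism L -> L}) : map_mx s (Y k) = Y k.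
  by apply/matrixP => i j; rewrite mxE; case: (Y01 k i j) => ->;
    rewrite ?rmorph0 ?rmorph1.
split.
- move=> k i j; case: (Y01 k i j) => ->; rewrite ?rmorph0 ?rmorph1.
    exact: algebraic_integer0.
  exact: (integral1 intr).
- by exists c => k s; rewrite sY.
- by exists 1%N => k; exists (fun=> ord0) => s t _; rewrite !sY.
Qed.

Lemma gal_bounded_block_col m (d : nat -> nat) (i : 'I_m) :
  gal_bounded (fun k => block_col (d k) i).
Proof.
apply: (@gal_bounded_fixed _ _ _ 1) => [k u v|k].
  rewrite mxE; case: eqP => _; rewrite !mxE; last by left.
  by case: eqP => _; [right|left].
split => // u; rewrite mul1r /csq /ipsq cdot_adj mulmxA.
suff -> : (vmx (block_col (d k) i))^t* *m vmx (block_col (d k) i) = 1%:M.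
  by rewrite mul1mx.
have -> : vmx (block_col (d k) i) =
    mxcol (fun j : 'I_m => if j == i then 1%:M else 0 : 'M[R[i]]_(d k)).
  apply/matrixP => a b; rewrite !mxE; case: eqP => _; rewrite !mxE ?rmorph0//.
  by rewrite rmorphMn rmorph1.
have -> : (mxcol (fun j : 'I_m => if j == i then 1%:M else 0 : 'M[R[i]]_(d k)))^t* =
    mxrow (fun j : 'I_m => if j == i then 1%:M else 0 : 'M[R[i]]_(d k)).
  apply/matrixP => a b; rewrite !mxE; case: eqP => _; rewrite !mxE ?rmorph0//.
  by rewrite eq_sym rmorphMn rmorph1.
rewrite mul_mxrow_mxcol (bigD1 i)//= eqxx mul1mx big1 ?addr0// => j /negPf ->.
by rewrite mul0mx.
Qed.

Lemma gal_bounded_block m n (d : nat -> nat)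
    (b : forall k, 'I_m -> 'I_n -> 'M[L]_(d k)) :
  (forall i j, gal_bounded (fun k => b k i j)) ->
  gal_bounded (fun k => mxblock (b k)).
Proof.
move=> hb.
apply: (@gal_bounded_ext _ _ _ (fun k => \sum_(ij <- index_enum ('I_m * 'I_n)%type)
    (block_col (d k) ij.1 *m b k ij.1 ij.2 *m adjL (block_col (d k) ij.2)))).
  move=> k; rewrite -(pair_bigA _ (fun i j => block_col (d k) i *m b k i j *m
    adjL (block_col (d k) j))) /=.
  have rE j : adjL (block_col (d k) j) = mxrow (fun j' : 'I_n => if j' == j then
    1%:M else 0 : 'M[L]_(d k)).
    apply/matrixP => u v; rewrite !mxE; case: eqP => _; rewrite !mxE ?rmorph0//.
    by rewrite eq_sym rmorphMn rmorph1.
  transitivity (\sum_i \sum_j mxblock (fun (i' : 'I_m) (j' : 'I_n) =>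
      (if i' == i then 1%:M else 0) *m b k i j *m (if j' == j then 1%:M else 0 :
        'M[L]_(d k)))).
    apply: eq_bigr => i _; apply: eq_bigr => j _.
    by rewrite rE /block_col mxcol_mul mul_mxcol_mxrow.
  pose e i j i' j' : 'M[L]_(d k) := (if i' == i then 1%:M else 0) *m b k i j *m
    (if j' == j then 1%:M else 0).
  transitivity (\sum_i mxblock (fun (i' : 'I_m) (j' : 'I_n) => \sum_j e i j i' j')).
    by apply: eq_bigr => i _; rewrite (mxblock_sum (fun j i' j' => e i j i' j')).
  rewrite -(mxblock_sum (fun i i' j' => \sum_j e i j i' j')).
  apply/eq_mxblock => i j; rewrite /e.
  rewrite (bigD1 i)//= (bigD1 j)//= !eqxx mul1mx mulmx1 big1 ?addr0 => [|j'
    j'j]; last first.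
    by rewrite eq_sym (negPf j'j) mulmx0.
  rewrite big1 ?addr0// => i' i'i; rewrite big1// => j' _.
  by rewrite eq_sym (negPf i'i) mul0mx mul0mx.
apply: gal_bounded_sum => -[i j] _ /=.
apply: gal_boundedM; last by apply: gal_boundedJ; exact: gal_bounded_block_col.
by apply: gal_boundedM; first exact: gal_bounded_block_col.
Qed.

End GaloisBoundedBlocks.

(** * The pseudo-determinant *)

Section Denominators.
Variable R : realType.
Local Notation L := (algnum R).

Lemma algebraic_integer_natM (z : L) n :
  algebraic_integer (algnum_val z) -> algebraic_integer (algnum_val (z * n%:R)).
Proof.
move=> hz; rewrite rmorphM rmorph_nat /=; apply: integral_mul => //.
exact: (integral_nat intr).
Qed.

Lemma common_denominator (s : seq L) : exists2 D : nat, (0 < D)%N &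
  forall z, z \in s -> algebraic_integer (algnum_val (z * D%:R)).
Proof.
elim: s => [|z s [D D0 hD]]; first by exists 1%N.
have [D' D'0 hD'] := algnum_denominator z.
exists (D * D')%N; first by rewrite muln_gt0 D0.
move=> y; rewrite inE natrM => /predU1P[->|ys].
  by rewrite [D%:R * _]mulrC mulrA; exact: algebraic_integer_natM.
by rewrite mulrA; apply: algebraic_integer_natM; exact: hD.
Qed.

Lemma star_poly_denominator r m n (P : 'M[star_poly L r]_(m, n)) :
  exists2 D : nat, (0 < D)%N &
    forall i j w, algebraic_integer (algnum_val (P i j w * D%:R)).
Proof.
have [D D0 hD] := common_denominator
  [seq P ij.1 ij.2 w | ij <- enum {: 'I_m * 'I_n}, w <- finsupp (P ij.1 ij.2)].
exists D => // i j w; have [wP|wP] := boolP (w \in finsupp (P i j)).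
  apply: hD; apply/allpairsPdep; exists (i, j), w; split => //.
  by rewrite mem_enum.
by rewrite fsfun_dflt// mul0r rmorph0; exact: algebraic_integer0.
Qed.

End Denominators.

Section MicrostateTrace.
Variables (R : realType) (r : nat) (d : nat -> nat).
Variable X : forall k, 'I_r -> 'M[R[i]]_((d k).+1).
Local Notation L := (algnum R).
Local Notation val := (@algnum_val R).
Local Notation vmx := (map_mx val).
Local Notation mstar := (fun A => A^t*).

Definition adjK k m n (A : 'M['M[R[i]]_((d k).+1)]_(m, n)) : 'M['M[R[i]]_((d
  k).+1)]_(n, m) :=
  map_mx mstar A^T.

Lemma flat_adj k m n (A : 'M['M[R[i]]_((d k).+1)]_(m, n)) : (flat A)^t* = flat
  (adjK A).
Proof. by apply/matrixP => i j; rewrite !mxE. Qed.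

Lemma star_poly_trace m n (P : 'M[star_poly L r]_(m, n)) :
  (forall j, galois_bounded (fun k => X k j)) ->
  exists2 C0 : R, 0 <= C0 & forall C, C0 <= C -> 0 < C -> exists K, forall k J,
    complex.Re (\sum_i \tr (qlog J (1%:M - map_mx ( *:%R C^-1%:C)
      (adjK (star_eval_mx val mstar (X k) P) *m star_eval_mx val mstar (X k) P))
        i i))
      <= K * (n * (d k).+1)%:R.
Proof.
move=> hX; have [D D0 hD] := star_poly_denominator P.
have /choice[Y0 hY0] : forall j, exists Y : forall k, 'M[L]_((d k).+1),
    gal_bounded Y /\ forall k, vmx (Y k) = X k j.
  by move=> j; have [Y ? ?] := galois_bounded_lift (hX j); exists Y.
pose Y k j := Y0 j k.
have wY w : gal_bounded (fun k => eval_word (@adjL R _ _) (Y k) w).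
  elim: w => [|l w IH].
    apply: (@gal_bounded_ext _ _ _ (fun k => (1 : L)%:M)) => [k|].
      by rewrite /eval_word big_nil.
    by apply: gal_bounded_scalar; rewrite rmorph1; exact: (integral1 intr).
  apply: (@gal_bounded_ext _ _ _ (fun k =>
      (if l.2 then adjL (Y k l.1) else Y k l.1) *m eval_word (@adjL R _ _) (Y k)
        w)).
    by move=> k; rewrite [RHS]/eval_word big_cons.
  apply: gal_boundedM => //; have [hl _] := hY0 l.1.
  by case: l.2 => //; exact: gal_boundedJ.
have wYX k w : vmx (eval_word (@adjL R _ _) (Y k) w) = eval_word mstar (X k) w.
  elim: w => [|l w IH]; first by rewrite /eval_word !big_nil; exact: map_mx1.
  rewrite /eval_word !big_cons -/(eval_word _ _ _) -/(eval_word _ _ _).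
  rewrite -!mulmxE map_mxM IH; congr (_ *m _).
  have [_ /(_ k) <-] := hY0 l.1; case: l.2 => //.
  by apply/matrixP => i j; rewrite !mxE.
pose b k i j : 'M[L]_((d k).+1) := \sum_(w <- finsupp (P i j))
  (P i j w * D%:R)%:M *m eval_word (@adjL R _ _) (Y k) w.
have bG i j : gal_bounded (fun k => b k i j).
  apply: gal_bounded_sum => w _; apply: gal_boundedM => //.
  by apply: gal_bounded_scalar; exact: hD.
have bX k i j : vmx (b k i j) = (D%:R : R[i]) *: star_eval val mstar (X k) (P i j).
  rewrite /b /star_eval scaler_sumr raddf_sum /=; apply: eq_bigr => w _.
  rewrite map_mxM wYX map_scalar_mx mul_scalar_mx scalerA; congr (_ *: _).
  by rewrite mulrC rmorphM rmorph_nat.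
have [C0 hC0] := gal_bounded_trace (gal_bounded_block bG).
exists `|C0| => // C CC0 Cpos.
pose D2 : R := D%:R ^+ 2.
have D2pos : 1 <= D2 by rewrite exprn_ege1// ler1n.
have [|K hK] := hC0 (D2 * C).
  apply: le_trans (ler_norm _) _; apply: (le_trans CC0).
  by rewrite ler_peMl// ltW.
exists K => k J; set y := star_eval_mx _ _ _ _; have := hK k J.
have -> : vmx (mxblock (b k)) = (D%:R : R[i]) *: flat y.
  rewrite /flat; apply/matrixP => u v; rewrite !mxE.
  by have /matrixP/(_ (tagged (tagnat.sig u)) (tagged (tagnat.sig v))) :=
    bX k (tag (tagnat.sig u)) (tag (tagnat.sig v)); rewrite !mxE.
have -> : ((D%:R : R[i]) *: flat y)^t* = (D%:R : R[i]) *: flat (adjK y).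
  by rewrite -flat_adj; apply/matrixP => u v; rewrite !mxE rmorphM rmorph_nat.
rewrite -scalemxAl -scalemxAr !scalerA -flatM.
have -> : (D2 * C)^-1%:C * D%:R * D%:R = C^-1%:C :> R[i].
  have -> : D%:R = (D%:R : R)%:C :> R[i] by rewrite rmorph_nat.
  rewrite -!rmorphM /=; congr (_%:C); rewrite /D2; field.
  by rewrite gt_eqF// pnatr_eq0 -lt0n.
rewrite -flatZ -flat1 -flatB -flat_qlog flat_trace => h.
by apply: (le_trans h); rewrite sum_nat_const card_ord.
Qed.

End MicrostateTrace.

Section MatrixTransfer.
Variables (R : realType) (M : vonNeumannAlgebra R) (tau : {scalar M}).
Variables (r : nat) (x : 'I_r -> M) (d : nat -> nat).
Variable X : forall k, 'I_r -> 'M[R[i]]_((d k).+1).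
Local Notation MC k := 'M[R[i]]_((d k).+1).

Definition same_poly_mx m n (A : 'M[M]_(m, n)) (B : forall k, 'M[MC k]_(m, n)) :
  Prop :=
  forall i j, same_poly x X (A i j) (fun k => B k i j).

Lemma same_poly_ext z (Y Z : forall k, MC k) : (forall k, Y k = Z k) ->
  same_poly x X z Y -> same_poly x X z Z.
Proof. by move=> YZ [s [h1 h2]]; exists s; split => // k; rewrite -YZ. Qed.

Lemma same_poly_mxM m n p (A : 'M[M]_(m, n)) (A' : 'M[M]_(n, p)) B B' :
  same_poly_mx A B -> same_poly_mx A' B' ->
  same_poly_mx (A *m A') (fun k => B k *m B' k).
Proof.
move=> hA hA' i j; rewrite mxE.
apply: (@same_poly_ext _ (fun k => \sum_l B k i l * B' k l j)) => [k|].
  by rewrite mxE.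
by apply: same_poly_sum => l; exact: same_polyM.
Qed.

Lemma same_poly_mxB m n (A A' : 'M[M]_(m, n)) B B' :
  same_poly_mx A B -> same_poly_mx A' B' ->
    same_poly_mx (A - A') (fun k => B k - B' k).
Proof.
move=> hA hA' i j; rewrite !mxE.
apply: (@same_poly_ext _ (fun k => B k i j - B' k i j)) => [k|].
  by rewrite !mxE.
by apply: same_polyD => //; exact: same_polyN.
Qed.

Lemma same_poly_mxD m n (A A' : 'M[M]_(m, n)) B B' :
  same_poly_mx A B -> same_poly_mx A' B' ->
    same_poly_mx (A + A') (fun k => B k + B' k).
Proof.
move=> hA hA' i j; rewrite !mxE.
apply: (@same_poly_ext _ (fun k => B k i j + B' k i j)) => [k|].
  by rewrite !mxE.
exact: same_polyD.
Qed.

Lemma same_poly_mxZ m n c (A : 'M[M]_(m, n)) B :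
  same_poly_mx A B -> same_poly_mx (vscale c A) (fun k => map_mx ( *:%R c) (B k)).
Proof.
move=> hA i j; rewrite !mxE.
apply: (@same_poly_ext _ (fun k => c *: B k i j)) => [k|]; first by rewrite !mxE.
exact: same_polyZ.
Qed.

Lemma same_poly_mx_adj m n (A : 'M[M]_(m, n)) B :
  same_poly_mx A B -> same_poly_mx (vN_adjmx A) (fun k => adjK (B k)).
Proof.
move=> hA i j; rewrite !mxE.
apply: (@same_poly_ext _ (fun k => (B k j i)^t*)) => [k|]; first by rewrite !mxE.
exact: same_poly_star.
Qed.

Lemma same_poly_mx1 n : same_poly_mx (1%:M : 'M[M]_n) (fun k => 1%:M).
Proof.
move=> i j; rewrite !mxE.
apply: (@same_poly_ext _ (fun k => if i == j then 1 else 0)) => [k|].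
  by rewrite !mxE; case: (i == j).
by case: (i == j); [exact: same_poly1|exact: same_poly0].
Qed.

Lemma same_poly_mx0 n : same_poly_mx (0 : 'M[M]_n) (fun k => 0).
Proof.
move=> i j; rewrite !mxE; apply: (@same_poly_ext _ (fun k => 0)) => [k|].
  by rewrite !mxE.
exact: same_poly0.
Qed.

Lemma same_poly_mxX n (A : 'M[M]_n) B l :
  same_poly_mx A B -> same_poly_mx (A ^+ l) (fun k => B k ^+ l).
Proof.
move=> hA; elim: l => [|l IH]; first exact: same_poly_mx1.
move=> i j; rewrite exprS -mulmxE.
apply: (@same_poly_ext _ (fun k => (B k *m B k ^+ l) i j)) => [k|].
  by rewrite exprS -mulmxE.
exact: same_poly_mxM.
Qed.

Lemma same_poly_mx_qlog n (A : 'M[M]_n) B J :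
  same_poly_mx A B -> same_poly_mx (qlog J A) (fun k => qlog J (B k)).
Proof.
move=> hA; rewrite /qlog.
elim: (index_enum _) => [|l s IH] i j.
  rewrite big_nil; apply: (@same_poly_ext _ (fun k => (0 : 'M[MC k]_n) i j)) =>
    [k|].
    by rewrite big_nil.
  exact: same_poly_mx0.
rewrite big_cons.
apply: (@same_poly_ext _ (fun k => ((B k ^+ (2 * 2 ^ l) - B k ^+ (2 * 4 ^ J)) +
    \sum_(l <- s) (B k ^+ (2 * 2 ^ l) - B k ^+ (2 * 4 ^ J))) i j)) => [k|].
  by rewrite big_cons.
apply: same_poly_mxD IH i j; apply: same_poly_mxB; exact: same_poly_mxX.
Qed.

Hypothesis X_lim : forall Q : star_poly R[i] r,
  (fun k => normalized_trace (star_eval id (fun A => A^t*) (X k) Q) : R[i]^o) @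
    \oo -->
  (tau (star_eval id (@vN_star R M) x Q) : R[i]^o).

Lemma same_poly_mx_mtr_le n (A : 'M[M]_n) B K : same_poly_mx A B ->
  (forall k, complex.Re (\sum_i \tr (B k i i)) <= K * (n * (d k).+1)%:R) ->
  mtr tau A <= K * n%:R.
Proof.
move=> AB hB.
have : (fun k => \sum_i normalized_trace (B k i i) : R[i]^o) @ \oo -->
    (\sum_i tau (A i i) : R[i]^o).
  elim: (index_enum _) => [|i s IH].
    under eq_fun do rewrite big_nil.
    by rewrite big_nil; exact: cvg_cst.
  under eq_fun do rewrite big_cons.
  rewrite big_cons; apply: cvgD; last exact: IH.
  exact: (same_poly_trace X_lim (AB i i)).
move=> /cvgrPdist_le h; apply/ler_addgt0Pr => e e0.
have [|N _ /(_ N (leqnn N))/= hN] := h e%:C; first by rewrite ltcR.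
set s := \sum_i tau (A i i) in hN *; set t := \sum_i normalized_trace _ in hN.
have -> : mtr tau A = complex.Re t + complex.Re (s - t) by rewrite -ReD addrC subrK.
apply: lerD.
  have -> : t = ((d N).+1%:R^-1)%:C * \sum_i \tr (B N i i).
    rewrite mulr_sumr; apply: eq_bigr => i _.
    by rewrite /normalized_trace mulrC fmorphV rmorph_nat.
  rewrite ReZ mulrC ler_pdivrMr// -mulrA -natrM; exact: hB.
apply: le_trans (ler_norm _) _; apply: le_trans (Re_le_cabs _) _.
by rewrite -lecR -cabsE.
Qed.

End MatrixTransfer.

Theorem theorem2 (R : realType) (M : vonNeumannAlgebra R) (tau : {scalar M})
    (tauP : faithful_normal_tracial_state tau)
    (r : nat) (x : 'I_r -> M)
    (x_gen : vN_generates x)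
    (x_gal : has_galois_bounded_microstates tau x)
    (m n : nat) (P : 'M[star_poly (algnum R) r]_(m, n)) (d : \bar R)
    (dP : is_FK_pseudodet tau
            (star_eval_mx (@algnum_val R) (@vN_star R M) x P) d) :
  (0 < d)%E.
Proof.
case: dP => a [mu [[[b ab] aa] [E aE muE] ->]].
apply: expeR_gt0.
have [n0|n0] := posnP n.
  by rewrite n0 mul0e ltNyr.
suff main : (-oo < \int[mu]_(t in `]0%R, +oo[) (ln t)%:E)%E.
  move: main; case: (\int[mu]_(t in _) _)%E => [s| |] //.
    by move=> _; rewrite -EFinM ltNyr.
  by move=> _; rewrite gt0_muley ?lte_fin ?ltr0n.
case: x_gal => e [X [Xgal Xlim]].
set y := star_eval_mx _ _ _ _ in aa.
have a_adj : vN_adjmx a = a by rewrite ab adjmxM adjmxK.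
have a_ge0 u : 0 <= mip (act a u) u.
  by rewrite ab actM act_adj adjmxK mip_ge0.
have [K K0 aK] := bnd_exists a.
have [C0 C0pos hC0] := star_poly_trace P Xgal.
pose C := 2 + K ^+ 2 + C0.
have K2 : 0 <= K ^+ 2 by exact: sqr_ge0.
have C2 : 2 <= C by rewrite /C -addrA lerDl addr_ge0.
have C_gt0 : 0 < C by lra.
have [|K1 hK1] := hC0 C _ C_gt0; first by rewrite /C lerDr addr_ge0.
have aC u : mnorm (act a u) ^+ 2 <= C * mnorm u ^+ 2.
  apply: (@le_trans _ _ (K ^+ 2 * mnorm u ^+ 2)).
    by rewrite -exprMn ler_sqr ?nnegrE ?mulr_ge0 ?mnorm_ge0//; exact: aK.
  by rewrite ler_wpM2r ?sqr_ge0// /C; lra.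
have yX : same_poly_mx x X y (fun k => star_eval_mx (@algnum_val R) (fun A =>
  A^t*) (X k) P).
  move=> i j; rewrite mxE; have := same_poly_star_eval x X (@algnum_val R) (P i j).
  by apply: same_poly_ext => k; rewrite mxE.
have trq J : mtr tau (qlog J (1%:M - vscale C^-1%:C (a *m a))) <= K1 * n%:R.
  rewrite aa.
  apply: (same_poly_mx_mtr_le Xlim) (hK1^~ J).
  apply: same_poly_mx_qlog; apply: same_poly_mxB; first exact: same_poly_mx1.
  apply: same_poly_mxZ; apply: same_poly_mxM => //; exact: same_poly_mx_adj.
have muE' B : measurable B -> mu B = (mtr tau (E B) / n%:R)%:E.
  move=> mB; rewrite muE// /vN_mxtrace; congr (_%:E).
  have -> : n%:R^-1 = (n%:R^-1 : R)%:C :> R[i] by rewrite fmorphV rmorph_nat.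
  by rewrite mulrC ReZ mulrC.
have mD i : measurable (@dyadic R i) by exact: measurable_itv.
apply: (@integral_ln_gtNy _ _ (K1 + 2)) => [B mB|I].
  by rewrite muE'.
have hmu i : fine (mu (dyadic i)) = mtr tau (E (dyadic i)) / n%:R.
  by rewrite muE'.
have hsum : \sum_(i < I) (i%:R - 1) * fine (mu (dyadic i)) <= K1.
  have [J hJ] := qlog_dyadic tauP a_adj a_ge0 aE C2 aC I.
  have : \sum_(i < I) (i%:R - 1) * mtr tau (E (dyadic i)) <= K1 * n%:R.
    exact: le_trans hJ (trq J).
  rewrite -ler_pdivrMr ?ltr0n// mulr_suml; apply: le_trans.
  by apply: ler_sum => i _; rewrite hmu mulrA.
have hone : \sum_(i < I) fine (mu (dyadic i)) <= 1.
  rewrite -lee_fin -sumEFin.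
  have -> : (\sum_(i < I) (fine (mu (dyadic i)))%:E = \sum_(i < I) mu (dyadic i))%E.
    by apply: eq_bigr => i _; rewrite muE'.
  rewrite -(big_mkord xpredT (fun i => mu (dyadic i))).
  have := @measure_bigcup _ _ _ mu setT (@dyadic R) (fun i _ => mD i)
    (@dyadic_trivIset R).
  have -> : (1%:E = mu setT)%E.
    have [_ E1 _ _] := aE; rewrite muE'// E1 mtr1// divff// pnatr_eq0 -lt0n //.
  move=> hU; apply: (@le_trans _ _ (mu (\bigcup_i dyadic i))); last first.
    by apply: le_measure; rewrite ?inE//; exact: bigcupT_measurable.
  rewrite hU; apply: (@le_trans _ _ (\sum_(0 <= i <oo) mu (dyadic i))%E).
    by apply: nneseries_lim_ge.
  by under [leRHS]eq_eseriesl do rewrite in_setT.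
have -> : \sum_(i < I) i.+1%:R * fine (mu (dyadic i)) =
  \sum_(i < I) (i%:R - 1) * fine (mu (dyadic i)) + 2 * \sum_(i < I) fine (mu
    (dyadic i)).
  rewrite mulr_sumr -big_split /=; apply: eq_bigr => i _.
  rewrite -addn1 natrD; ring.
lra.
Qed.
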